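(* Let $0<a\le b$ and let $\mathcal{R}_{a,b}$ be a rectangle of side lengths $a$ and $b$, divided by a diagonal into two congruent right-angled triangles (sharing their hypotenuse). Let $P_1$ and $P_2$ be independent random points, one uniformly distributed in each of the two triangles, and let $g_2$ and $G_2$ denote respectively the density function and the distribution function of the distance between $P_1$ and $P_2$. Then $$g_2=2\,g_{\mathcal{R}}-g\qquad\text{and}\qquad G_2=2\,G_{\mathcal{R}}-G,$$ where $g_{\mathcal{R}},G_{\mathcal{R}}$ (density and distribution function of the distance between two independent uniformly distributed random points in $\mathcal{R}_{a,b}$) and $g,G$ (density and distribution function of the distance between two independent uniformly distributed random points in one of the triangles) are the explicit functions given in the context.
   Context: Put $c=\sqrt{a^2+b^2}$, $\alpha=\arctan(a/b)$, $u=a+b+c$, $\tilde A=ab/2$, $h=a\cos\alpha$, $A_{\mathcal{R}}=ab$, $u_{\mathcal{R}}=2(a+b)$. For $t\ge x>0$ put $$L_1^*(t,x)=\tfrac12\Bigl(x\sqrt{t^2-x^2}+t^2\arcsin\tfrac xt\Bigr),\qquad L_2^*(t,x)=\sqrt{t^2-x^2}+x\arcsin\tfrac xt,$$ $$L_1^\natural(t,x)=\tfrac18\Bigl[\tfrac{5x}{3}(t^2-x^2)^{3/2}+x^3\sqrt{t^2-x^2}+t^4\arcsin\tfrac xt\Bigr],$$ $$L_2^\natural(t,x)=\tfrac13(t^2-x^2)^{3/2}+\tfrac x2\Bigl(x\sqrt{t^2-x^2}+t^2\arcsin\tfrac xt\Bigr).$$ Rectangle. $g_{\mathcal{R}}(t)=\frac{2t}{A_{\mathcal{R}}^2}J_{\mathcal{R}}^*(t)$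 if $0\le t\le c$ and $g_{\mathcal{R}}(t)=0$ otherwise, where $J_{\mathcal{R}}^*(t)$ equals $\pi A_{\mathcal{R}}-u_{\mathcal{R}}t+t^2$ if $0\le t<a$; $-a^2-2bt+2bL_2^*(t,a)$ if $a\le t<b$; $-(\pi A_{\mathcal{R}}+c^2)-t^2+2bL_2^*(t,a)+2aL_2^*(t,b)$ if $b\le t\le c$. $G_{\mathcal{R}}(t)=0$ if $t<0$, $G_{\mathcal{R}}(t)=\frac{2}{A_{\mathcal{R}}^2}J_{\mathcal{R}}^\natural(t)$ if $0\le t<c$, $G_{\mathcal{R}}(t)=1$ if $t\ge c$, where $$J_{\mathcal{R}}^\natural(t)=\begin{cases}J_{\mathcal{R},1}^\natural(0,t) & \text{if } 0\le t<a,\\ J_{\mathcal{R},1}^\natural(0,a)+J_{\mathcal{R},2}^\natural(a,t) & \text{if } a\le t<b,\\ J_{\mathcal{R},1}^\natural(0,a)+J_{\mathcal{R},2}^\natural(a,b)+J_{\mathcal{R},3}^\natural(b,t) & \text{if } b\le t<c,\end{cases}$$ $J_{\mathcal{R},k}^\natural(s,t)=H_{\mathcal{R},k}^\natural(t)-H_{\mathcal{R},k}^\natural(s)$, and $$H_{\mathcal{R},1}^\natural(t)=\frac{\pi A_{\mathcal{R}}t^2}{2}-\frac{u_{\mathcal{R}}t^3}{3}+\frac{t^4}{4},\qquad H_{\mathcal{R},2}^\natural(t)=-\frac{a^2t^2}{2}-\frac{2bt^3}{3}+2bL_2^\natural(t,a),$$ $$H_{\mathcal{R},3}^\natural(t)=-\frac{(\pi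 A_{\mathcal{R}}+c^2)t^2}{2}-\frac{t^4}{4}+2bL_2^\natural(t,a)+2aL_2^\natural(t,b).$$ Triangle. Constants: $$\Theta_1=\frac ab(2\alpha+\pi)+\frac{2b}{a}(\pi-\alpha)+6,\quad \Theta_2=\frac ab(2\alpha-\pi)-\frac{2b}{a}\alpha+6,\quad \Theta_3=\frac ab+\frac ba,$$ $$\Theta_4=1-\frac ba\alpha,\quad \Theta_5=a+b,\quad \Theta_6=\frac ab(2\alpha-\pi)-\frac{2b}{a}\alpha+2 .$$ $g(t)=\frac{2t}{\tilde A}\bigl[\pi+\frac1{\tilde A}(J^*(t)-ut)\bigr]$ if $0\le t\le c$ and $g(t)=0$ otherwise, where $$J^*(t)=\begin{cases}J_1^*(0,t) & \text{if } 0\le t<h,\\ J_1^*(0,h)+J_2^*(h,t) & \text{if } h\le t<a,\\ J_1^*(0,h)+J_2^*(h,a)+J_3^*(a,t) & \text{if } a\le t<b,\\ J_1^*(0,h)+J_2^*(h,a)+J_3^*(a,b)+J_4^*(b,t) & \text{if } b\le t\le c,\end{cases}$$ $J_k^*(s,t)=H_k^*(t)-H_k^*(s)$, and $$H_1^*(t)=\frac{\Theta_1t^2}{8},\qquad H_2^*(t)=\frac{\Theta_2t^2}{8}+\Theta_3L_1^*(t,h)+c\,L_2^*(t,h),$$ $$H_3^*(t)=at+\frac{\Theta_4t^2}{2}+\frac{\Theta_3}{2}L_1^*(t,h)+\frac c2L_2^*(t,h)+\frac{b}{2a}L_1^*(t,a)+\frac b2L_2^*(t,a),$$ $$H_4^*(t)=\Theta_5t+\frac{\Theta_6t^2}{8}+\frac{b}{2a}L_1^*(t,a)+\frac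 b2L_2^*(t,a)+\frac{a}{2b}L_1^*(t,b)+\frac a2L_2^*(t,b).$$ $G(t)=0$ if $t<0$, $G(t)=\frac1{\tilde A}\bigl[t^2\bigl(\pi-\frac{2u}{3\tilde A}t\bigr)+\frac2{\tilde A}J^\natural(t)\bigr]$ if $0\le t<c$, $G(t)=1$ if $t\ge c$, where $$J^\natural(t)=\begin{cases}K_1(t) & \text{if } 0\le t<h,\\ K_1(h)+K_2(t) & \text{if } h\le t<a,\\ K_1(h)+K_2(a)+K_3(t) & \text{if } a\le t<b,\\ K_1(h)+K_2(a)+K_3(b)+K_4(t) & \text{if } b\le t<c,\end{cases}$$ $$K_1(t)=J_1^\natural(0,t),\qquad K_2(t)=\tfrac12(t^2-h^2)[J_1^*(0,h)-H_2^*(h)]+J_2^\natural(h,t),$$ $$K_3(t)=\tfrac12(t^2-a^2)[J_1^*(0,h)+J_2^*(h,a)-H_3^*(a)]+J_3^\natural(a,t),$$ $$K_4(t)=\tfrac12(t^2-b^2)[J_1^*(0,h)+J_2^*(h,a)+J_3^*(a,b)-H_4^*(b)]+J_4^\natural(b,t),$$ $J_k^\natural(s,t)=H_k^\natural(t)-H_k^\natural(s)$, and $$H_1^\natural(t)=\frac{\Theta_1t^4}{32},\qquad H_2^\natural(t)=\frac{\Theta_2t^4}{32}+\Theta_3L_1^\natural(t,h)+c\,L_2^\natural(t,h),$$ $$H_3^\natural(t)=\frac{at^3}{3}+\frac{\Theta_4t^4}{8}+\frac{\Theta_3}{2}L_1^\natural(t,h)+\frac c2L_2^\natural(t,h)+\frac{b}{2a}L_1^\natural(t,a)+\frac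 b2L_2^\natural(t,a),$$ $$H_4^\natural(t)=\frac{\Theta_5t^3}{3}+\frac{\Theta_6t^4}{32}+\frac{b}{2a}L_1^\natural(t,a)+\frac b2L_2^\natural(t,a)+\frac{a}{2b}L_1^\natural(t,b)+\frac a2L_2^\natural(t,b).$$ *)

(* Defs.v *)
From HB Require Import structures.
From mathcomp Require Import all_boot all_order all_algebra.
From mathcomp Require Import all_classical all_reals all_analysis.
From mathcomp Require Import measurable_realfun.

Set Implicit Arguments.
Unset Strict Implicit.
Unset Printing Implicit Defensive.

Import Order.TTheory GRing.Theory Num.Theory.
Import numFieldNormedType.Exports.

Local Open Scope classical_set_scope.
Local Open Scope ring_scope.

(* Planar geometry. The norm that the library puts on [R * R] is the sup norm,
   so the Euclidean distance is written out in coordinates. *)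

Definition eucl_dist (R : realType) (p q : R * R) : R :=
  Num.sqrt ((p.1 - q.1) ^+ 2 + (p.2 - q.2) ^+ 2).

(* [A B C D] are the consecutive vertices of a rectangle with |AB| = a and
   |AD| = b, in an arbitrary position and orientation; [B D] is a diagonal. *)
Definition is_rectangle (R : realType) (a b : R) (A B C D : R * R) : Prop :=
  [/\ eucl_dist A B = a,
      eucl_dist A D = b,
      (B.1 - A.1) * (D.1 - A.1) + (B.2 - A.2) * (D.2 - A.2) = 0 &
      C = (B.1 + D.1 - A.1, B.2 + D.2 - A.2)].

(* The closed parallelogram with vertices A, B, B + D - A, D. *)
Definition parallelogram (R : realType) (A B D : R * R) : set (R * R) :=
  [set p | exists s t : R, [/\ 0 <= s <= 1, 0 <= t <= 1 &
    p = (A.1 + s * (B.1 - A.1) + t * (D.1 - A.1),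
         A.2 + s * (B.2 - A.2) + t * (D.2 - A.2))]].

(* The closed triangle (convex hull of three points). *)
Definition triangle (R : realType) (A B C : R * R) : set (R * R) :=
  [set p | exists x y z : R,
    [/\ 0 <= x, 0 <= y, 0 <= z, x + y + z = 1 &
     p = (x * A.1 + y * B.1 + z * C.1, x * A.2 + y * B.2 + z * C.2)]].

Definition lebesgue2 (R : realType) : set (R * R) -> \bar R :=
  (@lebesgue_measure R \x @lebesgue_measure R)%E.

Definition uniform_on (R : realType) d (T : measurableType d)
    (P : probability T R) (S : set (R * R))
    (X : {RV P >-> (R * R)%type}) : Prop :=
  forall B : set (R * R), measurable B ->
    distribution P X B
    = (lebesgue2 (B `&` S) * ((fine (lebesgue2 S))^-1)%:E)%E.

Definition independent_RV (R : realType) d (T : measurableType d)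
    d1 (T1 : measurableType d1) d2 (T2 : measurableType d2)
    (P : probability T R) (X : {RV P >-> T1}) (Y : {RV P >-> T2}) : Prop :=
  forall (B1 : set T1) (B2 : set T2), measurable B1 -> measurable B2 ->
    P (X @^-1` B1 `&` Y @^-1` B2) = (P (X @^-1` B1) * P (Y @^-1` B2))%E.

Definition is_density (R : realType) d (T : measurableType d)
    (P : probability T R) (X : {RV P >-> R}) (f : R -> R) : Prop :=
  [/\ measurable_fun setT f, (forall t, 0 <= f t) &
      forall B : set R, measurable B ->
        distribution P X B = (\int[lebesgue_measure]_(t in B) (f t)%:E)%E].

Arguments uniform_on {R d T} P S X.
Arguments independent_RV {R d T d1 T1 d2 T2} P X Y.
Arguments is_density {R d T} P X f.

Section distance.
Context (R : realType) d (T : measurableType d).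
Implicit Types X Y : {mfun T >-> (R * R)%type}.

Definition distance X Y : T -> R := fun w => eucl_dist (X w) (Y w).

Let measurable_distance X Y : measurable_fun setT (distance X Y).
Proof.
have msqrt : measurable_fun setT (@Num.sqrt R).
  by apply: continuous_measurable_fun; exact: sqrt_continuous.
apply: (measurableT_comp msqrt).
by apply: measurable_funD; apply: measurable_funX;
  apply: measurable_funB; exact: measurableT_comp.
Qed.

HB.instance Definition _ X Y :=
  isMeasurableFun.Build _ _ _ _ (distance X Y) (measurable_distance X Y).

End distance.

(* For independent random points X, uniform in S1, and Y, uniform in S2, the
   distance between X and Y has density f and distribution function F. *)
Definition distance_law (R : realType) (S1 S2 : set (R * R)) (f F : R -> R) :
    Prop :=
  forall d (T : measurableType d) (P : probability T R)
    (X Y : {RV P >-> (R * R)%type}),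
    uniform_on P S1 X -> uniform_on P S2 Y -> independent_RV P X Y ->
    is_density P (distance X Y) f /\
    (forall t : R, cdf (P := P) (distance X Y) t = (F t)%:E).

(* Explicit formulas. The suffixes s and n stand for the superscripts
   "star" and "natural". The final R in AR, uR, gR, GR, J..R and H..R refers to
   the rectangle; the other constants and functions refer to the triangle. *)

Section L_functions.
Context (R : realType).
Implicit Types t x : R.

Definition L1s t x : R :=
  1 / 2 * (x * Num.sqrt (t ^+ 2 - x ^+ 2) + t ^+ 2 * asin (x / t)).

Definition L2s t x : R :=
  Num.sqrt (t ^+ 2 - x ^+ 2) + x * asin (x / t).

Definition L1n t x : R :=
  1 / 8 * (5 * x / 3 * (t ^+ 2 - x ^+ 2) `^ (3 / 2)
           + x ^+ 3 * Num.sqrt (t ^+ 2 - x ^+ 2)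
           + t ^+ 4 * asin (x / t)).

Definition L2n t x : R :=
  1 / 3 * (t ^+ 2 - x ^+ 2) `^ (3 / 2)
  + x / 2 * (x * Num.sqrt (t ^+ 2 - x ^+ 2) + t ^+ 2 * asin (x / t)).

End L_functions.

Section explicit_formulas.
Context (R : realType) (a b : R).

(* hypot is the length c of the diagonal, AT the area (A tilde), uT the
   perimeter u and hT the height h of the triangle. *)
Definition hypot : R := Num.sqrt (a ^+ 2 + b ^+ 2).
Definition alpha : R := atan (a / b).
Definition uT : R := a + b + hypot.
Definition AT : R := a * b / 2.
Definition hT : R := a * cos alpha.
Definition AR : R := a * b.
Definition uR : R := 2 * (a + b).

Definition JsR (t : R) : R :=
  if t < a then pi * AR - uR * t + t ^+ 2
  else if t < b then - a ^+ 2 - 2 * b * t + 2 * b * L2s t a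
  else - (pi * AR + hypot ^+ 2) - t ^+ 2 + 2 * b * L2s t a + 2 * a * L2s t b.

Definition gR (t : R) : R :=
  if 0 <= t <= hypot then 2 * t / AR ^+ 2 * JsR t else 0.

Definition H1nR (t : R) : R :=
  pi * AR * t ^+ 2 / 2 - uR * t ^+ 3 / 3 + t ^+ 4 / 4.

Definition H2nR (t : R) : R :=
  - (a ^+ 2 * t ^+ 2 / 2) - 2 * b * t ^+ 3 / 3 + 2 * b * L2n t a.

Definition H3nR (t : R) : R :=
  - ((pi * AR + hypot ^+ 2) * t ^+ 2 / 2) - t ^+ 4 / 4
  + 2 * b * L2n t a + 2 * a * L2n t b.

Definition J1nR (s t : R) : R := H1nR t - H1nR s.
Definition J2nR (s t : R) : R := H2nR t - H2nR s.
Definition J3nR (s t : R) : R := H3nR t - H3nR s.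

Definition JnR (t : R) : R :=
  if t < a then J1nR 0 t
  else if t < b then J1nR 0 a + J2nR a t
  else J1nR 0 a + J2nR a b + J3nR b t.

Definition GR (t : R) : R :=
  if t < 0 then 0 else if t < hypot then 2 / AR ^+ 2 * JnR t else 1.

Definition Theta1 : R :=
  a / b * (2 * alpha + pi) + 2 * b / a * (pi - alpha) + 6.
Definition Theta2 : R := a / b * (2 * alpha - pi) - 2 * b / a * alpha + 6.
Definition Theta3 : R := a / b + b / a.
Definition Theta4 : R := 1 - b / a * alpha.
Definition Theta5 : R := a + b.
Definition Theta6 : R := a / b * (2 * alpha - pi) - 2 * b / a * alpha + 2.

Definition H1s (t : R) : R := Theta1 * t ^+ 2 / 8.

Definition H2s (t : R) : R :=
  Theta2 * t ^+ 2 / 8 + Theta3 * L1s t hT + hypot * L2s t hT.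

Definition H3s (t : R) : R :=
  a * t + Theta4 * t ^+ 2 / 2 + Theta3 / 2 * L1s t hT + hypot / 2 * L2s t hT
  + b / (2 * a) * L1s t a + b / 2 * L2s t a.

Definition H4s (t : R) : R :=
  Theta5 * t + Theta6 * t ^+ 2 / 8
  + b / (2 * a) * L1s t a + b / 2 * L2s t a
  + a / (2 * b) * L1s t b + a / 2 * L2s t b.

Definition J1s (s t : R) : R := H1s t - H1s s.
Definition J2s (s t : R) : R := H2s t - H2s s.
Definition J3s (s t : R) : R := H3s t - H3s s.
Definition J4s (s t : R) : R := H4s t - H4s s.

Definition Js (t : R) : R :=
  if t < hT then J1s 0 t
  else if t < a then J1s 0 hT + J2s hT t
  else if t < b then J1s 0 hT + J2s hT a + J3s a t
  else J1s 0 hT + J2s hT a + J3s a b + J4s b t.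

Definition gT (t : R) : R :=
  if 0 <= t <= hypot
  then 2 * t / AT * (pi + 1 / AT * (Js t - uT * t)) else 0.

Definition H1n (t : R) : R := Theta1 * t ^+ 4 / 32.

Definition H2n (t : R) : R :=
  Theta2 * t ^+ 4 / 32 + Theta3 * L1n t hT + hypot * L2n t hT.

Definition H3n (t : R) : R :=
  a * t ^+ 3 / 3 + Theta4 * t ^+ 4 / 8
  + Theta3 / 2 * L1n t hT + hypot / 2 * L2n t hT
  + b / (2 * a) * L1n t a + b / 2 * L2n t a.

Definition H4n (t : R) : R :=
  Theta5 * t ^+ 3 / 3 + Theta6 * t ^+ 4 / 32
  + b / (2 * a) * L1n t a + b / 2 * L2n t a
  + a / (2 * b) * L1n t b + a / 2 * L2n t b.

Definition J1n (s t : R) : R := H1n t - H1n s.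
Definition J2n (s t : R) : R := H2n t - H2n s.
Definition J3n (s t : R) : R := H3n t - H3n s.
Definition J4n (s t : R) : R := H4n t - H4n s.

Definition K1 (t : R) : R := J1n 0 t.

Definition K2 (t : R) : R :=
  1 / 2 * (t ^+ 2 - hT ^+ 2) * (J1s 0 hT - H2s hT) + J2n hT t.

Definition K3 (t : R) : R :=
  1 / 2 * (t ^+ 2 - a ^+ 2) * (J1s 0 hT + J2s hT a - H3s a) + J3n a t.

Definition K4 (t : R) : R :=
  1 / 2 * (t ^+ 2 - b ^+ 2) * (J1s 0 hT + J2s hT a + J3s a b - H4s b)
  + J4n b t.

Definition Jn (t : R) : R :=
  if t < hT then K1 t
  else if t < a then K1 hT + K2 t
  else if t < b then K1 hT + K2 a + K3 t
  else K1 hT + K2 a + K3 b + K4 t.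

Definition GT (t : R) : R :=
  if t < 0 then 0
  else if t < hypot
  then 1 / AT * (t ^+ 2 * (pi - 2 * uT / (3 * AT) * t)
                     + 2 / AT * Jn t)
  else 1.

End explicit_formulas.

(* Main.v *)
Require Import Defs.
From HB Require Import structures.
From mathcomp Require Import all_boot all_order all_algebra.
From mathcomp Require Import all_classical all_reals all_analysis.
From mathcomp Require Import measurable_realfun.
From mathcomp Require Import ring lra.

Set Implicit Arguments.
Unset Strict Implicit.
Unset Printing Implicit Defensive.

Import Order.TTheory GRing.Theory Num.Theory.
Import numFieldNormedType.Exports.

Local Open Scope classical_set_scope.
Local Open Scope ring_scope.

(* For independent uniform points in S1 and S2, the probability that their
   distance lies in B is |S1|^-1 |S2|^-1 times the integral over z of
   1_B(|z|) C(z), where C(z) = |S1 n (S2 - z)|. Folding z into the positive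
   quadrant replaces C by a weight D, the sum of C over the four sign changes,
   and polar coordinates give the density |S1|^-1 |S2|^-1 r W(r), where W(r) is
   the integral of D(r cos phi, r sin phi) over [0, pi/2]. For the rectangle and
   the triangle, W is elementary and yields g_R and g; integrating the pieces,
   with L_k^natural a primitive of t L_k^*, yields G_R and G up to the diameter c,
   past which the total mass is 1.
   The diagonal cuts the rectangle into two triangles exchanged by a central
   symmetry, so half of the pairs of points of the rectangle fall in the same
   triangle and half in different ones: g_R is the mean of g and g_2. *)

(** * Changes of variables in the plane *)

(** The law for points in different triangles is never computed from its own covariogram: its
    density is what is left of g_R after g is removed, and this subtraction is the delicate point. A
    density must be nonnegative at every t, not just almost everywhere, so 2 g_R - g >= 0 is derived
    from a pointwise inequality between the two quadrant weights, integrated over the angle.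
    Cancelling an integral in the extended reals requires it to be finite, hence a bound on the
    masses. Neither the sign nor the measurability of g and g_R is read off the piecewise formulas;
    both come from their being angular integrals. All identities between masses are stated for an
    arbitrary Borel set B of distances, so that they yield the density; intervals are used only for
    the distribution functions. *)

Section lebesgue_affine.
Context {R : realType}.
Local Notation mu := (@lebesgue_measure R).
Local Open Scope ereal_scope.

Lemma measurable_affine (k m : R) : measurable_fun setT (fun x : R => (k * x + m)%R).
Proof. by apply: measurable_funD => //; exact: measurable_funM. Qed.

(** The pushforward of Lebesgue measure, scaled by |k|, gives half-open intervals their length, so
    uniqueness of Lebesgue measure applies. For k < 0 the preimage is closed on the other side,
    which does not change its length. *)
Lemma lebesgue_measure_affine (k m : R) (A : set R) : k != 0%R ->
  measurable A -> mu ((fun x => (k * x + m)%R) @^-1` A) = (`|k|^-1)%:E * mu A.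
Proof.
move=> k0 mA.
set phi : R -> measurableTypeR R := fun x => (k * x + m)%R.
have mphi : measurable_fun setT phi by exact: measurable_affine.
have [nu nuE] : exists nu : {measure set (measurableTypeR R) -> \bar R},
    forall X, nu X = (`|k|)%:E * mu (phi @^-1` X).
  by unshelve eexists (mscale (NngNum (normr_ge0 k)) (pushforward mu phi)).
suff -> : mu A = nu A.
  by rewrite nuE muleA -EFinM mulVf ?normr_eq0// mul1e.
apply: lebesgue_measure_unique => //= _ [[u v]] _ <-.
rewrite nuE.
have [k0'|k0'] := ltP 0%R k.
  rewrite (_ : _ @^-1` _ = `]((u - m) / k)%R, ((v - m) / k)%R]%classic); last first.
    by apply/seteqP; split => x /=; rewrite !in_itv/= /phi ltr_pdivrMr// ler_pdivlMr//
      ltrBlDr lerBrDr (mulrC x).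
  rewrite !lebesgue_measure_itv /= !lte_fin ltr_pM2r ?invr_gt0// ltrD2r.
  case: ifPn => _; last by rewrite mule0.
  by rewrite -!EFinB -EFinM; congr (_%:E); rewrite gtr0_norm//; field.
have {k0'} k0' : (k < 0)%R by rewrite lt_neqAle k0.
rewrite (_ : _ @^-1` _ = `[((v - m) / k)%R, ((u - m) / k)%R[%classic); last first.
  by apply/seteqP; split => x /=; rewrite !in_itv/= /phi ltr_ndivlMr// ler_ndivrMr//
    ltrBlDr lerBrDr (mulrC x) andbC.
rewrite !lebesgue_measure_itv /= !lte_fin ltr_nM2r ?invr_lt0// ltrD2r.
case: ifPn => _; last by rewrite mule0.
by rewrite -!EFinB -EFinM; congr (_%:E); rewrite ltr0_norm//; field.
Qed.

Lemma ge0_integral_affine (k m : R) (f : R -> \bar R) : k != 0%R ->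
  measurable_fun setT f -> (forall x, 0 <= f x) ->
  \int[mu]_x f (k * x + m)%R = (`|k|^-1)%:E * \int[mu]_x f x.
Proof.
move=> k0 mf f0.
set phi : R -> measurableTypeR R := fun x => (k * x + m)%R.
have mphi : measurable_fun setT phi by exact: measurable_affine.
have := @ge0_integral_pushforward _ _ (measurableTypeR R) _ R phi mphi mu setT f measurableT mf
  (fun y _ => f0 y).
rewrite preimage_setT /comp /phi => <-.
have k1 : (0 <= `|k|^-1)%R by rewrite invr_ge0.
rewrite -(ge0_integral_mscale _ _ (NngNum k1))//.
apply: eq_measure_integral => //=.
by move=> A mA _; exact: lebesgue_measure_affine.
Qed.

Lemma ge0_integral_scale_pos (k : R) (f : R -> \bar R) : (0 < k)%R ->
  measurable_fun setT f -> (forall x, 0 <= f x) ->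
  \int[mu]_(x in `]0%R, +oo[) f (k * x)%R = (k^-1)%:E * \int[mu]_(x in `]0%R, +oo[) f x.
Proof.
move=> k0 mf f0.
have -> : (k^-1 = `|k|^-1)%R by rewrite gtr0_norm.
rewrite integral_mkcond [in RHS]integral_mkcond.
rewrite -(ge0_integral_affine 0%R); last first.
- by move=> x; exact: erestrict_ge0.
- exact: (measurable_restrictT f (measurable_itv _)).1 (measurable_funTS mf).
- by rewrite gt_eqF.
apply: eq_integral => x _; rewrite /patch !mem_setE addr0 !in_itv/= !andbT.
by rewrite pmulr_rgt0.
Qed.

Lemma ge0_integral_fold (f : R -> \bar R) :
  measurable_fun setT f -> (forall x, 0 <= f x) ->
  \int[mu]_x f x = \int[mu]_(x in `]0%R, +oo[) (f x + f (- x)%R).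
Proof.
move=> mf f0.
have mfN : measurable_fun setT (fun x : R => f (- x)%R) by exact: measurableT_comp.
rewrite ge0_integralD//; [|exact: measurable_funTS|exact: measurable_funTS].
rewrite integral_itv_obnd_cbnd; last exact: measurable_funTS.
have := @ge0_integration_by_substitution0 R (fun x => f (- x)%R) mfN.
rewrite (_ : \int[mu]_(x in `]0%R, +oo[) f (- x)%R = \int[mu]_(r in `[0%R, +oo[) f (- r)%R); last first.
  by rewrite integral_itv_obnd_cbnd//; exact: measurable_funTS.
move=> ->//; under [in X in _ = _ + X]eq_integral do rewrite opprK.
rewrite addrC.
rewrite -[X in _ = X + _]integral_itv_bndo_bndc; last exact: measurable_funTS.
rewrite -ge0_integral_setU//.
- by rewrite -itv_bndbnd_setU// set_itvE.
- exact: measurable_funTS.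
- apply/disj_setPS => x /=; rewrite !in_itv/= andbT => -[x0]; by rewrite leNgt x0.
Qed.

End lebesgue_affine.

Section polar.
Context {R : realType}.
Local Notation mu := (@lebesgue_measure R).
Local Notation pos := (`]0%R, +oo[%classic : set R).
Local Open Scope ereal_scope.

(** Tonelli in the plane, applied to f extended by 0 outside the open quadrant. *)
Lemma ge0_fubini_pos (f : R * R -> \bar R) :
  measurable_fun setT f -> (forall z, 0 <= f z) ->
  \int[mu]_(x in pos) \int[mu]_(y in pos) f (x, y) =
  \int[mu]_(y in pos) \int[mu]_(x in pos) f (x, y).
Proof.
move=> mf f0.
pose g := f \_ (pos `*` pos).
have mg : measurable_fun setT g.
  apply: (measurable_restrictT f _).1; last exact: measurable_funTS.
  by apply: measurableX; exact: measurable_itv.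
have g0 z : 0 <= g z by exact: erestrict_ge0.
have gE x y : g (x, y) = if (x \in pos) && (y \in pos) then f (x, y) else 0.
  by rewrite /g /patch in_setX.
transitivity (\int[mu]_x \int[mu]_y g (x, y)).
  rewrite integral_mkcond; apply: eq_integral => x _; rewrite /patch.
  case: ifPn => xp.
    by rewrite integral_mkcond; apply: eq_integral => y _; rewrite gE xp/= /patch.
  by rewrite integral0_eq// => y _; rewrite gE (negbTE xp).
rewrite (@fubini_tonelli _ _ (measurableTypeR R) (measurableTypeR R) R mu mu g)//.
rewrite [RHS]integral_mkcond; apply: eq_integral => x _; rewrite /patch.
case: ifPn => xp.
  rewrite [RHS]integral_mkcond; apply: eq_integral => y _.
  by rewrite gE xp andbT /patch.
by rewrite integral0_eq// => y _; rewrite gE (negbTE xp) andbF.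
Qed.

(* The quadrant is swept along the lines [y = x s]; the slope [s = tan phi]
   keeps both substitutions affine. *)
Lemma polar_slope (h : R * R -> \bar R) :
  measurable_fun setT h -> (forall z, 0 <= h z) ->
  \int[mu]_(x in pos) \int[mu]_(y in pos) h (x, y) =
  \int[mu]_(r in pos) \int[mu]_(s in pos)
    ((r / (1 + s ^+ 2))%:E * h (r / Num.sqrt (1 + s ^+ 2), r * s / Num.sqrt (1 + s ^+ 2))%R).
Proof.
move=> mh h0.
have mxs : measurable_fun setT (fun z : R * R => (z.1, z.1 * z.2)%R).
  by apply/measurable_fun_pair => //; exact: measurable_funM.
(* On the quadrant [Num.max 0 x] is the Jacobian x of y = x s; the maximum keeps the integrand
   nonnegative on the whole plane, as Tonelli requires. *)
have mh1 : measurable_fun setT (fun z : R * R => (Num.max 0 z.1)%:E * h (z.1, z.1 * z.2)%R).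
  apply: emeasurable_funM; last exact: (measurableT_comp mh mxs).
  by apply/measurable_EFinP; exact: (measurable_maxr (f := cst 0%R)).
have mhx (x : R) : measurable_fun setT (fun y : R => h (x, x * y)%R).
  by apply: (measurableT_comp mh); apply/measurable_fun_pair => //; exact: measurable_funM.
have mhs (s : R) : measurable_fun setT (fun y : R => (Num.max 0 y)%:E * h (y, y * s)%R).
  apply: emeasurable_funM.
    by apply/measurable_EFinP; exact: (measurable_maxr (f := cst 0%R)).
  by apply: (measurableT_comp mh); apply/measurable_fun_pair => //; exact: measurable_funM.
transitivity (\int[mu]_(x in pos) \int[mu]_(s in pos)
    ((Num.max 0 x)%:E * h (x, x * s)%R)).
  apply: eq_integral => x; rewrite inE/= in_itv/= andbT => x0.
  rewrite (max_idPr (ltW x0)) ge0_integralZl//; last first.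
  - by rewrite lee_fin ltW.
  - by apply: measurable_funTS; exact: mhx.
  rewrite (@ge0_integral_scale_pos _ x (fun y => h (x, y)))//.
  - by rewrite muleA -EFinM divff ?gt_eqF// mul1e.
  - exact: measurableT_comp.
rewrite (ge0_fubini_pos mh1); last first.
  by move=> z; rewrite mule_ge0// lee_fin le_max lexx.
have sq_gt0 (s : R) : (0 < 1 + s ^+ 2)%R by rewrite ltr_pwDl// sqr_ge0.
have sqr_gt0 (s : R) : (0 < Num.sqrt (1 + s ^+ 2))%R by rewrite sqrtr_gt0.
(* With s = tan phi this is cos phi: at a fixed slope the abscissa is x = k(s) r. *)
pose k (s : R) : R := ((Num.sqrt (1 + s ^+ 2))^-1)%R.
have k0 s : (0 < k s)%R by rewrite invr_gt0.
have mk : measurable_fun setT k.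
  apply: continuous_measurable_fun => s.
  apply: cvgV; first by rewrite gt_eqF.
  apply: (continuous_comp (f := fun s : R => (1 + s ^+ 2)%R)); last exact: sqrt_continuous.
  by apply: cvgD; [exact: cvg_cst|exact: exprn_continuous].
have mhks (s : R) : measurable_fun setT (fun y : R => (Num.max 0 (k s * y))%:E * h (k s * y, k s * y * s)%R).
  by apply: (measurableT_comp (mhs s)); exact: measurable_funM.
transitivity (\int[mu]_(s in pos) \int[mu]_(r in pos)
    ((k s * Num.max 0 (k s * r))%:E * h (k s * r, k s * r * s)%R)).
  apply: eq_integral => s; rewrite inE/= in_itv/= andbT => s0.
  under [RHS]eq_integral do rewrite EFinM -muleA.
  rewrite ge0_integralZl//; last first.
  - by rewrite lee_fin ltW.
  - by move=> x _; rewrite mule_ge0// lee_fin le_max lexx.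
  - by apply: measurable_funTS; exact: mhks.
  rewrite (@ge0_integral_scale_pos _ (k s) (fun x => (Num.max 0 x)%:E * h (x, x * s)%R))//.
    by rewrite muleA -EFinM divff ?gt_eqF// mul1e.
  by move=> x; rewrite mule_ge0// lee_fin le_max lexx.
rewrite -(ge0_fubini_pos (f := fun z => (k z.2 * Num.max 0 (k z.2 * z.1))%:E * h (k z.2 * z.1, k z.2 * z.1 * z.2)%R)).
- apply: eq_integral => r; rewrite inE/= in_itv/= andbT => r0.
  apply: eq_integral => s; rewrite inE/= in_itv/= andbT => s0.
  rewrite (max_idPr _) ?mulr_ge0 ?ltW// mulrA -expr2 /k exprVn sqr_sqrtr ?ltW//.
  by rewrite mulrC [(_^-1 * r)%R]mulrC [(r / _ * s)%R]mulrAC.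
- have mkz : measurable_fun setT (fun z : R * R => k z.2 * z.1)%R.
    by apply: measurable_funM => //; exact: measurableT_comp.
  apply: emeasurable_funM.
    apply/measurable_EFinP; apply: measurable_funM; first exact: measurableT_comp.
    exact: (measurable_maxr (f := cst 0%R)).
  apply: (measurableT_comp mh); apply/measurable_fun_pair => //.
  exact: measurable_funM.
- move=> z; rewrite mule_ge0// lee_fin mulr_ge0//; first exact/ltW.
  by rewrite le_max lexx.
Qed.

End polar.

Section polar_coordinates.
Context {R : realType}.
Local Notation mu := (@lebesgue_measure R).
Local Notation pos := (`]0%R, +oo[%classic : set R).

(** The substitution phi = atan s: [F \o atan] is a primitive of the left integrand and tends to
    F(pi / 2) at infinity. *)
Lemma integral_atan (V : R -> R) : continuous V -> (forall x, 0 <= V x) ->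
  (\int[mu]_(s in pos) (V (atan s) / (1 + s ^+ 2))%:E =
   \int[mu]_(x in `[0%R, (pi / 2)%R]) (V x)%:E)%E.
Proof.
move=> cV V0.
(* Starting the primitive at -1 makes both 0 and pi / 2 interior points of its domain of
   differentiability. *)
pose F (x : R) : R := (\int[mu]_(t in `[(-1)%R, x]) V t)%R.
have dF (x : R) : -1 < x -> is_derive x 1 F (V x).
  move=> x1.
  have iV : mu.-integrable `[(-1)%R, (x + 1)%R] (EFin \o V).
    by apply: continuous_compact_integrable; [exact: segment_compact|exact: continuous_subspaceT].
  have x2 : x < x + 1 by rewrite ltrDl.
  have [dF FE] := @continuous_FTC1_closed R V (-1) x (x + 1) x2 iV x1 (cV x).
  by apply: DeriveDef => //; rewrite -derive1E.
have F_cont (x : R) : -1 < x -> {for x, continuous F}.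
  move=> x1; have [? _] := dF x x1.
  exact/differentiable_continuous/derivable1_diffP.
have pi20 : 0 < pi / 2 :> R by rewrite divr_gt0// pi_gt0.
have sq_gt0 (s : R) : (0 < 1 + s ^+ 2)%R by rewrite ltr_pwDl// sqr_ge0.
have atan_ge0 (s : R) : 0 <= s -> -1 < atan s.
  by move=> s0; rewrite (@lt_le_trans _ _ 0)// -(@atan0 R); exact: le_atan.
have catan : continuous (@atan R) by exact: continuous_atan.
have cf : continuous (fun s : R => V (atan s) / (1 + s ^+ 2)).
  move=> s; apply: cvgM.
    by apply: (continuous_comp (f := @atan R)); [exact: catan|exact: cV].
  apply: cvgV; first by rewrite gt_eqF.
  by apply: cvgD; [exact: cvg_cst|exact: exprn_continuous].
have dFa (s : R) : 0 < s -> is_derive s 1 (F \o @atan R) (V (atan s) / (1 + s ^+ 2)).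
  move=> s0; have dat : is_derive s 1 (@atan R) (1 + s ^+ 2)^-1.
    by apply: DeriveDef; [exact: derivable_atan|rewrite -derive1E derive1_atan].
  have dFs := dF (atan s) (atan_ge0 s (ltW s0)).
  exact: is_derive1_comp.
rewrite integral_itv_obnd_cbnd; last first.
  apply: measurable_funTS; apply/measurable_EFinP.
  exact: continuous_measurable_fun.
rewrite (@ge0_continuous_FTC2y _ _ (F \o @atan R) 0 (F (pi / 2))) /=.
- rewrite (@continuous_FTC2 _ V F) ?atan0//.
  + exact: continuous_subspaceT.
  + split.
    * by move=> x /itvP xI; have [] : is_derive x 1 F (V x) by apply: dF; rewrite (@lt_trans _ _ 0) ?xI.
    * by apply: cvg_at_right_filter; apply: F_cont.
    * by apply: cvg_at_left_filter; apply: F_cont; rewrite (@lt_trans _ _ 0).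
  + move=> x /itvP xI; rewrite derive1E.
    by have [|_ ->//] := dF x; rewrite (@lt_trans _ _ 0) ?xI.
- by move=> x _; rewrite divr_ge0// ltW.
- exact: continuous_subspaceT.
- apply: (cvg_comp _ _ (@cvgy_atan R)).
  by apply: F_cont; rewrite (@lt_trans _ _ 0).
- by move=> x x0; have [] := dFa x x0.
- apply: cvg_at_right_filter.
  apply: (continuous_comp (f := @atan R) (g := F)); first exact: catan.
  by rewrite atan0; exact: F_cont.
- move=> x; rewrite in_itv/= andbT => x0.
  by have [_] := dFa x x0; rewrite derive1E.
Qed.
End polar_coordinates.

Section polar_fold.
Context {R : realType}.
Local Notation mu := (@lebesgue_measure R).
Local Notation pos := (`]0%R, +oo[%classic : set R).

Lemma cos_atan_sqrt (s : R) : cos (atan s) = (Num.sqrt (1 + s ^+ 2))^-1.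
Proof. exact: cos_atan. Qed.

Lemma sin_atan (s : R) : sin (atan s) = s / Num.sqrt (1 + s ^+ 2).
Proof.
rewrite -cos_atan_sqrt -{2}(atanK s) /tan mulfVK// cos_atan_sqrt.
by rewrite invr_eq0 gt_eqF// sqrtr_gt0 ltr_pwDl// sqr_ge0.
Qed.

(** In [polar_slope] the factor 1 / (1 + s^2) is the derivative of atan and is absorbed by the
    passage to the angle; the remaining r is the usual polar Jacobian. *)
Lemma ge0_integral_polar (g : R -> R) (D : R -> R -> R) :
  measurable_fun setT g -> (forall r, 0 <= g r) ->
  measurable_fun setT (fun z : R * R => D z.1 z.2) -> (forall x y, 0 <= D x y) ->
  (forall r, continuous (fun phi : R => D (r * cos phi) (r * sin phi))) ->
  (\int[mu]_(x in pos) \int[mu]_(y in pos) (g (Num.sqrt (x ^+ 2 + y ^+ 2)) * D x y)%:E =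
   \int[mu]_(r in pos) ((g r * r)%:E *
     \int[mu]_(phi in `[0%R, (pi / 2)%R]) (D (r * cos phi) (r * sin phi))%:E))%E.
Proof.
move=> mg g0 mD D0 cD.
have mnorm : measurable_fun setT (fun z : R * R => Num.sqrt (z.1 ^+ 2 + z.2 ^+ 2)).
  apply: (measurableT_comp (continuous_measurable_fun (@sqrt_continuous R))).
  by apply: measurable_funD; exact: measurable_funX.
have mh : measurable_fun setT (fun z : R * R => (g (Num.sqrt (z.1 ^+ 2 + z.2 ^+ 2)) * D z.1 z.2)%:E).
  apply/measurable_EFinP; apply: measurable_funM => //.
  exact: (measurableT_comp mg mnorm).
rewrite (polar_slope mh); last by move=> z; rewrite lee_fin mulr_ge0.
apply: eq_integral => r; rewrite inE/= in_itv/= andbT => r0.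
rewrite -integral_atan//.
have sq_gt0 (s : R) : (0 < 1 + s ^+ 2)%R by rewrite ltr_pwDl// sqr_ge0.
rewrite -ge0_integralZl//.
- apply: eq_integral => s _.
  rewrite cos_atan_sqrt sin_atan /= -!EFinM; congr (_%:E).
  set k := Num.sqrt (1 + s ^+ 2).
  have k0 : k != 0 by rewrite gt_eqF// sqrtr_gt0.
  have kk : k ^+ 2 = 1 + s ^+ 2 by rewrite sqr_sqrtr// ltW.
  have -> : Num.sqrt ((r / k) ^+ 2 + (r * s / k) ^+ 2) = r.
    rewrite (_ : _ + _ = r ^+ 2); first by rewrite sqrtr_sqr gtr0_norm.
    rewrite !expr_div_n exprMn kk; field; rewrite gt_eqF// sq_gt0.
  rewrite [r * (s / k)]mulrA.
  by field; rewrite gt_eqF// sq_gt0.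
- apply: measurable_funTS; apply/measurable_EFinP; apply: continuous_measurable_fun => s.
  apply: cvgM.
    apply: (continuous_comp (f := @atan R) (g := fun phi => D (r * cos phi) (r * sin phi))).
      exact: continuous_atan.
    exact: cD.
  apply: cvgV; first by rewrite gt_eqF.
  by apply: cvgD; [exact: cvg_cst|exact: exprn_continuous].
- by move=> s _; rewrite lee_fin divr_ge0// ltW.
- by rewrite lee_fin mulr_ge0// ltW.
Qed.

Lemma ge0_integral_fold2 (h : R * R -> \bar R) :
  measurable_fun setT h -> (forall z, 0 <= h z)%E ->
  (\int[mu]_x \int[mu]_y h (x, y) =
   \int[mu]_(x in pos) \int[mu]_(y in pos)
     (h (x, y) + h (x, (- y)%R) + (h ((- x)%R, y) + h ((- x)%R, (- y)%R))))%E.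
Proof.
move=> mh h0.
have mh1 (x : R) : measurable_fun setT (fun y : R => h (x, y)) by exact: measurableT_comp.
have mh2 (x : R) : measurable_fun setT (fun y : R => h (x, - y)).
  by apply: (measurableT_comp (mh1 x)).
rewrite ge0_integral_fold; last first.
- by move=> x; exact: integral_ge0.
- exact: (@measurable_fun_fubini_tonelli_F _ _ (measurableTypeR R) (measurableTypeR R) R mu h mh h0).
apply: eq_integral => x _; rewrite !ge0_integral_fold//.
rewrite -ge0_integralD//.
- by move=> y _; exact: adde_ge0.
- by apply: measurable_funTS; apply: emeasurable_funD; [exact: mh1|exact: mh2].
- by move=> y _; exact: adde_ge0.
- by apply: measurable_funTS; apply: emeasurable_funD; [exact: mh1|exact: mh2].
Qed.

End polar_fold.

Section planar_affine.
Context {R : realType}.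
Local Notation mu := (@lebesgue_measure R).
Local Notation lambda := (@lebesgue2 R).

Lemma measurable_planar (k l m : R) :
  measurable_fun setT (fun z : R * R => m + k * z.1 + l * z.2).
Proof.
apply: measurable_funD; last exact: measurable_funM.
by apply: measurable_funD => //; exact: measurable_funM.
Qed.

Lemma ge0_fubini2 (f : R * R -> \bar R) :
  measurable_fun setT f -> (forall z, 0 <= f z)%E ->
  (\int[mu]_x \int[mu]_y f (x, y) = \int[mu]_y \int[mu]_x f (x, y))%E.
Proof.
move=> mf f0.
exact: (@fubini_tonelli _ _ (measurableTypeR R) (measurableTypeR R) R mu mu f).
Qed.

Lemma ge0_integral_lebesgue2 (f : R * R -> \bar R) :
  measurable_fun setT f -> (forall z, 0 <= f z)%E ->
  (\int[(mu \x mu)%E]_z f z = \int[mu]_x \int[mu]_y f (x, y))%E.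
Proof.
move=> mf f0.
exact: (@fubini_tonelli1 _ _ (measurableTypeR R) (measurableTypeR R) R mu mu f mf f0).
Qed.

Lemma lebesgue2E (E : set (R * R)) : measurable E ->
  (lambda E = \int[mu]_x \int[mu]_y (\1_E (x, y))%:E)%E.
Proof.
move=> mE.
rewrite -(@ge0_integral_lebesgue2 (EFin \o \1_E)).
- by rewrite integral_indic// setIT.
- exact/measurable_EFinP/measurable_indic.
- by move=> z; rewrite lee_fin.
Qed.

(** Gaussian elimination: for fixed t replace s by the first coordinate x; for fixed x the second
    coordinate is then affine in t with slope d / u1. The factors 1 / |u1| and |u1 / d| multiply to
    1 / |d|. *)
Let affine2 (a1 a2 u1 u2 v1 v2 : R) (f : R * R -> \bar R) :
  u1 != 0 -> u1 * v2 - u2 * v1 != 0 ->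
  measurable_fun setT f -> (forall z, 0 <= f z)%E ->
  (\int[mu]_s \int[mu]_t f (a1 + u1 * s + v1 * t, a2 + u2 * s + v2 * t)%R =
   (`|u1 * v2 - u2 * v1|^-1)%:E * \int[mu]_x \int[mu]_y f (x, y))%E.
Proof.
move=> u0 d0 mf f0; set d := u1 * v2 - u2 * v1.
have mfg (g1 g2 : R * R -> R) : measurable_fun setT g1 -> measurable_fun setT g2 ->
    measurable_fun setT (fun z => f (g1 z, g2 z)).
  by move=> m1 m2; apply: (measurableT_comp mf); exact/measurable_fun_pair.
have mfg1 (g1 g2 : R -> R) : measurable_fun setT g1 -> measurable_fun setT g2 ->
    measurable_fun setT (fun z => f (g1 z, g2 z)).
  by move=> m1 m2; apply: (measurableT_comp mf); exact/measurable_fun_pair.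
rewrite (ge0_fubini2 (f := fun z => f (a1 + u1 * z.1 + v1 * z.2, a2 + u2 * z.1 + v2 * z.2)))//;
  last by apply: mfg; exact: measurable_planar.
have mf1 : measurable_fun setT (fun z : R * R => f (z.1, (a2 - u2 / u1 * a1) + u2 / u1 * z.1 + d / u1 * z.2)).
  by apply: mfg => //; exact: measurable_planar.
transitivity (\int[mu]_t ((`|u1|^-1)%:E * \int[mu]_x
    f (x, (a2 - u2 / u1 * a1) + u2 / u1 * x + d / u1 * t)%R))%E.
  apply: eq_integral => t _.
  rewrite -(@ge0_integral_affine R u1 (a1 + v1 * t)
    (fun x => f (x, (a2 - u2 / u1 * a1) + u2 / u1 * x + d / u1 * t)%R))//.
    apply: eq_integral => s _ /=; congr (f (_, _)); first by rewrite addrCA addrA.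
    rewrite /d; field.
    done.
  apply: mfg1 => //; apply: measurable_funD => //.
  by apply: measurable_funD => //; exact: measurable_funM.
rewrite ge0_integralZl//; last first.
- by move=> t _; exact: integral_ge0.
- exact: (@measurable_fun_fubini_tonelli_G _ _ (measurableTypeR R) (measurableTypeR R) R mu _ mf1).
rewrite -(ge0_fubini2 mf1)//=.
have -> : (\int[mu]_x \int[mu]_t
    f (x, (a2 - u2 / u1 * a1) + u2 / u1 * x + d / u1 * t)%R =
  \int[mu]_x ((`|d / u1|^-1)%:E * \int[mu]_y f (x, y)))%E.
  apply: eq_integral => x _.
  rewrite -(@ge0_integral_affine R (d / u1) ((a2 - u2 / u1 * a1) + u2 / u1 * x)
    (fun y => f (x, y)))//.
  - by apply: eq_integral => t _; rewrite addrC.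
  - by rewrite mulf_neq0// invr_eq0.
  - by apply: mfg1.
rewrite ge0_integralZl//; last first.
- by move=> t _; exact: integral_ge0.
- exact: (@measurable_fun_fubini_tonelli_F _ _ (measurableTypeR R) (measurableTypeR R) R mu _ mf).
rewrite muleA -EFinM; congr (_%:E * _)%E.
by rewrite normrM normfV invfM invrK mulrCA mulVf ?normr_eq0// mulr1.
Qed.

(** When u1 = 0 the determinant forces v1 != 0, and exchanging the roles of s and t leads back to
    [affine2]. *)
Lemma ge0_integral2_affine (a1 a2 u1 u2 v1 v2 : R) (f : R * R -> \bar R) :
  u1 * v2 - u2 * v1 != 0 ->
  measurable_fun setT f -> (forall z, 0 <= f z)%E ->
  (\int[mu]_s \int[mu]_t f (a1 + u1 * s + v1 * t, a2 + u2 * s + v2 * t)%R =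
   (`|u1 * v2 - u2 * v1|^-1)%:E * \int[mu]_x \int[mu]_y f (x, y))%E.
Proof.
move=> d0 mf f0; have [u0|u0] := eqVneq u1 0; last exact: affine2.
have v0 : v1 != 0.
  by apply: contra_neq d0 => v0; rewrite u0 v0 mul0r mulr0 subrr.
rewrite (ge0_fubini2 (f := fun z => f (a1 + u1 * z.1 + v1 * z.2, a2 + u2 * z.1 + v2 * z.2)))//;
  last first.
  apply: (measurableT_comp mf); apply/measurable_fun_pair; exact: measurable_planar.
have := @affine2 a1 a2 v1 v2 u1 u2 f v0 _ mf f0.
rewrite (_ : v1 * u2 - v2 * u1 = - (u1 * v2 - u2 * v1)); last by ring.
rewrite normrN oppr_eq0 => /(_ d0) <-.
by apply: eq_integral => s _; apply: eq_integral => t _ /=; congr (f (_, _)); ring.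
Qed.

Lemma lebesgue2_affine (a1 a2 u1 u2 v1 v2 : R) (E : set (R * R)) :
  u1 * v2 - u2 * v1 != 0 -> measurable E ->
  (lambda ((fun z => (a1 + u1 * z.1 + v1 * z.2, a2 + u2 * z.1 + v2 * z.2)%R) @^-1` E) =
   (`|u1 * v2 - u2 * v1|^-1)%:E * lambda E)%E.
Proof.
move=> d0 mE.
rewrite !lebesgue2E//; last first.
  rewrite -[X in measurable X]setTI; apply: measurable_fun_pair => //; exact: measurable_planar.
rewrite -(ge0_integral2_affine a1 a2 (f := EFin \o \1_E))//.
- exact/measurable_EFinP/measurable_indic.
- by move=> z; rewrite lee_fin.
Qed.

End planar_affine.

(** * Pairs of uniform points *)

Section planar_measure.
Context {R : realType}.
Local Notation mu := (@lebesgue_measure R).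

(* [lebesgue2] on the type [measurableTypeR R * measurableTypeR R], for which
   it is canonically a measure. *)
Definition planar : set (measurableTypeR R * measurableTypeR R) -> \bar R :=
  (mu \x mu)%E.

HB.instance Definition _ := Measure.on planar.

(** Needed for Tonelli on pairs of points. The squares of an increasing exhaustion of the line
    suffice: monotonicity puts both coordinates of a point in a common set. *)
Let planar_sigma_finite : sigma_finite setT planar.
Proof.
have /sigma_finiteP[F [TF ndF Foo]] := sigma_finiteT mu.
exists (fun n => F n `*` F n).
  apply/esym/seteqP; split => // -[x y] _.
  have [n _ Fx] : (\bigcup_i F i) x by rewrite -TF.
  have [m _ Fy] : (\bigcup_i F i) y by rewrite -TF.
  exists (maxn n m) => //; split => /=.
  - by move: x Fx; exact/subsetPset/ndF/leq_maxl.
  - by move: y Fy; exact/subsetPset/ndF/leq_maxr.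
move=> k; have [mF Fk] := Foo k; split; first exact: measurableX.
by rewrite /planar product_measure1E// lte_mul_pinfty// ge0_fin_numE.
Qed.

HB.instance Definition _ :=
  Measure_isSigmaFinite.Build _ _ _ planar planar_sigma_finite.

End planar_measure.

Lemma ge0_integral_mrestr d (T : measurableType d) (R : realType)
    (m : {measure set T -> \bar R}) (D : set T) (mD : measurable D) (f : T -> \bar R) :
  measurable_fun setT f -> (forall x, 0 <= f x)%E ->
  (\int[mrestr m mD]_x f x = \int[m]_(x in D) f x)%E.
Proof.
move=> mf f0.
rewrite -(setUv D) ge0_integral_setU//; last 3 first.
- exact: measurableC.
- exact: measurable_funTS.
- by apply/disj_setPS => x [].
rewrite [X in (_ + X)%E](_ : _ = 0)%E.
  by rewrite adde0; apply: eq_measure_integral => A mA AD; rewrite /= /mrestr setIidl.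
apply: null_set_integral; first exact: measurableC.
  exact: measurable_funTS.
by rewrite /= /mrestr setICl measure0.
Qed.

Section transport.
Context {R : realType}.
Local Notation mu := (@lebesgue_measure R).
Local Notation lambda := (@planar R).

Lemma measurable_eucl_dist :
  measurable_fun setT (fun z : (R * R) * (R * R) => eucl_dist z.1 z.2).
Proof.
apply: (measurableT_comp (continuous_measurable_fun (@sqrt_continuous R))).
by apply: measurable_funD; apply: measurable_funX; apply: measurable_funB;
  exact: measurableT_comp.
Qed.

(** If X is uniform in the preimage of S, then phi(X) is uniform in S since phi preserves area;
    independence passes to phi(X), phi(Y), and their distance is that of X and Y. *)
Lemma distance_law_transport (phi : R * R -> R * R) (S1 S2 : set (R * R)) (f F : R -> R) :
  measurable_fun setT phi ->
  (forall E, measurable E -> lebesgue2 (phi @^-1` E) = lebesgue2 E) ->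
  (forall p q, eucl_dist (phi p) (phi q) = eucl_dist p q) ->
  measurable S1 -> measurable S2 ->
  distance_law S1 S2 f F -> distance_law (phi @^-1` S1) (phi @^-1` S2) f F.
Proof.
move=> mphi phiL phiD mS1 mS2 H d T P X Y uX uY iXY.
have mpre (E : set (R * R)) : measurable E -> measurable (phi @^-1` E).
  by move=> mE; rewrite -[X in measurable X]setTI; exact: mphi.
pose phim : {mfun (R * R)%type >-> (R * R)%type} :=
  HB.pack phi (isMeasurableFun.Build _ _ _ _ _ mphi).
pose X' : {RV P >-> (R * R)%type} := phim \o X.
pose Y' : {RV P >-> (R * R)%type} := phim \o Y.
have uni (S : set (R * R)) (Z : {RV P >-> (R * R)%type}) : measurable S ->
    uniform_on P (phi @^-1` S) Z -> uniform_on P S (phim \o Z : {RV P >-> (R * R)%type}).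
  move=> mS uZ B mB.
  rewrite -(phiL _ mS) -(phiL (B `&` S)); last exact: measurableI.
  rewrite preimage_setI -uZ//; exact: mpre.
have [|[mf f0 df] cf] := H d T P X' Y' (uni _ _ mS1 uX) (uni _ _ mS2 uY).
  by move=> B1 B2 mB1 mB2; have := iXY _ _ (mpre _ mB1) (mpre _ mB2).
have DE : distance X' Y' = distance X Y :> (T -> R).
  by apply/funext => w; rewrite /distance phiD.
have DB (B : set R) : distribution P (distance X Y) B = distribution P (distance X' Y') B.
  by rewrite /distribution /pushforward; congr (P _); apply: (congr1 (fun g => g @^-1` B)).
split; first split => //.
- by move=> B mB; rewrite -df// DB.
- by move=> t; rewrite -cf /cdf DB.
Qed.

(** The four-dimensional volume of the pairs (p, q) in S1 x S2 whose distance lies in B. Being free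
    of probabilities and normalization, it is additive in each of S1 and S2. *)
Definition pair_mass (S1 S2 : set (R * R)) (B : set R) : \bar R :=
  (\int[lambda]_(p in S1) lebesgue2 (S2 `&` [set q | B (eucl_dist p q)]))%E.

Lemma measurable_pair_mass (S2 : set (R * R)) (B : set R) :
  measurable S2 -> measurable B ->
  measurable_fun setT (fun p : R * R => lebesgue2 (S2 `&` [set q | B (eucl_dist p q)])).
Proof.
move=> mS2 mB.
pose E : set ((R * R) * (R * R)) := (setT `*` S2) `&` [set z | B (eucl_dist z.1 z.2)].
have mE : measurable E.
  apply: measurableI; first exact: measurableX.
  by rewrite -[X in measurable X]setTI; exact: measurable_eucl_dist.
have := @measurable_fun_xsection _ _ (R * R)%type (measurableTypeR R * measurableTypeR R)%type R lambda E mE.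
apply: eq_measurable_fun => p _ /=; rewrite /lebesgue2; congr (_ _).
by apply/seteqP; split => q; rewrite /xsection /= inE /E/= => -[] // [].
Qed.

(** Independence identifies the law of (X, Y) with the product of the two laws, by uniqueness of the
    product measure; each law is Lebesgue measure restricted to S and scaled by 1 / |S|. *)
Lemma distribution_distance d (T : measurableType d) (P : probability T R)
    (X Y : {RV P >-> (R * R)%type}) (S1 S2 : set (R * R)) (B : set R) :
  uniform_on P S1 X -> uniform_on P S2 Y -> independent_RV P X Y ->
  measurable S1 -> measurable S2 -> measurable B ->
  distribution P (distance X Y) B =
    (((fine (lebesgue2 S1))^-1 * (fine (lebesgue2 S2))^-1)%:E * pair_mass S1 S2 B)%E.
Proof.
move=> uX uY iXY mS1 mS2 mB.
pose E : set ((R * R) * (R * R)) := [set z | B (eucl_dist z.1 z.2)].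
have mE : measurable E.
  by rewrite /E -[X in measurable X]setTI; exact: measurable_eucl_dist.
have mXY : measurable_fun setT (fun w => (X w, Y w)) by exact: measurable_fun_pair.
have -> : distribution P (distance X Y) B = pushforward P (fun w => (X w, Y w)) E by [].
rewrite -(@product_measure_unique _ _ _ _ R (distribution P X) (distribution P Y)
  (pushforward P (fun w => (X w, Y w))))//.
pose f p := lebesgue2 (S2 `&` [set q | B (eucl_dist p q)]).
pose k1 := (fine (lebesgue2 S1))^-1; pose k2 := (fine (lebesgue2 S2))^-1.
have k10 : 0 <= k1 by rewrite invr_ge0 fine_ge0// measure_ge0.
have k20 : 0 <= k2 by rewrite invr_ge0 fine_ge0// measure_ge0.
have mf : measurable_fun setT f by exact: measurable_pair_mass.
have f0 p : (0 <= f p)%E by exact: measure_ge0.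
have mS1' : measurable (S1 : set (measurableTypeR R * measurableTypeR R)) by [].
transitivity (\int[distribution P X]_p (k2%:E * f p))%E.
  apply: eq_integral => p _ /=.
  rewrite uY; last exact: measurable_xsection.
  rewrite muleC /f; congr (_ * lebesgue2 _)%E.
  by apply/seteqP; split => q; rewrite /xsection /= inE /E/= => -[].
rewrite ge0_integralZl//.
rewrite ge0_integral_distribution//.
transitivity (k2%:E * \int[lambda]_(p in S1) (k1%:E * f p))%E; last first.
  by rewrite ge0_integralZl//; [rewrite muleA -EFinM mulrC|exact: measurable_funTS].
congr (_ * _)%E.
pose X2 : T -> (measurableTypeR R * measurableTypeR R)%type := X.
have mX2 : measurable_fun setT X2 by move=> mT D mD; exact: (@measurable_funPT _ _ _ _ X).
have := @ge0_integral_pushforward _ _ T _ R X2 mX2 P setT f measurableT mf (fun y _ => f0 y).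
rewrite preimage_setT => <-.
rewrite ge0_integralZl//; last exact: measurable_funTS.
rewrite -(ge0_integral_mrestr lambda mS1' mf f0).
rewrite -(ge0_integral_mscale (mrestr lambda mS1') measurableT (NngNum k10))//.
apply: eq_measure_integral => //= A mA _.
rewrite /mscale/= /mrestr muleC.
exact: uX.
Qed.

End transport.

Section covariogram.
Context {R : realType}.
Local Notation mu := (@lebesgue_measure R).
Local Notation lambda := (@planar R).

Lemma measurable_hypot :
  measurable_fun setT (fun z : R * R => Num.sqrt (z.1 ^+ 2 + z.2 ^+ 2)).
Proof.
apply: (measurableT_comp (continuous_measurable_fun (@sqrt_continuous R))).
by apply: measurable_funD; exact: measurable_funX.
Qed.

Lemma measurable_eucl_distr (p : R * R) :
  measurable_fun setT (fun q : R * R => eucl_dist p q).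
Proof.
have mp : measurable_fun setT (fun q : R * R => (p, q)) by exact/measurable_fun_pair.
exact: (measurableT_comp (@measurable_eucl_dist R) mp).
Qed.

Lemma lebesgue2_translate (p : R * R) (E : set (R * R)) : measurable E ->
  lebesgue2 [set z : R * R | E (p.1 + z.1, p.2 + z.2)] = lebesgue2 E.
Proof.
move=> mE; have := @lebesgue2_affine R p.1 p.2 1 0 0 1 E.
rewrite mulr1 mulr0 subr0 normr1 invr1 mul1e oner_eq0 => /(_ isT mE) <-.
by congr (lebesgue2 _); apply/seteqP; split => z /=; rewrite !mul1r !mul0r !addr0.
Qed.

(** Put q = p + z. Both sides are the volume of the set [E] of the pairs (p, z): sectioned at p, and
    using translation invariance, it gives [pair_mass]; sectioned at z it gives the covariogram. *)
Lemma pair_mass_covariogram (S1 S2 : set (R * R)) (B : set R) :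
  measurable S1 -> measurable S2 -> measurable B ->
  pair_mass S1 S2 B =
  (\int[mu]_x \int[mu]_y ((\1_B (Num.sqrt (x ^+ 2 + y ^+ 2)))%:E *
     lebesgue2 (S1 `&` [set p | S2 (p.1 + x, p.2 + y)%R])))%E.
Proof.
move=> mS1 mS2 mB.
pose E : set ((R * R) * (R * R)) := [set w | S1 w.1 /\
  S2 (w.1.1 + w.2.1, w.1.2 + w.2.2) /\ B (Num.sqrt (w.2.1 ^+ 2 + w.2.2 ^+ 2))].
have mE : measurable E.
  apply: measurableI; last apply: measurableI.
  - by rewrite -[X in measurable X]setTI; exact: measurable_fst.
  - rewrite -[X in measurable X]setTI.
    have ms : measurable_fun setT (fun w : (R * R) * (R * R) => (w.1.1 + w.2.1, w.1.2 + w.2.2)).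
      by apply/measurable_fun_pair; apply: measurable_funD; exact: measurableT_comp.
    exact: ms.
  - rewrite -[X in measurable X]setTI.
    have ms : measurable_fun setT (fun w : (R * R) * (R * R) => Num.sqrt (w.2.1 ^+ 2 + w.2.2 ^+ 2)).
      exact: (measurableT_comp measurable_hypot).
    exact: ms.
have distE (p z : R * R) : eucl_dist p (p.1 + z.1, p.2 + z.2) = Num.sqrt (z.1 ^+ 2 + z.2 ^+ 2).
  by rewrite /eucl_dist /=; congr Num.sqrt; ring.
pose T2 := (measurableTypeR R * measurableTypeR R)%type.
have mE' : measurable (E : set (T2 * T2)) by exact: mE.
transitivity (\int[lambda]_p lambda (xsection E p))%E.
  rewrite /pair_mass integral_mkcond; apply: eq_integral => p _.
  rewrite /patch; case: ifPn => pS.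
    rewrite -(lebesgue2_translate p); last first.
      apply: measurableI => //.
      rewrite -[X in measurable X]setTI.
      have ms : measurable_fun setT (fun q : R * R => eucl_dist p q).
        exact: measurable_eucl_distr.
      exact: ms.
    congr (lambda _); apply/seteqP; split => z /=; rewrite /xsection /= inE /E /= distE.
      by move=> [? ?]; split => //; exact: set_mem.
    by move=> [? [? ?]].
  rewrite (_ : xsection _ _ = set0) ?measure0//.
  by apply/seteqP; split => z //; rewrite /xsection/= inE => -[/mem_set]; rewrite (negbTE pS).
transitivity (\int[lambda]_z lambda (ysection E z))%E.
  have mI : measurable_fun setT (fun w : T2 * T2 => (\1_E w)%:E : \bar R).
    by apply/measurable_EFinP; exact: measurable_indic.
  have I0 w : (0 <= (\1_E w)%:E :> \bar R)%E by rewrite lee_fin.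
  have := @fubini_tonelli _ _ T2 T2 R lambda lambda (fun w => (\1_E w)%:E) mI I0.
  have := indic_fubini_tonelli_FE lambda mE'.
  have := indic_fubini_tonelli_GE lambda mE'.
  rewrite /fubini_F /fubini_G /= => GE FE.
  under eq_integral do rewrite (congr1 (fun g => g _) FE)/=.
  by under [in X in _ = X -> _]eq_integral do rewrite (congr1 (fun g => g _) GE)/=.
rewrite (@ge0_integral_lebesgue2 R (fun z => lambda (ysection E z))); last 2 first.
- exact: (measurable_fun_ysection lambda mE').
- by move=> z; exact: measure_ge0.
apply: eq_integral => x _; apply: eq_integral => y _.
rewrite indicE; have [yB|yB] := boolP (_ \in B).
  rewrite mul1e; congr (lambda _); apply/seteqP; split => p /=; rewrite /ysection/= inE /E/=.
    by move=> [? []].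
  by move=> [? ?]; do 2 split => //; exact: set_mem.
rewrite mul0e (_ : ysection _ _ = set0) ?measure0//.
apply/seteqP; split => p //=; rewrite /ysection/= inE /E/= => -[_ [_]] /mem_set.
by rewrite (negbTE yB).
Qed.
End covariogram.

Section polar_mass.
Context {R : realType}.
Local Notation mu := (@lebesgue_measure R).
Local Notation lambda := (@planar R).

Definition covariogram (S1 S2 : set (R * R)) (z : R * R) : \bar R :=
  lebesgue2 (S1 `&` [set p | S2 (p.1 + z.1, p.2 + z.2)]).

Lemma measurable_covariogram (S1 S2 : set (R * R)) :
  measurable S1 -> measurable S2 -> measurable_fun setT (covariogram S1 S2).
Proof.
move=> mS1 mS2.
pose E : set ((R * R) * (R * R)) := [set w | S1 w.1 /\
  S2 (w.1.1 + w.2.1, w.1.2 + w.2.2)].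
have mE : measurable E.
  apply: measurableI.
  - by rewrite -[X in measurable X]setTI; exact: measurable_fst.
  - rewrite -[X in measurable X]setTI.
    have ms : measurable_fun setT (fun w : (R * R) * (R * R) => (w.1.1 + w.2.1, w.1.2 + w.2.2)).
      by apply/measurable_fun_pair; apply: measurable_funD; exact: measurableT_comp.
    exact: ms.
pose T2 := (measurableTypeR R * measurableTypeR R)%type.
have mE' : measurable (E : set (T2 * T2)) by exact: mE.
have := measurable_fun_ysection lambda mE'.
apply: eq_measurable_fun => z _ /=; congr (lambda _).
by apply/seteqP; split => p; rewrite /ysection/= inE.
Qed.

Lemma pair_mass_polar (S1 S2 : set (R * R)) (D : R -> R -> R) (W : R -> R) (B : set R) :
  measurable S1 -> measurable S2 -> measurable B ->
  measurable_fun setT (fun z : R * R => D z.1 z.2) -> (forall x y, 0 <= D x y) ->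
  (forall r, continuous (fun phi : R => D (r * cos phi) (r * sin phi))) ->
  (forall x y : R, 0 < x -> 0 < y ->
    (covariogram S1 S2 (x, y) + covariogram S1 S2 (x, (- y)%R) +
    (covariogram S1 S2 ((- x)%R, y) + covariogram S1 S2 ((- x)%R, (- y)%R)) = (D x y)%:E)%E) ->
  (forall r, 0 < r -> (\int[mu]_(phi in `[0%R, (pi / 2)%R]) (D (r * cos phi) (r * sin phi))%:E = (W r)%:E)%E) ->
  pair_mass S1 S2 B = (\int[mu]_(t in B) (if (0 <= t)%R then t * W t else 0)%:E)%E.
Proof.
move=> mS1 mS2 mB mD D0 cD DE WE.
have mh : measurable_fun setT (fun z : R * R =>
    (\1_B (Num.sqrt (z.1 ^+ 2 + z.2 ^+ 2)))%:E * covariogram S1 S2 z)%E.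
  apply: emeasurable_funM; last exact: measurable_covariogram.
  apply/measurable_EFinP; apply: (measurableT_comp _ measurable_hypot).
  exact: measurable_indic.
rewrite pair_mass_covariogram//.
rewrite (ge0_integral_fold2 mh); last first.
  by move=> z; rewrite mule_ge0 ?lee_fin//; exact: measure_ge0.
have mB' : measurable_fun setT (\1_B : R -> R) by exact: measurable_indic.
transitivity (\int[mu]_(x in `]0%R, +oo[) \int[mu]_(y in `]0%R, +oo[)
    (\1_B (Num.sqrt (x ^+ 2 + y ^+ 2)) * D x y)%:E)%E.
  apply: eq_integral => x; rewrite inE/= in_itv/= andbT => x0.
  apply: eq_integral => y; rewrite inE/= in_itv/= andbT => y0.
  rewrite !sqrrN EFinM -DE//.
  have c0 z : (0 <= covariogram S1 S2 z)%E by exact: measure_ge0.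
  have cc z w : (0 <= covariogram S1 S2 z + covariogram S1 S2 w)%E by exact: adde_ge0.
  by rewrite (ge0_muleDr _ (cc _ _) (cc _ _)) !(ge0_muleDr _ (c0 _) (c0 _)).
rewrite (ge0_integral_polar mB')//.
rewrite integral_mkcond [RHS]integral_mkcond; apply: eq_integral => r _.
rewrite /patch mem_setE in_itv/= andbT.
have [r0|] := ltP 0 r.
  rewrite WE// -EFinM -mulrA indicE; case: (_ \in _); last by rewrite mul0r.
  by rewrite mul1r (ltW r0).
(* The closed condition 0 <= t is harmless at 0, where the factor t makes the integrand vanish
   whatever [W 0] is. *)
rewrite le_eqVlt => /predU1P[->|r0]; first by rewrite lexx mul0r; case: ifP.
by rewrite leNgt r0/=; case: ifP.
Qed.

End polar_mass.

Section ftc_global.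
Context {R : realType}.
Local Notation mu := (@lebesgue_measure R).

Lemma integral_is_derive (F f : R -> R) (s e : R) : s <= e ->
  (forall x : R, is_derive x 1 F (f x)) -> continuous f ->
  (\int[mu]_(x in `[s, e]) (f x)%:E = (F e - F s)%:E)%E.
Proof.
move=> se dF cf; move: se; rewrite le_eqVlt => /predU1P[->|se].
  by rewrite set_itv1 integral_set1 subrr.
have cF : continuous F.
  by move=> x; have [? _] := dF x; exact/differentiable_continuous/derivable1_diffP.
rewrite (@continuous_FTC2 _ f F)//.
- exact: continuous_subspaceT.
- split.
  + by move=> x _; have [] := dF x.
  + by apply: cvg_at_right_filter; exact: cF.
  + by apply: cvg_at_left_filter; exact: cF.
- by move=> x _; rewrite derive1E; have [_ ->] := dF x.
Qed.

Lemma ge0_integral_itv_split (f : R -> R) (s m e : R) : s <= m -> m <= e ->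
  measurable_fun setT f -> (forall x : R, 0 <= f x) ->
  (\int[mu]_(x in `[s, e]) (f x)%:E =
   \int[mu]_(x in `[s, m]) (f x)%:E + \int[mu]_(x in `[m, e]) (f x)%:E)%E.
Proof.
move=> sm me mf f0.
have mf' D : measurable_fun D (EFin \o f) by apply: measurable_funTS; exact/measurable_EFinP.
rewrite -[X in (_ = _ + X)%E]integral_itv_obnd_cbnd//.
rewrite -ge0_integral_setU//.
- by rewrite -itv_bndbnd_setU// bnd_simp.
- exact: mf'.
- by move=> x _; rewrite lee_fin.
- apply/disj_setPS => x /=; rewrite !in_itv/= => -[/andP[_ xm] /andP[mx _]].
  by move: mx; rewrite ltNge xm.
Qed.

End ftc_global.

(** * Covariograms of the rectangle and the triangle *)

Section corner.
Context {R : realType}.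
Local Notation mu := (@lebesgue_measure R).
Variables (a b : R).
Hypotheses (a0 : 0 < a) (b0 : 0 < b).

(** The triangles homothetic to [tri0], degenerate and empty ones included. The family is stable
    under translation and intersection, so every value of the covariogram of [tri0] is the area of
    one of them. *)
Definition corner (m1 m2 k : R) : set (R * R) :=
  [set p | [/\ m1 <= p.1, m2 <= p.2 & b * p.1 + a * p.2 <= k]].

Lemma measurable_le_affine (k l m : R) : measurable [set p : R * R | m <= k * p.1 + l * p.2].
Proof.
have mf : measurable_fun setT (fun p : R * R => k * p.1 + l * p.2).
  by apply: measurable_funD; exact: measurable_funM.
rewrite -[X in measurable X]setTI.
rewrite (_ : [set p : R * R | m <= k * p.1 + l * p.2] =
  (fun p : R * R => k * p.1 + l * p.2) @^-1` `[m, +oo[).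
  by apply: mf => //; exact: measurable_itv.
by apply/seteqP; split => p /=; rewrite in_itv/= andbT.
Qed.

Lemma measurable_corner m1 m2 k : measurable (corner m1 m2 k).
Proof.
rewrite (_ : corner m1 m2 k = [set p : R * R | m1 <= 1 * p.1 + 0 * p.2] `&`
  [set p : R * R | m2 <= 0 * p.1 + 1 * p.2] `&` [set p : R * R | - k <= - b * p.1 + - a * p.2]).
  by do ?apply: measurableI; exact: measurable_le_affine.
by apply/seteqP; split => p /=; rewrite /corner/= !mul1r !mul0r addr0 add0r
   !mulNr -opprD lerN2; [case|case=> -[]].
Qed.

(** With s = k - b m1 - a m2 the legs are s / b and s / a; [Num.max 0] accounts for the empty case s
    < 0. *)
Lemma lebesgue2_corner m1 m2 k :
  lebesgue2 (corner m1 m2 k) =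
  ((Num.max 0 (k - b * m1 - a * m2)) ^+ 2 / (2 * (a * b)))%:E.
Proof.
rewrite /lebesgue2 /product_measure1.
transitivity (\int[mu]_(x in `[m1, ((k - a * m2) / b)%R]) ((k - b * x) / a - m2)%:E)%E.
  rewrite [RHS]integral_mkcond; apply: eq_integral => /= x _; move: (x : R) => {}x.
  rewrite /patch mem_setE in_itv/=; case: ifPn => [/andP[m1x xk]|].
    rewrite (_ : xsection _ _ = `[m2, ((k - b * x) / a)%R]%classic); last first.
      apply/seteqP; split => y; rewrite /xsection/= inE /corner/= in_itv/= ler_pdivlMr//.
        by case=> _ -> /= ?; lra.
      by move=> /andP[-> yk]; split => //; lra.
    rewrite lebesgue_measure_itv/= lte_fin; case: ltP => // h.
    congr (_%:E); apply/eqP; rewrite eq_sym subr_eq0 eq_le h/= ler_pdivlMr//.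
    by move: xk; rewrite ler_pdivlMr// => xk; lra.
  rewrite negb_and -!ltNge => h.
  rewrite (_ : xsection _ _ = set0) ?measure0//.
  apply/seteqP; split => y //; rewrite /xsection/= inE /corner/= => -[m1x m2y].
  have := ler_wpM2l (ltW a0) m2y; move: h => /orP[|]; first by rewrite ltNge m1x.
  by rewrite ltr_pdivrMr// => ? ? ?; lra.
have [h|h] := leP 0 (k - b * m1 - a * m2); last first.
  rewrite expr0n mul0r set_itv_ge ?integral_set0//.
  by rewrite bnd_simp -ltNge ltr_pdivrMr//; lra.
have dF (x : R) : is_derive x 1 (fun x : R => (k / a - m2) * x - b / a * (x ^+ 2 / 2))
    ((k - b * x) / a - m2).
  apply: is_derive_eq; rewrite /GRing.scale/=; field.
  by rewrite gt_eqF.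
rewrite (integral_is_derive _ dF).
- by congr (_%:E); field; rewrite !gt_eqF.
- by rewrite ler_pdivlMr//; lra.
- move=> x; apply: cvgB; last exact: cvg_cst.
  apply: cvgM; last exact: cvg_cst.
  apply: cvgB; first exact: cvg_cst.
  by apply: cvgM; [exact: cvg_cst|exact: cvg_id].
Qed.
End corner.

Section covariograms.
Context {R : realType}.
Local Notation mu := (@lebesgue_measure R).
Variables (a b : R).
Hypotheses (a0 : 0 < a) (b0 : 0 < b).

Definition rect0 : set (R * R) := `[0, a]%classic `*` `[0, b]%classic.
Definition tri0 : set (R * R) := corner a b 0 0 (a * b).

Lemma measurable_rect0 : measurable rect0.
Proof. by apply: measurableX; exact: measurable_itv. Qed.

Lemma measurable_tri0 : measurable tri0.
Proof. exact: measurable_corner. Qed.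

Lemma lebesgue2_rect0 : lebesgue2 rect0 = (a * b)%:E.
Proof.
rewrite /lebesgue2 /rect0 product_measure1E//.
by rewrite /= !lebesgue_measure_itv/= !lte_fin a0 b0 !sube0.
Qed.

Lemma lebesgue2_tri0 : lebesgue2 tri0 = (a * b / 2)%:E.
Proof.
rewrite /tri0 lebesgue2_corner// !mulr0 !subr0 (max_idPr _) ?mulr_ge0 ?ltW//.
by congr (_%:E); field; rewrite !gt_eqF.
Qed.

Let slab (w x : R) : mu (`[0, w] `&` [set p | 0 <= p + x <= w]) = (Num.max 0 (w - `|x|))%:E.
Proof.
have [x0|x0] := leP 0 x.
  rewrite (_ : _ `&` _ = `[0, (w - x)%R]%classic).
    rewrite lebesgue_measure_itv/= lte_fin sube0 ger0_norm//.
    by case: ltP => //.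
  apply/seteqP; split => p /=; rewrite !in_itv/=.
    by case=> /andP[-> ?] /andP[? ?]/=; lra.
  by case/andP => ? ?; split; apply/andP; split; lra.
rewrite (_ : _ `&` _ = `[(- x)%R, w]%classic).
  rewrite lebesgue_measure_itv/= lte_fin ltr0_norm//.
  by case: ltP => h; rewrite -?EFinD; congr (_%:E);
    [rewrite (max_idPr _)|rewrite (max_idPl _)]; lra.
apply/seteqP; split => p /=; rewrite !in_itv/=.
  by case=> /andP[? ?] /andP[? ?]/=; lra.
by case/andP => ? ?; split; apply/andP; split; lra.
Qed.

Let measurable_slab (w x : R) : measurable (`[0, w] `&` [set p | 0 <= p + x <= w]).
Proof.
apply: measurableI; first exact: measurable_itv.
have mf : measurable_fun setT (fun p : R => p + x) by exact: measurable_funD.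
rewrite -[X in measurable X]setTI.
exact: mf measurableT `[0, w]%classic (measurable_itv _).
Qed.

Lemma covariogram_rect0 x y : covariogram rect0 rect0 (x, y) =
  (Num.max 0 (a - `|x|) * Num.max 0 (b - `|y|))%:E.
Proof.
rewrite /covariogram (_ : _ `&` _ = (`[0, a] `&` [set p | 0 <= p + x <= a]) `*`
  (`[0, b] `&` [set p | 0 <= p + y <= b])).
  rewrite /lebesgue2 product_measure1E.
  - by rewrite [LHS](congr2 mule (slab a x) (slab b y)) EFinM.
  - exact: measurable_slab.
  - exact: measurable_slab.
by apply/seteqP; split => p /=; rewrite /rect0/= !in_itv/= => -[[? ?] [? ?]].
Qed.

(** The conditions on p and on p + z merge into p.1 >= max(0, -x), p.2 >= max(0, -y) and b p.1 + a
    p.2 <= a b - max(0, b x + a y), which define a [corner]. *)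
Lemma covariogram_tri0 x y : covariogram tri0 tri0 (x, y) =
  ((Num.max 0 (a * b - Num.max 0 (b * x + a * y) - b * Num.max 0 (- x) -
     a * Num.max 0 (- y))) ^+ 2 / (2 * (a * b)))%:E.
Proof.
rewrite -lebesgue2_corner// /covariogram; congr (lebesgue2 _).
apply/seteqP; split => p; rewrite /tri0 /corner/= !ge_max; last first.
  rewrite lerBrDl -lerBrDr ge_max.
  case=> /andP[? ?] /andP[? ?] /andP[? ?]; do 2 split => //; lra.
rewrite lerBrDl -lerBrDr ge_max.
case=> -[? ? ?] [? ? ?]; split; apply/andP; split; lra.
Qed.

Lemma covariogram_rect0_sum (x y : R) : 0 < x -> 0 < y ->
  (covariogram rect0 rect0 (x, y) + covariogram rect0 rect0 (x, (- y)%R) +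
   (covariogram rect0 rect0 ((- x)%R, y) + covariogram rect0 rect0 ((- x)%R, (- y)%R)) =
  (4 * (Num.max 0 (a - x) * Num.max 0 (b - y)))%:E)%E.
Proof.
move=> x0 y0; rewrite !covariogram_rect0 !normrN !gtr0_norm//.
by rewrite -!EFinD; congr (_%:E); ring.
Qed.

(** Opposite vectors have the same covariogram: the two equal signs give the base a b - b x - a y,
    the two mixed ones a b - max(b x, a y). The doubling cancels the 2 in the area of a [corner]. *)
Lemma covariogram_tri0_sum (x y : R) : 0 < x -> 0 < y ->
  (covariogram tri0 tri0 (x, y) + covariogram tri0 tri0 (x, (- y)%R) +
   (covariogram tri0 tri0 ((- x)%R, y) + covariogram tri0 tri0 ((- x)%R, (- y)%R)) =
  ((Num.max 0 (a * b - b * x - a * y) ^+ 2 +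
    Num.max 0 (a * b - Num.max (b * x) (a * y)) ^+ 2) / (a * b))%:E)%E.
Proof.
move=> x0 y0; rewrite !covariogram_tri0 !opprK.
have ax : 0 < b * x by rewrite mulr_gt0.
have ay : 0 < a * y by rewrite mulr_gt0.
rewrite !(max_idPr (ltW x0)) !(max_idPr (ltW y0)).
have -> : Num.max 0 (- x) = 0 by apply/max_idPl; lra.
have -> : Num.max 0 (- y) = 0 by apply/max_idPl; lra.
have -> : Num.max 0 (b * x + a * y) = b * x + a * y by apply/max_idPr; lra.
have -> : Num.max 0 (b * - x + a * - y) = 0 by apply/max_idPl; lra.
have -> : a * b - Num.max 0 (b * x + a * - y) - b * 0 - a * y = a * b - Num.max (b * x) (a * y).
  by case: (leP (b * x)) => ?; case: (leP 0) => ?; lra.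
have -> : a * b - Num.max 0 (b * - x + a * y) - b * x - a * 0 = a * b - Num.max (b * x) (a * y).
  by case: (leP (b * x)) => ?; case: (leP 0) => ?; lra.
have -> : a * b - (b * x + a * y) - b * 0 - a * 0 = a * b - b * x - a * y by ring.
rewrite subr0 -!EFinD; congr (_%:E); field.
by rewrite !gt_eqF.
Qed.

End covariograms.

(** * Decomposition of the mass over the two triangles *)

Section pair_mass_algebra.
Context {R : realType}.
Local Notation lambda := (@planar R).
Local Notation T2 := (measurableTypeR R * measurableTypeR R)%type.
Implicit Types S : set (R * R).

Let ring_section S (B : set R) : measurable S -> measurable B -> forall p,
  measurable (S `&` [set q | B (eucl_dist p q)]).
Proof.
move=> mS mB p; apply: measurableI => //.
by rewrite -[X in measurable X]setTI; exact: measurable_eucl_distr.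
Qed.

Let setUD S S' : S `|` S' `\` S = S `|` S'.
Proof.
apply/seteqP; split => p; first by case=> [|[]]; [left|right].
by case=> [|S'p]; [left|have [|] := pselect (S p); [left|right]].
Qed.

Lemma pair_mass_transport (phi : R * R -> R * R) S1 S2 (B : set R) :
  measurable_fun setT phi ->
  (forall E, measurable E -> lebesgue2 (phi @^-1` E) = lebesgue2 E) ->
  (forall p q, eucl_dist (phi p) (phi q) = eucl_dist p q) ->
  measurable S1 -> measurable S2 -> measurable B ->
  pair_mass (phi @^-1` S1) (phi @^-1` S2) B = pair_mass S1 S2 B.
Proof.
move=> mphi phiL phiD mS1 mS2 mB; rewrite /pair_mass.
pose f p := lebesgue2 (S2 `&` [set q | B (eucl_dist p q)]).
have mf : measurable_fun setT f by exact: measurable_pair_mass.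
have f0 p : (0 <= f p)%E by exact: measure_ge0.
transitivity (\int[lambda]_(p in phi @^-1` S1) (f \o phi) p)%E.
  apply: eq_integral => p _; rewrite /f/= -(phiL (S2 `&` _)); last exact: ring_section.
  by congr lebesgue2; apply/seteqP; split => q /=; rewrite phiD.
pose phi' : T2 -> T2 := phi.
have mphi' : measurable_fun setT phi' by exact: mphi.
have mS1' : measurable (S1 : set T2) by [].
have mfS : measurable_fun (S1 : set T2) f by exact: measurable_funTS.
have := @ge0_integral_pushforward _ _ T2 T2 R phi' mphi' lambda S1 f mS1' mfS (fun y _ => f0 y).
move=> <-; apply: eq_measure_integral => //= A mA _.
exact: phiL.
Qed.

Lemma pair_massUr S1 S2 S2' (B : set R) :
  measurable S1 -> measurable S2 -> measurable S2' -> measurable B ->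
  lebesgue2 (S2 `&` S2') = 0%E ->
  pair_mass S1 (S2 `|` S2') B = (pair_mass S1 S2 B + pair_mass S1 S2' B)%E.
Proof.
move=> mS1 mS2 mS2' mB S20.
rewrite /pair_mass -ge0_integralD//.
- apply: eq_integral => p _; rewrite setIUl -setUD.
  have mE S : measurable S -> measurable (S `&` [set q | B (eucl_dist p q)] : set T2).
    by move=> mS; exact: ring_section.
  set A := S2 `&` _; set A' := S2' `&` _.
  have mA : measurable (A : set T2) by exact: mE.
  have mA' : measurable (A' : set T2) by exact: mE.
  transitivity (lambda A + lambda (A' `\` A))%E.
    rewrite -measureU//; first exact: measurableD.
    by apply/seteqP; split => q //= [? []].
  congr (_ + _)%E.
  have mS22 : measurable (S2 `&` S2' : set T2) by exact: measurableI.
  have A0 : lambda (A' `&` A) = 0%E.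
    apply: (subset_measure0 _ mS22 _ S20); first exact: measurableI.
    by move=> q [[? _] [? _]].
  by rewrite [RHS](measureDI lambda mA' mA) [X in (_ + X)%E]A0 adde0.
- by apply: measurable_funTS; exact: measurable_pair_mass.
- by apply: measurable_funTS; exact: measurable_pair_mass.
Qed.

Lemma pair_massUl S1 S1' S2 (B : set R) :
  measurable S1 -> measurable S1' -> measurable S2 -> measurable B ->
  lebesgue2 (S1 `&` S1') = 0%E ->
  pair_mass (S1 `|` S1') S2 B = (pair_mass S1 S2 B + pair_mass S1' S2 B)%E.
Proof.
move=> mS1 mS1' mS2 mB S10; rewrite /pair_mass.
set f := fun p => lebesgue2 _.
have mf : measurable_fun setT f by exact: measurable_pair_mass.
have f0 p : (0 <= f p)%E by exact: measure_ge0.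
have mS : measurable (S1' : set T2) by [].
have mS' : measurable (S1 : set T2) by [].
have mI : measurable (S1 `&` S1' : set T2) by exact: measurableI.
have -> : (\int[lambda]_(p in S1') f p = \int[lambda]_(p in S1' `\` S1) f p)%E.
  rewrite (ge0_negligible_integral mI)//.
  - by rewrite setDIr setDv setU0.
  - exact: measurable_funTS.
rewrite -ge0_integral_setU//.
- by rewrite setUD.
- exact: measurableD.
- exact: measurable_funTS.
- by apply/disj_setPS => p [? []].
Qed.
End pair_mass_algebra.

Section two_triangles.
Context {R : realType}.
Local Notation mu := (@lebesgue_measure R).
Local Notation T2 := (measurableTypeR R * measurableTypeR R)%type.
Variables (a b : R).
Hypotheses (a0 : 0 < a) (b0 : 0 < b).

(** The half-turn about the centre of the rectangle; the zero coefficients put it in the form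
    expected by [measurable_planar] and [lebesgue2_affine]. *)
Definition central_symmetry (p : R * R) : R * R :=
  (a + (-1) * p.1 + 0 * p.2, b + 0 * p.1 + (-1) * p.2).

Definition tri1 : set (R * R) := central_symmetry @^-1` tri0 a b.

Let measurable_symmetry : measurable_fun setT central_symmetry.
Proof. by apply/measurable_fun_pair; exact: measurable_planar. Qed.

Lemma measurable_tri1 : measurable tri1.
Proof.
rewrite -[X in measurable X]setTI; apply: measurable_symmetry => //.
exact: measurable_tri0.
Qed.

Let symmetry_measure E : measurable E ->
  lebesgue2 (central_symmetry @^-1` E) = lebesgue2 E.
Proof.
have d1 : (-1) * (-1) - 0 * 0 = 1 :> R by ring.
move=> mE; have d0 : (-1) * (-1) - 0 * 0 != 0 :> R by rewrite d1 oner_neq0.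
by have := lebesgue2_affine a b d0 mE; rewrite d1 normr1 invr1 mul1e.
Qed.

Let symmetry_dist p q :
  eucl_dist (central_symmetry p) (central_symmetry q) = eucl_dist p q.
Proof. by rewrite /eucl_dist /central_symmetry/=; congr Num.sqrt; ring. Qed.

Let symmetryK : central_symmetry @^-1` tri1 = tri0 a b.
Proof.
apply/seteqP; split => -[x y] /=; rewrite /tri1 /tri0 /corner /central_symmetry /=.
  by case=> ? ? ?; split; lra.
by case=> ? ? ?; split; lra.
Qed.

Lemma lebesgue2_tri1 : lebesgue2 tri1 = (a * b / 2)%:E.
Proof. by rewrite symmetry_measure ?lebesgue2_tri0//; exact: measurable_tri0. Qed.

Let rect0E : rect0 a b = tri0 a b `|` tri1.
Proof.
apply/seteqP; split => -[x y]; rewrite /tri1 /tri0 /rect0 /corner /central_symmetry /= !in_itv/=.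
  case=> /andP[? ?] /andP[? ?].
  by have [?|/ltW ?] := leP (b * x + a * y) (a * b); [left|right]; split; lra.
case=> -[x0 y0 h].
  have ? : x <= a by rewrite -(ler_pM2l b0); have := mulr_ge0 (ltW a0) y0; lra.
  have ? : y <= b by rewrite -(ler_pM2l a0); have := mulr_ge0 (ltW b0) x0; lra.
  by split; apply/andP; split.
have ? : 0 <= x by rewrite -(pmulr_rge0 _ b0); have := mulr_ge0 (ltW a0) y0; lra.
have ? : 0 <= y by rewrite -(pmulr_rge0 _ a0); have := mulr_ge0 (ltW b0) x0; lra.
by split; apply/andP; split; lra.
Qed.

(** The overlap lies on the line b x + a y = a b, which meets each vertical line in a single
    point. *)
Let diagonal_null : lebesgue2 (tri0 a b `&` tri1) = 0%E.
Proof.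
have mI : measurable (tri0 a b `&` tri1 : set T2).
  by apply: measurableI; [exact: measurable_tri0|exact: measurable_tri1].
rewrite /lebesgue2 /product_measure1 integral0_eq// => /= x _; move: (x : R) => {}x.
have mx := measurable_xsection x mI.
have ms : measurable ([set (a * b - b * x) / a] : set (measurableTypeR R)).
  exact: measurable_set1.
apply: (subset_measure0 mx ms _ (lebesgue_measure_set1 _)) => y.
rewrite /xsection/= inE /tri1 /tri0 /corner /central_symmetry /=.
move=> [[? ? ?] [? ? ?]]; apply/(mulIf (lt0r_neq0 a0)); rewrite divfK ?gt_eqF//.
by lra.
Qed.

Lemma pair_mass_rect0 (B : set R) : measurable B ->
  pair_mass (rect0 a b) (rect0 a b) B =
  (2%:E * pair_mass (tri0 a b) (tri0 a b) B + 2%:E * pair_mass (tri0 a b) tri1 B)%E.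
Proof.
move=> mB; rewrite rect0E.
have mt0 := measurable_tri0 a b; have mt1 := measurable_tri1.
rewrite pair_massUl//; last exact: measurableU.
rewrite !pair_massUr//.
have -> : pair_mass tri1 (tri0 a b) B = pair_mass (tri0 a b) tri1 B.
  by rewrite -[in LHS]symmetryK pair_mass_transport.
have -> : pair_mass tri1 tri1 B = pair_mass (tri0 a b) (tri0 a b) B.
  by rewrite pair_mass_transport.
move: (pair_mass _ _ B) (pair_mass _ tri1 B) => u v.
have E (w : \bar R) : (2%:E * w = w + w)%E by rewrite (mule_natl w 2) mule2n.
by rewrite !E [(v + u)%E]addeC addeACA.
Qed.

End two_triangles.

(** * Angular integrals *)

Section truncated_square.
Context {R : realType}.
Local Notation mu := (@lebesgue_measure R).
Implicit Types (w p psi phi : R).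

(** In polar coordinates [tri_weight] splits into such positive parts, with w = a b and p
    proportional to r. *)
Definition sqpart w p phi : R := Num.max 0 (w - p * cos phi) ^+ 2.

Definition sqprim w p phi : R :=
  w ^+ 2 * phi - 2 * w * p * sin phi + p ^+ 2 / 2 * (phi + sin phi * cos phi).

Lemma continuous_max0 : continuous (Num.max 0 : R -> R).
Proof.
move=> x; apply: (@continuous_max _ _ (cst 0) id); [exact: cvg_cst|exact: cvg_id].
Qed.

Lemma continuous_sqpart w p : continuous (sqpart w p).
Proof.
move=> x; apply: (continuous_comp (f := fun phi => Num.max 0 (w - p * cos phi)) (g := fun y => y ^+ 2)).
  apply: (continuous_comp (f := fun phi => w - p * cos phi) (g := Num.max 0)).
    apply: cvgB; first exact: cvg_cst.
    by apply: cvgM; [exact: cvg_cst|exact: continuous_cos].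
  exact: continuous_max0.
exact: exprn_continuous.
Qed.

Lemma measurable_sqpart w p : measurable_fun setT (sqpart w p).
Proof. by apply: continuous_measurable_fun; exact: continuous_sqpart. Qed.

Lemma sqpart_ge0 w p phi : 0 <= sqpart w p phi.
Proof. exact: sqr_ge0. Qed.

Let is_derive_sqprim w p phi : is_derive phi 1 (sqprim w p) ((w - p * cos phi) ^+ 2).
Proof.
rewrite /sqprim; apply: is_derive_eq; rewrite /GRing.scale/=.
have := cos2Dsin2 phi => h.
have h2 : sin phi ^+ 2 = 1 - cos phi ^+ 2 by lra.
by rewrite mulrN -(expr2 (sin phi)) h2; field.
Qed.

Let integral_sq w p s e : s <= e ->
  (\int[mu]_(phi in `[s, e]) ((w - p * cos phi) ^+ 2)%:E = (sqprim w p e - sqprim w p s)%:E)%E.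
Proof.
move=> se; apply: integral_is_derive => // x.
apply: (continuous_comp (f := fun phi => w - p * cos phi) (g := fun y => y ^+ 2)).
  apply: cvgB; first exact: cvg_cst.
  by apply: cvgM; [exact: cvg_cst|exact: continuous_cos].
exact: exprn_continuous.
Qed.

Let le_cos_itv psi phi : 0 <= phi -> phi <= psi -> psi <= pi / 2 -> cos psi <= cos phi.
Proof.
move=> phi0 phipsi psi2; have p0 := pi_gt0 R.
by rewrite leNgt ltr_cos ?in_itv/= -?leNgt//; apply/andP; split; lra.
Qed.

(** Since cos decreases on [0, psi], three regimes arise: no truncation if p <= w, a zero integrand
    if w <= p cos psi, and in between an integrand that vanishes up to acos(w / p) and is the plain
    square afterwards. *)
Lemma integral_sqpart_le w p psi : 0 <= p -> p <= w -> 0 <= psi <= pi / 2 ->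
  (\int[mu]_(phi in `[0%R, psi]) (sqpart w p phi)%:E = (sqprim w p psi)%:E)%E.
Proof.
move=> p0 pw /andP[psi0 psi2].
transitivity (\int[mu]_(phi in `[0%R, psi]) ((w - p * cos phi) ^+ 2)%:E)%E.
  apply: eq_integral => phi _; rewrite /sqpart (max_idPr _)//.
  by rewrite subr_ge0 (le_trans _ pw)// ler_piMr// cos_le1.
by rewrite integral_sq//; congr (_%:E); rewrite /sqprim sin0 cos0; field.
Qed.

Lemma integral_sqpart_gt w p psi : 0 < p -> 0 <= w <= p -> 0 <= psi <= pi / 2 ->
  w <= p * cos psi ->
  (\int[mu]_(phi in `[0%R, psi]) (sqpart w p phi)%:E = 0)%E.
Proof.
move=> p0 wp /andP[psi0 psi2] h; apply: integral0_eq => phi /=.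
rewrite in_itv/= => /andP[phi0 phipsi]; congr (_%:E).
rewrite /sqpart (max_idPl _) ?expr0n// subr_le0 (le_trans h)// ler_pM2l//.
exact: le_cos_itv.
Qed.

Lemma integral_sqpart_mid w p psi : 0 < p -> 0 <= w <= p -> 0 <= psi <= pi / 2 ->
  p * cos psi <= w ->
  (\int[mu]_(phi in `[0%R, psi]) (sqpart w p phi)%:E =
   (sqprim w p psi - sqprim w p (acos (w / p)))%:E)%E.
Proof.
move=> p0 /andP[w0 wp] /andP[psi0 psi2] h; set d := acos (w / p).
have wp1 : -1 <= w / p <= 1.
  by rewrite (le_trans _ (divr_ge0 w0 (ltW p0)))//= ler_pdivrMr// mul1r.
have d0 : 0 <= d by exact: acos_ge0.
have cosd : cos d = w / p by rewrite acosK.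
have dpsi : d <= psi.
  rewrite leNgt; apply/negP => psid.
  have : cos d < cos psi.
    rewrite ltr_cos ?in_itv/= ?d0 ?acos_lepi//.
    by have p0' := pi_gt0 R; apply/andP; split; lra.
  by rewrite cosd ltr_pdivrMr// mulrC ltNge h.
rewrite (ge0_integral_itv_split d0 dpsi (measurable_sqpart w p) (sqpart_ge0 w p)).
rewrite integral_sqpart_gt//; last 3 first.
- exact/andP.
- by rewrite d0 (le_trans dpsi).
- by rewrite cosd mulrC divfK ?gt_eqF.
rewrite add0e -integral_sq//; apply: eq_integral => phi; rewrite inE/= in_itv/= => /andP[dphi phipsi].
congr (_%:E); rewrite /sqpart (max_idPr _)// subr_ge0.
rewrite -ler_pdivlMl// mulrC -cosd; apply: le_cos_itv => //.
exact: le_trans psi2.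
Qed.

End truncated_square.

Section angular_substitution.
Context {R : realType}.
Local Notation mu := (@lebesgue_measure R).
Variable f : R -> R.
Hypotheses (mf : measurable_fun setT f) (f0 : forall x : R, 0 <= f x).

Let subst (k m s e : R) : k != 0 -> `|k| = 1 ->
  (\int[mu]_(x in `[s, e]) (f x)%:E =
   \int[mu]_x ((EFin \o f) \_ `[s, e] (k * x + m)%R))%E.
Proof.
move=> k0 k1; rewrite ge0_integral_affine//.
- by rewrite k1 invr1 mul1e integral_mkcond.
- apply: (measurable_restrictT _ (measurable_itv _)).1; apply: measurable_funTS.
  exact/measurable_EFinP.
- by move=> x; apply: erestrict_ge0 => // y _; rewrite lee_fin.
Qed.

Lemma integral_itv_shift (m l : R) :
  (\int[mu]_(x in `[m, (m + l)%R]) (f x)%:E = \int[mu]_(x in `[0%R, l]) (f (m + x))%:E)%E.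
Proof.
rewrite (subst m m (m + l) (oner_neq0 _) (normr1 _)) [RHS]integral_mkcond.
apply: eq_integral => /= x _; move: (x : R) => {}x.
rewrite /patch !mem_setE !in_itv/= mul1r (addrC x) lerDl lerD2l.
by [].
Qed.

Lemma integral_itv_reflect (m l : R) :
  (\int[mu]_(x in `[(m - l)%R, m]) (f x)%:E = \int[mu]_(x in `[0%R, l]) (f (m - x))%:E)%E.
Proof.
rewrite (@subst (-1) m (m - l) m) ?normrN1 ?oppr_eq0 ?oner_neq0// [RHS]integral_mkcond.
apply: eq_integral => /= x _; move: (x : R) => {}x.
rewrite /patch !mem_setE !in_itv/= mulN1r (addrC (- x)) lerD2l lerN2 gerBl.
by rewrite andbC.
Qed.

End angular_substitution.

Section triangle_angles.
Context {R : realType}.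
Local Notation mu := (@lebesgue_measure R).
Variables (a b : R).
Hypotheses (a0 : 0 < a) (ab : a <= b).
Let b0 : 0 < b. Proof. exact: lt_le_trans ab. Qed.
Local Notation c := (hypot a b).
Local Notation al := (alpha a b).

Lemma hypot_gt0 : 0 < c.
Proof. by rewrite sqrtr_gt0 addr_gt0// exprn_gt0. Qed.

Lemma hypot_sqr : c ^+ 2 = a ^+ 2 + b ^+ 2.
Proof. by rewrite sqr_sqrtr// addr_ge0// sqr_ge0. Qed.

Let sqrt_alpha : Num.sqrt (1 + (a / b) ^+ 2) = c / b.
Proof.
rewrite -(ger0_norm (_ : 0 <= c / b)); last by rewrite divr_ge0// ltW// hypot_gt0.
rewrite -sqrtr_sqr; congr Num.sqrt; rewrite !expr_div_n hypot_sqr.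
by field; rewrite gt_eqF.
Qed.

Lemma cos_alpha : cos al = b / c.
Proof. by rewrite /alpha cos_atan sqrt_alpha invf_div. Qed.

Lemma sin_alpha : sin al = a / c.
Proof.
rewrite /alpha sin_atan sqrt_alpha; field.
by rewrite !gt_eqF// hypot_gt0.
Qed.

Lemma alpha_gt0 : 0 < al.
Proof. by rewrite -(@atan0 R) lt_atan// divr_gt0. Qed.

Lemma alpha_lt_pihalf : al < pi / 2.
Proof. exact: atan_ltpi2. Qed.

Lemma hTE : hT a b = a * b / c.
Proof. by rewrite /hT cos_alpha mulrA. Qed.

Local Notation be := (pi / 2 - al).

Lemma cos_beta : cos be = a / c.
Proof. by rewrite -sin_alpha cosB cos_pihalf sin_pihalf mul0r add0r mul1r. Qed.

Lemma sin_beta : sin be = b / c.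
Proof. by rewrite -cos_alpha sinB cos_pihalf sin_pihalf mul0r subr0 mul1r. Qed.

(* [tri_weight] and [rect_weight] are the covariograms summed over the four
   sign changes of [(x, y)]; see [covariogram_tri0_sum]. *)
Definition tri_weight (x y : R) : R :=
  (Num.max 0 (a * b - b * x - a * y) ^+ 2 +
   Num.max 0 (a * b - Num.max (b * x) (a * y)) ^+ 2) / (a * b).

Definition rect_weight (x y : R) : R :=
  4 * (Num.max 0 (a - x) * Num.max 0 (b - y)).

Let cvg_sqr (f : R -> R) x : {for x, continuous f} -> {for x, continuous (fun y => f y ^+ 2)}.
Proof.
by move=> cf; apply: (continuous_comp (f := f) (g := fun y : R => y ^+ 2)) => //; exact: exprn_continuous.
Qed.

Let cvg_max (f g : R -> R) x : {for x, continuous f} -> {for x, continuous g} ->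
  {for x, continuous (fun y => Num.max (f y) (g y))}.
Proof. by move=> cf cg; exact: continuous_max. Qed.

Let cvg_cos (k r x : R) : {for x, continuous (fun y => k * (r * cos y))}.
Proof.
by apply: cvgM; [exact: cvg_cst|apply: cvgM; [exact: cvg_cst|exact: continuous_cos]].
Qed.

Let cvg_sin (k r x : R) : {for x, continuous (fun y => k * (r * sin y))}.
Proof.
by apply: cvgM; [exact: cvg_cst|apply: cvgM; [exact: cvg_cst|exact: continuous_sin]].
Qed.

Let cvg_tri1 (r x : R) : {for x, continuous (fun phi =>
  Num.max 0 (a * b - b * (r * cos phi) - a * (r * sin phi)) ^+ 2)}.
Proof.
apply: cvg_sqr; apply: cvg_max; first exact: cvg_cst.
apply: cvgB; last exact: cvg_sin.
by apply: cvgB; [exact: cvg_cst|exact: cvg_cos].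
Qed.

Let cvg_tri2 (r x : R) : {for x, continuous (fun phi =>
  Num.max 0 (a * b - Num.max (b * (r * cos phi)) (a * (r * sin phi))) ^+ 2)}.
Proof.
apply: cvg_sqr; apply: cvg_max; first exact: cvg_cst.
apply: cvgB; first exact: cvg_cst.
by apply: (@cvg_max (fun y => b * (r * cos y)) (fun y => a * (r * sin y)));
  [exact: cvg_cos|exact: cvg_sin].
Qed.

Lemma continuous_tri_weight (r : R) :
  continuous (fun phi : R => tri_weight (r * cos phi) (r * sin phi)).
Proof.
move=> x; apply: cvgM; last exact: cvg_cst.
by apply: cvgD; [exact: cvg_tri1|exact: cvg_tri2].
Qed.

Lemma continuous_rect_weight (r : R) :
  continuous (fun phi : R => rect_weight (r * cos phi) (r * sin phi)).
Proof.
move=> x; apply: cvgM; first exact: cvg_cst.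
have cc : {for x, continuous (fun phi : R => Num.max 0 (a - r * cos phi))}.
  apply: cvg_max; first exact: cvg_cst.
  apply: cvgB; first exact: cvg_cst.
  by apply: cvgM; [exact: cvg_cst|exact: continuous_cos].
have cs : {for x, continuous (fun phi : R => Num.max 0 (b - r * sin phi))}.
  apply: cvg_max; first exact: cvg_cst.
  apply: cvgB; first exact: cvg_cst.
  by apply: cvgM; [exact: cvg_cst|exact: continuous_sin].
exact: cvgM cc cs.
Qed.

Let measurable_proj (k : R) :
  measurable_fun setT (fun z : R * R => k * z.1) /\
  measurable_fun setT (fun z : R * R => k * z.2).
Proof. by split; exact: measurable_funM. Qed.

Let measurable_max0 (f : R * R -> R) : measurable_fun setT f ->
  measurable_fun setT (fun z => Num.max 0 (f z)).
Proof. exact: (measurable_maxr (f := cst 0)). Qed.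

Lemma measurable_tri_weight :
  measurable_fun setT (fun z : R * R => tri_weight z.1 z.2).
Proof.
have [m1 _] := measurable_proj b; have [_ m2] := measurable_proj a.
apply: measurable_funM => //; apply: measurable_funD; apply: measurable_funX;
  apply: measurable_max0; apply: measurable_funB => //.
- exact: measurable_funB.
- exact: measurable_maxr.
Qed.

Lemma measurable_rect_weight :
  measurable_fun setT (fun z : R * R => rect_weight z.1 z.2).
Proof.
apply: measurable_funM => //; apply: measurable_funM; apply: measurable_max0;
  exact: measurable_funB.
Qed.

Lemma tri_weight_ge0 (x y : R) : 0 <= tri_weight x y.
Proof. by rewrite divr_ge0 ?addr_ge0 ?sqr_ge0 ?mulr_ge0// ltW. Qed.

Lemma rect_weight_ge0 (x y : R) : 0 <= rect_weight x y.
Proof. by rewrite mulr_ge0// mulr_ge0// le_max lexx. Qed.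

Definition sqpart_integral (w p psi : R) : \bar R :=
  (\int[mu]_(phi in `[0%R, psi]) (sqpart w p phi)%:E)%E.

Lemma tri_weight_cos (r phi : R) :
  a * b - b * (r * cos phi) - a * (r * sin phi) = a * b - r * c * cos (phi - al).
Proof.
rewrite cosB cos_alpha sin_alpha; field.
by rewrite gt_eqF// hypot_gt0.
Qed.

(* In polar coordinates [b * x + a * y] is [r * c * cos (phi - al)], and the
   maximum switches from [b * x] to [a * y] at [phi = be]: after cutting at [al]
   and at [be] respectively, each piece is a cosine of an angle starting at 0. *)
Lemma integral_tri_weight (r : R) : 0 < r ->
  (\int[mu]_(phi in `[0%R, (pi / 2)%R]) (tri_weight (r * cos phi) (r * sin phi))%:E =
   ((a * b)^-1)%:E * ((sqpart_integral (a * b) (r * c) be + sqpart_integral (a * b) (r * c) al) +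
     (sqpart_integral (a * b) (b * r) be + sqpart_integral (a * b) (a * r) al)))%E.
Proof.
move=> r0.
have al0 := ltW alpha_gt0; have al2 := ltW alpha_lt_pihalf.
have be0 : 0 <= be by rewrite subr_ge0.
pose f1 phi := Num.max 0 (a * b - b * (r * cos phi) - a * (r * sin phi)) ^+ 2.
pose f2 phi := Num.max 0 (a * b - Num.max (b * (r * cos phi)) (a * (r * sin phi))) ^+ 2.
have f10 phi : 0 <= f1 phi by exact: sqr_ge0.
have f20 phi : 0 <= f2 phi by exact: sqr_ge0.
have mf1 : measurable_fun setT f1.
  by apply: continuous_measurable_fun; exact: cvg_tri1.
have mf2 : measurable_fun setT f2.
  by apply: continuous_measurable_fun; exact: cvg_tri2.
have mE (f : R -> R) D : measurable_fun setT f -> measurable_fun D (EFin \o f).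
  by move=> mf; apply: measurable_funTS; exact/measurable_EFinP.
transitivity (\int[mu]_(phi in `[0%R, (pi / 2)%R]) (((a * b)^-1)%:E * ((f1 phi)%:E + (f2 phi)%:E)))%E.
  by apply: eq_integral => phi _; rewrite /tri_weight -EFinD -EFinM mulrC.
rewrite ge0_integralZl//; last 3 first.
- by apply: emeasurable_funD; exact: mE.
- by move=> phi _; rewrite adde_ge0// lee_fin.
- by rewrite lee_fin invr_ge0 mulr_ge0// ltW.
rewrite ge0_integralD//; [|by move=> x _; rewrite lee_fin|exact: mE|by move=> x _; rewrite lee_fin|exact: mE].
congr (_ * (_ + _))%E.
  rewrite (ge0_integral_itv_split al0 al2)// addeC; congr (_ + _)%E.
    have := integral_itv_shift mf1 f10 al be; rewrite subrKC => ->.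
    by apply: eq_integral => phi _; rewrite /f1 tri_weight_cos [al + phi]addrC addrK.
  have := integral_itv_reflect mf1 f10 al al; rewrite subrr => ->.
  by apply: eq_integral => phi _; rewrite /f1 tri_weight_cos addrAC subrr sub0r cosN.
have be2 : be <= pi / 2 by rewrite gerBl.
have c0 := hypot_gt0; have pi0 := pi_gt0 R.
rewrite (ge0_integral_itv_split be0 be2)//; congr (_ + _)%E.
  apply: eq_integral => phi; rewrite inE/= in_itv/= => /andP[phi0 phibe].
  have m : Num.max (b * (r * cos phi)) (a * (r * sin phi)) = b * r * cos phi.
    rewrite -mulrA; apply/max_idPl.
    rewrite mulrCA [leRHS]mulrCA ler_pM2l// -subr_ge0.
    rewrite (_ : _ - _ = c * cos (al + phi)); last first.
      by rewrite cosD cos_alpha sin_alpha; field; rewrite gt_eqF.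
    by rewrite mulr_ge0 ?(ltW c0)// cos_ge0_pihalf//; apply/andP; split; lra.
  by rewrite /f2 /sqpart m.
have := integral_itv_reflect mf2 f20 (pi / 2) al => ->.
apply: eq_integral => phi; rewrite inE/= in_itv/= => /andP[phi0 phial].
rewrite /f2 /sqpart cosB sinB cos_pihalf sin_pihalf !(mul0r, mul1r, add0r, subr0).
have m : Num.max (b * (r * sin phi)) (a * (r * cos phi)) = a * r * cos phi.
  rewrite -mulrA; apply/max_idPr.
  rewrite mulrCA [leRHS]mulrCA ler_pM2l// -subr_ge0.
  rewrite (_ : _ - _ = c * sin (al - phi)); last first.
    by rewrite sinB cos_alpha sin_alpha; field; rewrite gt_eqF.
  by rewrite mulr_ge0 ?(ltW c0)// sin_ge0_pi//; apply/andP; split; lra.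
by rewrite m.
Qed.

End triangle_angles.

Section triangle_weight_value.
Context {R : realType}.
Local Notation mu := (@lebesgue_measure R).
Variables (a b : R).
Hypotheses (a0 : 0 < a) (ab : a <= b).
Let b0 : 0 < b. Proof. exact: lt_le_trans ab. Qed.
Local Notation c := (hypot a b).
Local Notation al := (alpha a b).
Local Notation be := (pi / 2 - al).
Local Notation h := (hT a b).
Let c0 : 0 < c. Proof. exact: hypot_gt0. Qed.
Let al0 : 0 <= al. Proof. exact/ltW/alpha_gt0. Qed.
Let be0 : 0 <= be. Proof. by rewrite subr_ge0; exact/ltW/alpha_lt_pihalf. Qed.

Lemma acosE (x : R) : -1 <= x <= 1 -> acos x = pi / 2 - asin x.
Proof.
move=> x1; have p0 := pi_gt0 R.
have h1 := asin_geNpi2 x1; have h2 := asin_lepi2 x1.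
rewrite -[in RHS](cosK (_ : pi / 2 - asin x \in `[0, pi])); last first.
  by rewrite in_itv/=; apply/andP; split; lra.
rewrite cosB cos_pihalf sin_pihalf mul0r add0r mul1r asinK//.
Qed.

(** At d = acos(x / r) one has p cos d = w and p sin d = q sqrt(r^2 - x^2); the coefficient -3 / 2
    is -2 from the linear term plus 1 / 2 from sin d cos d. *)
Lemma sqprim_acos (q x r : R) : 0 < q -> 0 < r -> 0 <= x <= r ->
  sqprim (q * x) (q * r) (acos (q * x / (q * r))) =
  ((q * x) ^+ 2 + (q * r) ^+ 2 / 2) * (pi / 2 - asin (x / r))
  - 3 / 2 * (q * x) * (q * Num.sqrt (r ^+ 2 - x ^+ 2)).
Proof.
move=> q0 r0 /andP[x0 xr].
have -> : q * x / (q * r) = x / r by field; rewrite !gt_eqF.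
have xr1 : -1 <= x / r <= 1.
  by rewrite (le_trans _ (divr_ge0 x0 (ltW r0)))//= ler_pdivrMr// mul1r.
have -> : Num.sqrt (r ^+ 2 - x ^+ 2) = r * sin (acos (x / r)).
  rewrite (_ : r ^+ 2 - x ^+ 2 = r ^+ 2 * (1 - (x / r) ^+ 2)); last first.
    by field; rewrite gt_eqF.
  by rewrite sqrtrM ?sqr_ge0// sqrtr_sqr gtr0_norm// sin_acos.
rewrite -acosE// /sqprim acosK//; field.
by rewrite gt_eqF.
Qed.

(* E1, E1', E2, E3 are the four angular integrals for small [r]; D1, D2, D3 are
   what the truncation removes from them beyond [h], [a], [b]. *)
Let E1 r := (a * b) ^+ 2 * be - 2 * (a * b) * r * b
  + r ^+ 2 / 2 * ((a ^+ 2 + b ^+ 2) * be + a * b).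
Let E1' r := (a * b) ^+ 2 * al - 2 * (a * b) * r * a
  + r ^+ 2 / 2 * ((a ^+ 2 + b ^+ 2) * al + a * b).
Let E2 r := (a * b) ^+ 2 * be - 2 * (a * b) * (b * r) * (b / c)
  + (b * r) ^+ 2 / 2 * (be + a * b / (a ^+ 2 + b ^+ 2)).
Let E3 r := (a * b) ^+ 2 * al - 2 * (a * b) * (a * r) * (a / c)
  + (a * r) ^+ 2 / 2 * (al + a * b / (a ^+ 2 + b ^+ 2)).
Let D1 r := ((a * b) ^+ 2 + (a ^+ 2 + b ^+ 2) * r ^+ 2 / 2) * (pi / 2 - asin (h / r))
  - 3 / 2 * (a * b) * (c * Num.sqrt (r ^+ 2 - h ^+ 2)).
Let D2 r := ((a * b) ^+ 2 + (b * r) ^+ 2 / 2) * (pi / 2 - asin (a / r))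
  - 3 / 2 * (a * b) * (b * Num.sqrt (r ^+ 2 - a ^+ 2)).
Let D3 r := ((a * b) ^+ 2 + (a * r) ^+ 2 / 2) * (pi / 2 - asin (b / r))
  - 3 / 2 * (a * b) * (a * Num.sqrt (r ^+ 2 - b ^+ 2)).

Let c2 := hypot_sqr a b.

Let E1E r : sqprim (a * b) (r * c) be = E1 r.
Proof.
rewrite /sqprim cos_beta// sin_beta// /E1 -c2; field.
by rewrite gt_eqF.
Qed.

Let E1'E r : sqprim (a * b) (r * c) al = E1' r.
Proof.
rewrite /sqprim cos_alpha// sin_alpha// /E1' -c2; field.
by rewrite gt_eqF.
Qed.

Let E2E r : sqprim (a * b) (b * r) be = E2 r.
Proof.
rewrite /sqprim cos_beta// sin_beta// /E2 -c2; field.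
by rewrite gt_eqF.
Qed.

Let E3E r : sqprim (a * b) (a * r) al = E3 r.
Proof.
rewrite /sqprim cos_alpha// sin_alpha// /E3 -c2; field.
by rewrite gt_eqF.
Qed.

Let hc : h * c = a * b.
Proof. by rewrite hTE// divfK// gt_eqF. Qed.

Let h0 : 0 < h.
Proof. by rewrite hTE// !divr_gt0// mulr_gt0. Qed.

Let ha : h <= a.
Proof.
rewrite hTE// ler_pdivrMr// ler_pM2l// -(ler_pXn2r (_ : (0 < 2)%N)) ?nnegrE ?(ltW b0) ?(ltW c0)//.
by rewrite c2 lerDr sqr_ge0.
Qed.

Let D1E r : h <= r -> sqprim (a * b) (r * c) (acos (a * b / (r * c))) = D1 r.
Proof.
move=> hr; have r0 : 0 < r by exact: lt_le_trans hr.
rewrite -hc [h * c]mulrC [r * c]mulrC sqprim_acos ?(ltW h0)// /D1 -hc -c2.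
by field.
Qed.

Let D2E r : a <= r -> sqprim (a * b) (b * r) (acos (a * b / (b * r))) = D2 r.
Proof.
move=> ar; have r0 : 0 < r by exact: lt_le_trans ar.
by rewrite [a * b]mulrC sqprim_acos ?(ltW a0)// /D2 [b * a]mulrC.
Qed.

Let D3E r : b <= r -> sqprim (a * b) (a * r) (acos (a * b / (a * r))) = D3 r.
Proof.
move=> br; have r0 : 0 < r by exact: lt_le_trans br.
by rewrite sqprim_acos ?(ltW b0).
Qed.

(** The candidate for the angular integral W(r), read off [gT]: the density is r times this value,
    divided by the squared area of the triangle ([gTE]). [rect_value] plays the same part for
    [gR]. *)
Definition tri_value (r : R) : R :=
  if r <= c then a * b * pi + 2 * (Js a b r - uT a b * r) else 0.

Let sqrt_ah : Num.sqrt (a ^+ 2 - h ^+ 2) = a ^+ 2 / c.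
Proof.
rewrite -(ger0_norm (_ : 0 <= a ^+ 2 / c)); last by rewrite divr_ge0 ?sqr_ge0// ltW.
rewrite -sqrtr_sqr; congr Num.sqrt; rewrite hTE// !expr_div_n c2.
by field; rewrite -c2 sqrf_eq0 gt_eqF.
Qed.

Let sqrt_bh : Num.sqrt (b ^+ 2 - h ^+ 2) = b ^+ 2 / c.
Proof.
rewrite -(ger0_norm (_ : 0 <= b ^+ 2 / c)); last by rewrite divr_ge0 ?sqr_ge0// ltW.
rewrite -sqrtr_sqr; congr Num.sqrt; rewrite hTE// !expr_div_n c2.
by field; rewrite -c2 sqrf_eq0 gt_eqF.
Qed.

Let asin_ha : asin (h / a) = be.
Proof.
rewrite -[RHS]sinK ?sin_beta//.
  by congr asin; rewrite hTE//; field; rewrite !gt_eqF.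
have := pi_gt0 R; have := be0; have := al0 => ? ? ?.
by rewrite in_itv/=; apply/andP; split; lra.
Qed.

Let asin_hb : asin (h / b) = al.
Proof.
rewrite -[RHS]sinK ?sin_alpha//.
  by congr asin; rewrite hTE//; field; rewrite !gt_eqF.
have := pi_gt0 R; have := be0; have := al0 => ? ? ?.
by rewrite in_itv/=; apply/andP; split; lra.
Qed.

Lemma asin1 : asin (1 : R) = pi / 2.
Proof.
have := @sinK R (pi / 2); rewrite sin_pihalf; apply.
by rewrite in_itv/=; have := pi_gt0 R; lra.
Qed.

Let asin_self x : 0 < x -> asin (x / x) = pi / 2 :> R.
Proof. by move=> x0; rewrite divff ?gt_eqF// asin1. Qed.

Let sqrt_self x : Num.sqrt (x ^+ 2 - x ^+ 2) = 0 :> R.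
Proof. by rewrite subrr sqrtr0. Qed.

(** On each range of r the formula for J* is compared with the angular pieces that survive there;
    the factor a b clears the denominator of [tri_weight]. *)
Let Js1 r : r < h -> a * b * (a * b * pi + 2 * (Js a b r - uT a b * r)) = E1 r + E1' r + (E2 r + E3 r).
Proof.
move=> rh; rewrite /Js rh /J1s /H1s /Theta1 /uT /E1 /E1' /E2 /E3 -!c2.
field: c2.
by rewrite !gt_eqF.
Qed.

Let Js2 r : h <= r -> r < a ->
  a * b * (a * b * pi + 2 * (Js a b r - uT a b * r)) =
  (E1 r - D1 r) + (E1' r - D1 r) + (E2 r + E3 r).
Proof.
move=> hr ra; rewrite /Js ltNge hr/= ra /J1s /J2s /H1s /H2s /Theta1 /Theta2 /Theta3 /uT.
rewrite /L1s /L2s asin_self// sqrt_self /E1 /E1' /E2 /E3 /D1 -!c2.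
(* The identity is linear in the arcsine and in the root, so both may become free variables; the
   only relation left is c^2 = a^2 + b^2. *)
move: (asin (h / r)) (Num.sqrt (r ^+ 2 - h ^+ 2)) => A S.
rewrite hTE//.
field: c2.
by rewrite !gt_eqF.
Qed.

Let Js3 r : a <= r -> r < b ->
  a * b * (a * b * pi + 2 * (Js a b r - uT a b * r)) =
  (E1 r - D1 r) + (E2 r - D2 r + E3 r).
Proof.
move=> ar rb; rewrite /Js !ltNge (le_trans ha ar) ar/= -ltNge rb.
rewrite /J1s /J2s /J3s /H1s /H2s /H3s /Theta1 /Theta2 /Theta3 /Theta4 /uT.
rewrite /L1s /L2s !asin_self// !sqrt_self sqrt_ah asin_ha /E1 /E2 /E3 /D1 /D2 -!c2.
move: (asin (h / r)) (Num.sqrt (r ^+ 2 - h ^+ 2)) => A S.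
move: (asin (a / r)) (Num.sqrt (r ^+ 2 - a ^+ 2)) => A' S'.
rewrite hTE//.
field: c2.
by rewrite !gt_eqF.
Qed.

Let Js4 r : b <= r ->
  a * b * (a * b * pi + 2 * (Js a b r - uT a b * r)) = E2 r - D2 r + (E3 r - D3 r).
Proof.
move=> br; have ar := le_trans ab br; rewrite /Js !ltNge (le_trans ha ar) ar br/=.
rewrite /J1s /J2s /J3s /J4s /H1s /H2s /H3s /H4s /Theta1 /Theta2 /Theta3 /Theta4 /Theta5 /Theta6 /uT.
rewrite /L1s /L2s !asin_self// !sqrt_self sqrt_ah sqrt_bh asin_ha asin_hb /E2 /E3 /D2 /D3 -!c2.
move: (asin (b / r)) (Num.sqrt (r ^+ 2 - b ^+ 2)) => A S.
move: (asin (a / r)) (Num.sqrt (r ^+ 2 - a ^+ 2)) => A' S'.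
(* These come from H_3* and H_4* at t = b, where they have the same coefficients, and cancel. *)
move: (asin (a / b)) (Num.sqrt (b ^+ 2 - a ^+ 2)) => A'' S''.
rewrite hTE//.
field: c2.
by rewrite !gt_eqF.
Qed.

(** Truncation begins when p = r c reaches w = a b, at r = h, and fills [0, be] when p cos be = a r
    reaches a b, at r = b. The same computation gives the thresholds h and a, a and c, b and c for
    the other three pieces. *)
Let PP1 r : 0 < r -> sqpart_integral (a * b) (r * c) be =
  (if r < h then E1 r else if r < b then E1 r - D1 r else 0)%:E.
Proof.
move=> r0; have be2 : 0 <= be <= pi / 2 by rewrite be0 gerBl.
have rc0 : 0 < r * c by exact: mulr_gt0.
have ab0 : 0 <= a * b by rewrite mulr_ge0 ?ltW.
have cE : r * c * cos be = a * r by rewrite cos_beta//; field; rewrite gt_eqF.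
case: (ltP r h) => [rh|hr].
  by rewrite /sqpart_integral integral_sqpart_le ?E1E ?(ltW rc0)// -hc ler_pM2r// ltW.
have wp : 0 <= a * b <= r * c by rewrite ab0 -hc ler_pM2r.
case: (ltP r b) => [rb|br].
  by rewrite /sqpart_integral integral_sqpart_mid// ?E1E ?D1E// cE ler_pM2l// ltW.
by rewrite /sqpart_integral integral_sqpart_gt// cE ler_pM2l.
Qed.

Let PP1' r : 0 < r -> sqpart_integral (a * b) (r * c) al =
  (if r < h then E1' r else if r < a then E1' r - D1 r else 0)%:E.
Proof.
move=> r0; have al2 : 0 <= al <= pi / 2 by rewrite al0 ltW// alpha_lt_pihalf.
have rc0 : 0 < r * c by exact: mulr_gt0.
have ab0 : 0 <= a * b by rewrite mulr_ge0 ?ltW.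
have cE : r * c * cos al = b * r by rewrite cos_alpha//; field; rewrite gt_eqF.
case: (ltP r h) => [rh|hr].
  by rewrite /sqpart_integral integral_sqpart_le ?E1'E ?(ltW rc0)// -hc ler_pM2r// ltW.
have wp : 0 <= a * b <= r * c by rewrite ab0 -hc ler_pM2r.
case: (ltP r a) => [ra|ar].
  by rewrite /sqpart_integral integral_sqpart_mid// ?E1'E ?D1E// cE (mulrC a) ler_pM2l// ltW.
by rewrite /sqpart_integral integral_sqpart_gt// cE (mulrC a) ler_pM2l.
Qed.

Let PP2 r : 0 < r -> sqpart_integral (a * b) (b * r) be =
  (if r < a then E2 r else if r <= c then E2 r - D2 r else 0)%:E.
Proof.
move=> r0; have be2 : 0 <= be <= pi / 2 by rewrite be0 gerBl.
have br0 : 0 < b * r by exact: mulr_gt0.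
have ab0 : 0 <= a * b by rewrite mulr_ge0 ?ltW.
have cE : b * r * cos be = a * b * (r / c) by rewrite cos_beta//; field; rewrite gt_eqF.
case: (ltP r a) => [ra|ar].
  by rewrite /sqpart_integral integral_sqpart_le ?E2E ?(ltW br0)// [a * b]mulrC ler_pM2l// ltW.
have wp : 0 <= a * b <= b * r by rewrite ab0 [a * b]mulrC ler_pM2l.
have ab0' : 0 < a * b by exact: mulr_gt0.
case: (leP r c) => [rc|cr].
  by rewrite /sqpart_integral integral_sqpart_mid// ?E2E ?D2E// cE ler_piMr// ler_pdivrMr// mul1r.
by rewrite /sqpart_integral integral_sqpart_gt// cE ler_peMr// ler_pdivlMr// mul1r ltW.
Qed.

Let PP3 r : 0 < r -> sqpart_integral (a * b) (a * r) al =
  (if r < b then E3 r else if r <= c then E3 r - D3 r else 0)%:E.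
Proof.
move=> r0; have al2 : 0 <= al <= pi / 2 by rewrite al0 ltW// alpha_lt_pihalf.
have ar0 : 0 < a * r by exact: mulr_gt0.
have ab0 : 0 <= a * b by rewrite mulr_ge0 ?ltW.
have cE : a * r * cos al = a * b * (r / c) by rewrite cos_alpha//; field; rewrite gt_eqF.
case: (ltP r b) => [rb|br].
  by rewrite /sqpart_integral integral_sqpart_le ?E3E ?(ltW ar0)// ler_pM2l// ltW.
have wp : 0 <= a * b <= a * r by rewrite ab0 ler_pM2l.
case: (leP r c) => [rc|cr].
  by rewrite /sqpart_integral integral_sqpart_mid// ?E3E ?D3E// cE ler_piMr// ler_pdivrMr// mul1r.
by rewrite /sqpart_integral integral_sqpart_gt// cE ler_peMr// ler_pdivlMr// mul1r ltW.
Qed.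

Lemma legs_le_hypot : (a <= c) /\ (b <= c).
Proof.
by split; rewrite -(ler_pXn2r (_ : (0 < 2)%N)) ?nnegrE ?(ltW a0) ?(ltW b0) ?(ltW c0)// c2
  ?lerDl ?lerDr sqr_ge0.
Qed.

Lemma integral_tri_weight_value r : 0 < r ->
  (\int[mu]_(phi in `[0%R, (pi / 2)%R]) (tri_weight a b (r * cos phi) (r * sin phi))%:E
   = (tri_value r)%:E)%E.
Proof.
move=> r0; rewrite integral_tri_weight// PP1// PP1'// PP2// PP3//.
have [ac bc] := legs_le_hypot.
have ab0 : a * b != 0 by rewrite gt_eqF// mulr_gt0.
rewrite -!EFinD -EFinM; congr (_%:E); rewrite /tri_value.
have [rh|hr] := ltP r h.
  have ra := lt_le_trans rh ha; have rb := lt_le_trans ra ab.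
  by rewrite ra rb (le_trans (ltW rb) bc) -Js1// mulrA mulVf// mul1r.
have [ra|ar] := ltP r a.
  have rb := lt_le_trans ra ab.
  by rewrite rb (le_trans (ltW rb) bc) -Js2// mulrA mulVf// mul1r.
have [rb|br] := ltP r b.
  by rewrite (le_trans (ltW rb) bc) addr0 -Js3// mulrA mulVf// mul1r.
rewrite !add0r; case: ifPn => rc; first by rewrite -Js4// mulrA mulVf// mul1r.
by rewrite addr0 mulr0.
Qed.

End triangle_weight_value.

(** * The angular integral of the rectangle *)

Section rectangle_weight_value.
Context {R : realType}.
Local Notation mu := (@lebesgue_measure R).
Variables (a b : R).
Hypotheses (a0 : 0 < a) (ab : a <= b).
Let b0 : 0 < b. Proof. exact: lt_le_trans ab. Qed.
Local Notation c := (hypot a b).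
Let c0 : 0 < c. Proof. exact: hypot_gt0. Qed.
Let c2 := hypot_sqr a b.

Definition rect_value (r : R) : R := if r <= c then 2 * JsR a b r else 0.

Let Q (r phi : R) := 4 * (a * b * phi - b * r * sin phi + a * r * cos phi + r ^+ 2 * sin phi ^+ 2 / 2).

Let is_derive_Q (r phi : R) : is_derive phi 1 (Q r) (4 * ((a - r * cos phi) * (b - r * sin phi))).
Proof.
rewrite /Q; apply: is_derive_eq; rewrite /GRing.scale/=.
by field.
Qed.

Let f r (phi : R) := rect_weight a b (r * cos phi) (r * sin phi).

(** Between m1 and m2 neither factor of the weight is truncated, so [Q] is a primitive there. The
    bounds will be m1 = acos(a / r), or 0 while r < a, and m2 = asin(b / r), or pi / 2 while r <
    b. *)
Let rect_pieces (r m1 m2 : R) : 0 <= m1 -> m1 <= m2 -> m2 <= pi / 2 ->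
  (\int[mu]_(phi in `[0%R, m1]) (f r phi)%:E = 0)%E ->
  (\int[mu]_(phi in `[m2, (pi / 2)%R]) (f r phi)%:E = 0)%E ->
  (forall phi, m1 <= phi -> phi <= m2 -> r * cos phi <= a /\ r * sin phi <= b) ->
  (\int[mu]_(phi in `[0%R, (pi / 2)%R]) (f r phi)%:E = (Q r m2 - Q r m1)%:E)%E.
Proof.
move=> m10 m12 m2p f1 f2 fm.
have mf : measurable_fun setT (f r).
  by apply: continuous_measurable_fun; exact: continuous_rect_weight.
have f0 phi : 0 <= f r phi by exact: rect_weight_ge0.
rewrite (ge0_integral_itv_split m10 (le_trans m12 m2p))// (ge0_integral_itv_split m12 m2p)//.
rewrite f1 f2 add0e adde0 -(integral_is_derive m12 (is_derive_Q r)); last first.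
  move=> x; apply: cvgM; first exact: cvg_cst.
  apply: cvgM; (apply: cvgB; first exact: cvg_cst); (apply: cvgM; first exact: cvg_cst).
    exact: continuous_cos.
  exact: continuous_sin.
apply: eq_integral => phi; rewrite inE/= in_itv/= => /andP[p1 p2].
have [h1 h2] := fm phi p1 p2.
by rewrite /f /rect_weight !(max_idPr _) ?subr_ge0.
Qed.

Let int0 r (m : R) : (\int[mu]_(phi in `[m, m]) (f r phi)%:E = 0)%E.
Proof. by rewrite set_itv1 integral_set1. Qed.

Let pi0 := pi_gt0 R.

Let cos_le (x y : R) : 0 <= x -> x <= y -> y <= pi -> cos y <= cos x.
Proof.
move=> x0 xy yp; have p := pi0.
by rewrite leNgt ltr_cos ?in_itv/= -?leNgt//; apply/andP; split; lra.
Qed.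

Let sinE (x : R) : sin x = cos (pi / 2 - x).
Proof. by rewrite cosB cos_pihalf sin_pihalf mul0r add0r mul1r. Qed.

Let sin_le (x y : R) : - (pi / 2) <= x -> x <= y -> y <= pi / 2 -> sin x <= sin y.
Proof.
move=> x0 xy yp; have p := pi0; rewrite !sinE.
by apply: cos_le; lra.
Qed.

Section large_radius.
Variables (r : R).
Hypothesis ar : a <= r.
Let r0 : 0 < r. Proof. exact: lt_le_trans ar. Qed.
Let ar1 : -1 <= a / r <= 1.
Proof. by rewrite (le_trans _ (divr_ge0 (ltW a0) (ltW r0)))//= ler_pdivrMr// mul1r. Qed.

Let m1 := acos (a / r).

Let m10 : 0 <= m1. Proof. exact: acos_ge0. Qed.
Let m1p : m1 <= pi / 2.
Proof.
rewrite /m1 acosE// gerBl.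
have h : 0 <= a / r by rewrite divr_ge0// ltW.
rewrite leNgt; apply/negP => h1.
have := asinK (_ : a / r \in `[-1, 1]); rewrite in_itv/= => /(_ ar1) E.
have : sin (asin (a / r)) < 0.
  by rewrite -oppr_gt0 -sinN sin_gt0_pi//; have := asin_geNpi2 ar1 => ?; apply/andP; split; lra.
by rewrite E ltNge h.
Qed.
Let cosm1 : cos m1 = a / r. Proof. by rewrite acosK. Qed.
Let sinm1 : sin m1 = Num.sqrt (r ^+ 2 - a ^+ 2) / r.
Proof.
rewrite sin_acos// (_ : r ^+ 2 - a ^+ 2 = r ^+ 2 * (1 - (a / r) ^+ 2)); last first.
  by field; rewrite gt_eqF.
by rewrite sqrtrM ?sqr_ge0// sqrtr_sqr gtr0_norm// mulrAC divff ?mul1r// gt_eqF.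
Qed.

Let low : (\int[mu]_(phi in `[0%R, m1]) (f r phi)%:E = 0)%E.
Proof.
apply: integral0_eq => phi /=; rewrite in_itv/= => /andP[p0 p1].
rewrite /f /rect_weight (max_idPl _) ?mul0r ?mulr0// subr_le0.
rewrite -ler_pdivrMl// mulrC -cosm1; apply: cos_le => //.
by have p := pi0; apply: (le_trans m1p); lra.
Qed.

Let lowQ phi : m1 <= phi -> phi <= pi / 2 -> r * cos phi <= a.
Proof.
move=> h1 h2; rewrite -ler_pdivlMl// mulrC -cosm1; apply: cos_le => //.
by have p := pi0; lra.
Qed.

Let Qm1 : Q r m1 = 4 * (a * b * (pi / 2 - asin (a / r)) - b * Num.sqrt (r ^+ 2 - a ^+ 2)
  + a ^+ 2 + (r ^+ 2 - a ^+ 2) / 2).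
Proof.
rewrite /Q sinm1 cosm1 /m1 acosE// expr_div_n sqr_sqrtr; last first.
  by rewrite subr_ge0 ler_pXn2r ?nnegrE ?(ltW a0) ?(ltW r0).
field; by rewrite gt_eqF.
Qed.

Lemma rect_mid : r < b -> (\int[mu]_(phi in `[0%R, (pi / 2)%R]) (f r phi)%:E = (2 * JsR a b r)%:E)%E.
Proof.
move=> rb; rewrite (rect_pieces m10 m1p (lexx _))//.
  congr (_%:E); rewrite Qm1 /Q sin_pihalf cos_pihalf /JsR ltNge ar/= rb /L2s.
  by field.
move=> phi h1 h2; split; first exact: lowQ.
by rewrite (le_trans _ (ltW rb))// -[leRHS]mulr1 ler_pM2l// sin_le1.
Qed.

Section larger_radius.
Hypothesis br : b <= r.
Let br1 : -1 <= b / r <= 1.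
Proof. by rewrite (le_trans _ (divr_ge0 (ltW b0) (ltW r0)))//= ler_pdivrMr// mul1r. Qed.

Let m2 := asin (b / r).
Let sinm2 : sin m2 = b / r. Proof. by rewrite asinK. Qed.
Let cosm2 : cos m2 = Num.sqrt (r ^+ 2 - b ^+ 2) / r.
Proof.
rewrite cos_asin// (_ : r ^+ 2 - b ^+ 2 = r ^+ 2 * (1 - (b / r) ^+ 2)); last first.
  by field; rewrite gt_eqF.
by rewrite sqrtrM ?sqr_ge0// sqrtr_sqr gtr0_norm// mulrAC divff ?mul1r// gt_eqF.
Qed.

Let high : (\int[mu]_(phi in `[m2, (pi / 2)%R]) (f r phi)%:E = 0)%E.
Proof.
apply: integral0_eq => phi /=; rewrite in_itv/= => /andP[p0 p1].
rewrite /f /rect_weight [X in _ * (_ * X)](max_idPl _) ?mulr0// subr_le0.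
rewrite -ler_pdivrMl// mulrC -sinm2; apply: sin_le => //.
exact: asin_geNpi2.
Qed.

(** The condition r <= c is what orders the bounds: sin m1 <= sin m2 means sqrt(r^2 - a^2) <= b. *)
Lemma rect_high : r <= c -> (\int[mu]_(phi in `[0%R, (pi / 2)%R]) (f r phi)%:E = (2 * JsR a b r)%:E)%E.
Proof.
move=> rc; have p := pi0; have m12 : m1 <= m2.
  rewrite leNgt; apply/negP => m21.
  have : sin m1 <= sin m2.
    rewrite sinm1 sinm2 ler_pM2r ?invr_gt0//.
    rewrite -[leRHS](ger0_norm (ltW b0)) -sqrtr_sqr ler_wsqrtr// lerBlDl -c2.
    by rewrite ler_pXn2r ?nnegrE ?(ltW c0) ?(ltW r0).
  rewrite !sinE leNgt ltr_cos ?in_itv/=; first by rewrite ltrD2l ltrN2 m21.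
    by have h1 := m10; have h2 := m1p; apply/andP; split; lra.
  have := asin_geNpi2 br1; have := asin_lepi2 br1; rewrite -/m2 => ? ?.
  by apply/andP; split; lra.
have m2p : m2 <= pi / 2 by exact: asin_lepi2.
rewrite (rect_pieces m10 m12 m2p)//.
  congr (_%:E); rewrite Qm1 /Q sinm2 cosm2 /JsR ltNge ar/= ltNge br/= c2 /L2s /AR -/m2.
  by field; rewrite gt_eqF.
move=> phi h1 h2; split; first by apply: lowQ => //; exact: le_trans m2p.
rewrite -ler_pdivlMl// mulrC -sinm2; apply: sin_le => //.
by have := m10; lra.
Qed.

End larger_radius.

End large_radius.

Lemma integral_rect_weight_value r : 0 < r ->
  (\int[mu]_(phi in `[0%R, (pi / 2)%R]) (rect_weight a b (r * cos phi) (r * sin phi))%:E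
   = (rect_value r)%:E)%E.
Proof.
move=> r0; have pp := pi0; rewrite /rect_value.
have [ac bc] := legs_le_hypot a0 ab.
have [ra|ar] := ltP r a.
  have rb := lt_le_trans ra ab.
  rewrite (le_trans (ltW rb) bc) (rect_pieces (lexx 0) _ (lexx _))//; last 2 first.
  - by rewrite divr_ge0// ltW.
  - move=> phi _ _; split.
      by rewrite (le_trans _ (ltW ra))// -[leRHS]mulr1 ler_pM2l// cos_le1.
    by rewrite (le_trans _ (ltW rb))// -[leRHS]mulr1 ler_pM2l// sin_le1.
  congr (_%:E); rewrite /Q sin_pihalf cos_pihalf sin0 cos0 /JsR ra /AR /uR.
  by field.
have [rb|br] := ltP r b; first by rewrite (le_trans (ltW rb) bc); exact: rect_mid.
have [rc|cr] := leP r c; first exact: rect_high.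
(* Beyond the diagonal one of the two factors always vanishes: r cos phi < a and r sin phi < b would
   give r < c. *)
apply: integral0_eq => phi /=; rewrite in_itv/= => /andP[p0 p1]; rewrite /rect_weight.
have [h|h] := leP a (r * cos phi).
  by rewrite (max_idPl _) ?mul0r ?mulr0// subr_le0.
rewrite [X in _ * (_ * X)](max_idPl _) ?mulr0// subr_le0.
rewrite leNgt; apply/negP => h'.
have cp : 0 <= r * cos phi.
  by rewrite mulr_ge0 ?(ltW r0)// cos_ge0_pihalf//; apply/andP; split; lra.
have sp : 0 <= r * sin phi.
  by rewrite mulr_ge0 ?(ltW r0)// sin_ge0_pi//; apply/andP; split; lra.
have rE : r ^+ 2 = (r * cos phi) ^+ 2 + (r * sin phi) ^+ 2.
  by rewrite !exprMn -mulrDr cos2Dsin2 mulr1.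
have : r ^+ 2 < c ^+ 2.
  by rewrite rE c2 ltrD// ltr_pXn2r ?nnegrE ?(ltW a0) ?(ltW b0).
by rewrite ltr_pXn2r ?nnegrE ?(ltW r0) ?(ltW c0)// ltNge (ltW cr).
Qed.

End rectangle_weight_value.

(** * Distribution functions *)

Section primitives.
Context {R : realType}.
Local Notation mu := (@lebesgue_measure R).
Implicit Types (x t : R).

(** Unlike [integral_is_derive], this asks for derivatives only inside the interval: its left end
    may be t = x, where [rootd x] and [angle x] have infinite slope. *)
Lemma integral_derive_itv (F f : R -> R) (s e : R) : s <= e ->
  (forall t, s < t -> t < e -> is_derive t 1 F (f t)) ->
  (forall t, s <= t -> t <= e -> {for t, continuous F}) ->
  (forall t, s <= t -> t <= e -> {for t, continuous f}) ->
  (\int[mu]_(t in `[s, e]) (f t)%:E = (F e - F s)%:E)%E.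
Proof.
move=> se dF cF cf; move: (se); rewrite le_eqVlt => /predU1P[<-|se'].
  by rewrite set_itv1 integral_set1 subrr.
rewrite (@continuous_FTC2 _ f F)//.
- apply: continuous_in_subspaceT => t; rewrite inE/= in_itv/= => /andP[? ?].
  exact: cf.
- split.
  + by move=> t; rewrite in_itv/= => /andP[st te]; have [] := dF t st te.
  + by apply: cvg_at_right_filter; exact: cF.
  + by apply: cvg_at_left_filter; exact: cF.
- move=> t; rewrite in_itv/= => /andP[st te]; rewrite derive1E.
  by have [_ ->] := dF t st te.
Qed.

Definition rootd x t : R := Num.sqrt (t ^+ 2 - x ^+ 2).
(* This form of [asin (x / t)] is continuous up to [t = x], where [asin] is not
   differentiable. *)
Definition angle x t : R := pi / 2 - 2 * atan (Num.sqrt ((t - x) / (t + x))).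

(** Half-angle formula: if tan th = sqrt((t - x) / (t + x)), then cos(2 th) = (1 - tan^2 th) / (1 +
    tan^2 th) = x / t, so pi / 2 - 2 th has sine x / t. *)
Lemma angleE x t : 0 < x -> x <= t -> asin (x / t) = angle x t.
Proof.
move=> x0 xt; have t0 : 0 < t by exact: lt_le_trans xt.
have tx0 : 0 < t + x by rewrite addr_gt0.
set th := atan (Num.sqrt ((t - x) / (t + x))).
have th0 : 0 <= th by rewrite -(@atan0 R) le_atan// sqrtr_ge0.
have thp : th < pi / 2 by exact: atan_ltpi2.
have E : sin (angle x t) = x / t.
  rewrite /angle -/th sinB cos_pihalf sin_pihalf mul0r subr0 mul1r.
  rewrite mulr_natl cos_mulr2n /th cos_atan exprVn sqr_sqrtr; last first.
    by rewrite addr_ge0// sqr_ge0.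
  rewrite sqr_sqrtr; last by rewrite divr_ge0 ?subr_ge0// ltW.
  field.
  by apply/and3P; split; rewrite gt_eqF//; lra.
rewrite -E sinK// in_itv/= /angle -/th.
by apply/andP; split; lra.
Qed.

Lemma continuous_rootd x t : {for t, continuous (rootd x)}.
Proof.
apply: (continuous_comp (f := fun t : R => t ^+ 2 - x ^+ 2)); last exact: sqrt_continuous.
by apply: cvgB; [exact: exprn_continuous|exact: cvg_cst].
Qed.

Lemma continuous_angle x t : 0 < x -> 0 < t -> {for t, continuous (angle x)}.
Proof.
move=> x0 t0; apply: cvgB; first exact: cvg_cst.
apply: cvgM; first exact: cvg_cst.
apply: (continuous_comp (f := fun t : R => Num.sqrt ((t - x) / (t + x)))); last exact: continuous_atan.
apply: (continuous_comp (f := fun t : R => (t - x) / (t + x))); last exact: sqrt_continuous.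
apply: cvgM; first by apply: cvgB; [exact: cvg_id|exact: cvg_cst].
apply: cvgV; first by rewrite gt_eqF// addr_gt0.
by apply: cvgD; [exact: cvg_id|exact: cvg_cst].
Qed.

Lemma is_derive_rootd x t : 0 < x -> x < t -> is_derive t 1 (rootd x) (t / rootd x t).
Proof.
move=> x0 xt; have q0 : 0 < t ^+ 2 - x ^+ 2.
  by rewrite subr_gt0 ltr_pXn2r ?nnegrE ?(ltW x0)//; lra.
have d1 : is_derive t 1 (fun t : R => t ^+ 2 - x ^+ 2) (2 * t).
  by apply: is_derive_eq; rewrite /GRing.scale/=; ring.
have d2 := is_derive1_sqrt q0.
have d3 := @is_derive1_comp _ Num.sqrt (fun t : R => t ^+ 2 - x ^+ 2) t _ _ d2 d1.
apply: (is_derive_eq d3); rewrite /rootd; field.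
by rewrite gt_eqF ?sqrtr_gt0.
Qed.

Lemma is_derive_angle x t : 0 < x -> x < t ->
  is_derive t 1 (angle x) (- (x / (t * rootd x t))).
Proof.
move=> x0 xt.
have tx : 0 < t - x by rewrite subr_gt0.
have tx' : 0 < t + x by rewrite addr_gt0//; exact: lt_trans xt.
have q0 : 0 < (t - x) / (t + x) by rewrite divr_gt0.
have d1 : is_derive t 1 (fun t : R => (t - x) / (t + x)) (2 * x / (t + x) ^+ 2).
  have dV := @is_deriveV _ (fun t : R => t + x) t 1 1 (lt0r_neq0 tx') _.
  have d1 : is_derive t 1 (fun t : R => t + x) 1.
    by apply: is_derive_eq; rewrite addr0.
  have d2 : is_derive t 1 (fun t : R => t - x) 1.
    by apply: is_derive_eq; rewrite subr0.
  have d3 := is_deriveM d2 (dV d1).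
  apply: (is_derive_eq d3).
  rewrite /GRing.scale/=; field; by rewrite gt_eqF.
have d2 := is_derive1_sqrt q0.
set u := Num.sqrt ((t - x) / (t + x)).
have d3 : is_derive u 1 (@atan R) (1 + u ^+ 2)^-1.
  by apply: DeriveDef; [exact: derivable_atan|rewrite -derive1E derive1_atan].
have d4 := @is_derive1_comp _ Num.sqrt (fun t : R => (t - x) / (t + x)) t _ _ d2 d1.
have d5 := @is_derive1_comp _ (@atan R) (fun t : R => Num.sqrt ((t - x) / (t + x))) t _ _ d3 d4.
have u0 : 0 < u by rewrite sqrtr_gt0.
have uE : u ^+ 2 = (t - x) / (t + x) by rewrite sqr_sqrtr// ltW.
(* Writing the root through u leaves a rational identity for [field]. *)
have rE : rootd x t = (t + x) * u.
  rewrite /rootd (_ : t ^+ 2 - x ^+ 2 = (t + x) ^+ 2 * ((t - x) / (t + x))); last first.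
    by field; rewrite gt_eqF.
  by rewrite sqrtrM ?sqr_ge0// sqrtr_sqr gtr0_norm.
have d6 : is_derive t 1 (fun t : R => atan (Num.sqrt ((t - x) / (t + x))))
    (x / (2 * t * rootd x t)).
  apply: (is_derive_eq d5); rewrite uE rE -/u; field.
  by apply/and4P; split; rewrite gt_eqF//; lra.
by rewrite /angle; apply: is_derive_eq; rewrite /GRing.scale/=; field;
  rewrite !gt_eqF ?rE ?mulr_gt0//; lra.
Qed.

End primitives.

Section L_primitives.
Context {R : realType}.
Local Notation mu := (@lebesgue_measure R).
Implicit Types (x t : R).

(** The four L-functions with [angle] in place of asin and a cube of the root in place of the power
    3 / 2; they are continuous for all t > 0 and agree with the originals for t >= x ([LcE]). *)
Definition L1sc x t : R := 1 / 2 * (x * rootd x t + t ^+ 2 * angle x t).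
Definition L2sc x t : R := rootd x t + x * angle x t.
Definition L1nc x t : R :=
  1 / 8 * (5 * x / 3 * rootd x t ^+ 3 + x ^+ 3 * rootd x t + t ^+ 4 * angle x t).
Definition L2nc x t : R :=
  1 / 3 * rootd x t ^+ 3 + x / 2 * (x * rootd x t + t ^+ 2 * angle x t).

Lemma powR32 (y : R) : 0 <= y -> y `^ (3 / 2) = Num.sqrt y ^+ 3.
Proof.
move=> y0; rewrite [3 / 2]mulrC powRrM powR12_sqrt//.
by rewrite powR_mulrn// sqrtr_ge0.
Qed.

Let sq_ge0 x t : 0 < x -> x <= t -> 0 <= t ^+ 2 - x ^+ 2.
Proof.
by move=> x0 xt; rewrite subr_ge0 ler_pXn2r ?nnegrE ?(ltW x0)// (le_trans (ltW x0)).
Qed.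

Lemma LcE x t : 0 < x -> x <= t ->
  [/\ L1s t x = L1sc x t, L2s t x = L2sc x t, L1n t x = L1nc x t & L2n t x = L2nc x t].
Proof.
move=> x0 xt; have q0 := sq_ge0 x0 xt.
by rewrite /L1s /L2s /L1n /L2n !angleE// powR32.
Qed.

Let rootd_gt0 x t : 0 < x -> x < t -> 0 < rootd x t.
Proof.
move=> x0 xt; rewrite sqrtr_gt0 subr_gt0 ltr_pXn2r ?nnegrE ?(ltW x0)//; lra.
Qed.

Let rootd2 x t : 0 < x -> x < t -> rootd x t ^+ 2 = t ^+ 2 - x ^+ 2.
Proof. by move=> x0 xt; rewrite sqr_sqrtr// sq_ge0// ltW. Qed.

Lemma is_derive_L1nc x t : 0 < x -> x < t -> is_derive t 1 (L1nc x) (t * L1sc x t).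
Proof.
move=> x0 xt; have t0 := lt_trans x0 xt.
have dr := is_derive_rootd x0 xt; have da := is_derive_angle x0 xt.
have r0 := rootd_gt0 x0 xt; have r2 := rootd2 x0 xt.
rewrite /L1nc; apply: is_derive_eq; rewrite /GRing.scale/= /L1sc.
field: r2.
by rewrite !gt_eqF.
Qed.

Lemma is_derive_L2nc x t : 0 < x -> x < t -> is_derive t 1 (L2nc x) (t * L2sc x t).
Proof.
move=> x0 xt; have t0 := lt_trans x0 xt.
have dr := is_derive_rootd x0 xt; have da := is_derive_angle x0 xt.
have r0 := rootd_gt0 x0 xt; have r2 := rootd2 x0 xt.
rewrite /L2nc; apply: is_derive_eq; rewrite /GRing.scale/= /L2sc.
field: r2.
by rewrite !gt_eqF.
Qed.

Let cvgXn n (f : R -> R) t : {for t, continuous f} -> {for t, continuous (fun y : R => f y ^+ n)}.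
Proof.
by move=> cf; apply: (continuous_comp (f := f) (g := fun y : R => y ^+ n)) => //; exact: exprn_continuous.
Qed.

Let cvgZc k (f : R -> R) t : {for t, continuous f} -> {for t, continuous (fun y : R => k * f y)}.
Proof. by move=> cf; apply: cvgM; first exact: cvg_cst. Qed.

Let cvgXM n (f : R -> R) t : {for t, continuous f} -> {for t, continuous (fun y : R => y ^+ n * f y)}.
Proof. by move=> cf; apply: cvgM => //; exact: exprn_continuous. Qed.

Lemma continuous_Lc x t : 0 < x -> 0 < t ->
  [/\ {for t, continuous (L1sc x)}, {for t, continuous (L2sc x)},
      {for t, continuous (L1nc x)} & {for t, continuous (L2nc x)}].
Proof.
move=> x0 t0; have cr := @continuous_rootd R x t; have ca := continuous_angle x0 t0.
have c1 : {for t, continuous (fun t : R => x * rootd x t + t ^+ 2 * angle x t)}.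
  by apply: cvgD; [exact: cvgZc|exact: cvgXM].
split.
- exact: cvgZc.
- by apply: cvgD => //; exact: cvgZc.
- apply: (cvgZc (f := fun t : R => 5 * x / 3 * rootd x t ^+ 3 + x ^+ 3 * rootd x t + t ^+ 4 * angle x t)).
  apply: cvgD; last exact: cvgXM.
  by apply: cvgD; [apply: (cvgZc (f := fun t : R => rootd x t ^+ 3)); exact: cvgXn|exact: cvgZc].
- apply: cvgD; last exact: (@cvgZc (x / 2) _ _ c1).
  by apply: (cvgZc (f := fun t : R => rootd x t ^+ 3)); exact: cvgXn.
Qed.

Lemma integral_poly_piece (p0 p1 p2 e : R) : 0 <= e ->
  (\int[mu]_(t in `[0%R, e]) (t * (p0 + p1 * t + p2 * t ^+ 2))%:E =
   (p0 * e ^+ 2 / 2 + p1 * e ^+ 3 / 3 + p2 * e ^+ 4 / 4)%:E)%E.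
Proof.
move=> e0.
have dF t : is_derive t 1 (fun t : R => p0 * t ^+ 2 / 2 + p1 * t ^+ 3 / 3 + p2 * t ^+ 4 / 4)
    (t * (p0 + p1 * t + p2 * t ^+ 2)).
  by apply: is_derive_eq; rewrite /GRing.scale/=; field.
rewrite (integral_is_derive e0 dF).
  by congr (_%:E); rewrite !expr0n/= !mulr0 !mul0r !addr0 subr0.
move=> t; apply: cvgM; first exact: cvg_id.
apply: cvgD; last by apply: (cvgZc (f := fun t : R => t ^+ 2)); exact: exprn_continuous.
by apply: cvgD; [exact: cvg_cst|apply: (cvgZc (f := id)); exact: cvg_id].
Qed.

(** A common shape for all pieces involving L-functions; a piece with a single radius takes y = x
    and zero coefficients. The constant p0 also absorbs the matching constants of J*, whose
    integrals against t are the terms in (t^2 - s^2) / 2 of [K2], [K3] and [K4]. *)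
Lemma integral_L_piece (x y p0 p1 p2 q1 q2 q1' q2' s e : R) :
  0 < x -> x <= s -> 0 < y -> y <= s -> s <= e ->
  let F t := p0 * t ^+ 2 / 2 + p1 * t ^+ 3 / 3 + p2 * t ^+ 4 / 4
    + q1 * L1n t x + q2 * L2n t x + q1' * L1n t y + q2' * L2n t y in
  (\int[mu]_(t in `[s, e]) (t * (p0 + p1 * t + p2 * t ^+ 2
     + q1 * L1s t x + q2 * L2s t x + q1' * L1s t y + q2' * L2s t y))%:E =
   (F e - F s)%:E)%E.
Proof.
move=> x0 xs y0 ys se F.
pose Fc t := p0 * t ^+ 2 / 2 + p1 * t ^+ 3 / 3 + p2 * t ^+ 4 / 4
    + q1 * L1nc x t + q2 * L2nc x t + q1' * L1nc y t + q2' * L2nc y t.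
pose fc t := t * (p0 + p1 * t + p2 * t ^+ 2
     + q1 * L1sc x t + q2 * L2sc x t + q1' * L1sc y t + q2' * L2sc y t).
have FE t : s <= t -> F t = Fc t.
  move=> st; rewrite /F /Fc; have [_ _ -> ->] := LcE x0 (le_trans xs st).
  by have [_ _ -> ->] := LcE y0 (le_trans ys st).
have dF t : s < t -> t < e -> is_derive t 1 Fc (fc t).
  move=> st te.
  have d1 := is_derive_L1nc x0 (le_lt_trans xs st).
  have d2 := is_derive_L2nc x0 (le_lt_trans xs st).
  have d3 := is_derive_L1nc y0 (le_lt_trans ys st).
  have d4 := is_derive_L2nc y0 (le_lt_trans ys st).
  rewrite /Fc /fc; apply: is_derive_eq; rewrite /GRing.scale/=.
  by field.
have cF t : s <= t -> t <= e -> {for t, continuous Fc}.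
  move=> st te; have t0 := lt_le_trans (lt_le_trans x0 xs) st.
  have [_ _ c1 c2] := continuous_Lc x0 t0; have [_ _ c3 c4] := continuous_Lc y0 t0.
  rewrite /Fc.
  have cp (k l : R) n : {for t, continuous (fun t : R => k * t ^+ n / l)}.
    apply: cvgM; last exact: cvg_cst.
    by apply: (cvgZc (f := fun t : R => t ^+ n)); exact: exprn_continuous.
  by do ![apply: cvgD]; (try exact: cp); exact: cvgZc.
have cf t : s <= t -> t <= e -> {for t, continuous fc}.
  move=> st te; have t0 := lt_le_trans (lt_le_trans x0 xs) st.
  have [c1 c2 _ _] := continuous_Lc x0 t0; have [c3 c4 _ _] := continuous_Lc y0 t0.
  apply: cvgM; first exact: cvg_id.
  do 4 (apply: cvgD; last exact: cvgZc).
  apply: cvgD; last by apply: (cvgZc (f := fun t : R => t ^+ 2)); exact: exprn_continuous.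
  by apply: cvgD; [exact: cvg_cst|apply: (cvgZc (f := id)); exact: cvg_id].
rewrite !FE// -(integral_derive_itv se dF cF cf).
apply: eq_integral => t; rewrite inE/= in_itv/= => /andP[st _].
rewrite /fc; have [-> -> _ _] := LcE x0 (le_trans xs st).
by have [-> -> _ _] := LcE y0 (le_trans ys st).
Qed.

End L_primitives.

(** * Positivity and measurability of the densities *)

Section densities.
Context {R : realType}.
Local Notation mu := (@lebesgue_measure R).
Variables (a b : R).
Hypotheses (a0 : 0 < a) (ab : a <= b).
Let b0 : 0 < b. Proof. exact: lt_le_trans ab. Qed.
Local Notation c := (hypot a b).

Lemma gRE t : gR a b t = ((a * b) ^+ 2)^-1 * (if 0 <= t then t * rect_value a b t else 0).
Proof.
rewrite /gR /rect_value /AR; case: (leP 0 t) => t0 /=; last by rewrite mulr0.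
case: ifP => _; last by rewrite !mulr0.
by field; rewrite !gt_eqF.
Qed.

Lemma gTE t : gT a b t = ((a * b / 2) ^+ 2)^-1 * (if 0 <= t then t * tri_value a b t else 0).
Proof.
rewrite /gT /tri_value /AT; case: (leP 0 t) => t0 /=; last by rewrite mulr0.
case: ifP => _; last by rewrite !mulr0.
by field; rewrite !gt_eqF.
Qed.

(** The source of 2 g_R - g >= 0. With p and q the positive parts of a b - b x and a b - a y, the
    rectangle has weight 4 p q / (a b), and the base of each square in [tri_weight] is at most p and
    at most q. *)
Lemma rect_weight_tri_weight (x y : R) : 0 <= x -> 0 <= y ->
  2 * tri_weight a b x y <= rect_weight a b x y.
Proof.
move=> x0 y0; rewrite /tri_weight /rect_weight.
have ab0 : 0 < a * b by exact: mulr_gt0.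
have bx : 0 <= b * x by rewrite mulr_ge0// ltW.
have ay : 0 <= a * y by rewrite mulr_ge0// ltW.
set p := Num.max 0 (a * b - b * x); set q := Num.max 0 (a * b - a * y).
have -> : 4 * (Num.max 0 (a - x) * Num.max 0 (b - y)) = 4 * (p * q) / (a * b).
  have -> : p = b * Num.max 0 (a - x).
    by rewrite maxr_pMr ?(ltW b0)// mulr0 mulrBr (mulrC b).
  have -> : q = a * Num.max 0 (b - y).
    by rewrite maxr_pMr ?(ltW a0)// mulr0 mulrBr.
  by field; rewrite !gt_eqF.
rewrite [leLHS]mulrA ler_pM2r ?invr_gt0//.
have p0 : 0 <= p by rewrite le_max lexx.
have q0 : 0 <= q by rewrite le_max lexx.
have sq (z : R) : 0 <= z -> z <= p -> z <= q -> z ^+ 2 <= p * q.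
  by move=> z0 zp zq; rewrite expr2 ler_pM.
have m0 (z : R) : 0 <= Num.max 0 z by rewrite le_max lexx.
have mm (z w : R) : z <= w -> Num.max 0 z <= Num.max 0 w.
  by move=> zw; rewrite ge_max !le_max lexx zw orbT.
have h1 : Num.max 0 (a * b - b * x - a * y) ^+ 2 <= p * q.
  by apply: sq; [exact: m0|apply: mm; lra|apply: mm; lra].
have h2 : Num.max 0 (a * b - Num.max (b * x) (a * y)) ^+ 2 <= p * q.
  by apply: sq; [exact: m0|apply: mm|apply: mm]; rewrite lerD2l lerN2 le_max lexx ?orbT.
lra.
Qed.

Lemma tri_value_ge0 t : 0 < t -> 0 <= tri_value a b t.
Proof.
move=> t0; rewrite -lee_fin -integral_tri_weight_value//.
by apply: integral_ge0 => phi _; rewrite lee_fin tri_weight_ge0.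
Qed.

Lemma rect_value_tri_value t : 0 < t -> 2 * tri_value a b t <= rect_value a b t.
Proof.
move=> t0; rewrite -lee_fin EFinM -integral_tri_weight_value// -integral_rect_weight_value//.
have mt : measurable_fun setT (fun phi : R => tri_weight a b (t * cos phi) (t * sin phi)).
  by apply: continuous_measurable_fun; exact: continuous_tri_weight.
have mr : measurable_fun setT (fun phi : R => rect_weight a b (t * cos phi) (t * sin phi)).
  by apply: continuous_measurable_fun; exact: continuous_rect_weight.
rewrite -ge0_integralZl//; last 2 first.
- by apply: measurable_funTS; exact/measurable_EFinP.
- by move=> phi _; rewrite lee_fin tri_weight_ge0.
apply: ge0_le_integral => //.
- by move=> phi _; rewrite mule_ge0// lee_fin tri_weight_ge0.
- apply: measurable_funTS; apply: emeasurable_funM => //; exact/measurable_EFinP.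
- by apply: measurable_funTS; exact/measurable_EFinP.
move=> phi /=; rewrite in_itv/= => /andP[p0 p1].
rewrite -EFinM lee_fin rect_weight_tri_weight ?mulr_ge0 ?(ltW t0)//.
  by rewrite cos_ge0_pihalf//; apply/andP; split; lra.
by rewrite sin_ge0_pi//; apply/andP; split; lra.
Qed.

Lemma gT_ge0 t : 0 <= gT a b t.
Proof.
rewrite gTE mulr_ge0 ?invr_ge0 ?sqr_ge0//; case: ifPn => //.
rewrite le_eqVlt => /predU1P[<-|t0]; first by rewrite mul0r.
by rewrite mulr_ge0 ?(ltW t0)// tri_value_ge0.
Qed.

Lemma gT_le_gR t : gT a b t <= 2 * gR a b t.
Proof.
rewrite gTE gRE; case: ifPn => [|_]; last by rewrite !mulr0.
rewrite le_eqVlt => /predU1P[<-|t0]; first by rewrite !mul0r !mulr0.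
have -> : ((a * b / 2) ^+ 2)^-1 * (t * tri_value a b t) =
  2 * (((a * b) ^+ 2)^-1 * (t * (2 * tri_value a b t))).
  by field; rewrite !gt_eqF.
by rewrite ler_pM2l// ler_wpM2l ?invr_ge0 ?sqr_ge0// ler_pM2l// rect_value_tri_value.
Qed.

Lemma gR_ge0 t : 0 <= gR a b t.
Proof. by rewrite -(pmulr_rge0 _ (_ : 0 < 2))// (le_trans (gT_ge0 t))// gT_le_gR. Qed.

(** For t > 0, [V t] is a partial integral of a measurable function of (t, phi), hence measurable in
    t by Tonelli; for t <= 0 the function is 0. *)
Let measurable_radial (D : R -> R -> R) (V : R -> R) (k : R) :
  measurable_fun setT (fun z : R * R => D z.1 z.2) -> (forall x y, 0 <= D x y) ->
  (forall t : R, 0 < t -> (\int[mu]_(phi in `[0%R, (pi / 2)%R]) (D (t * cos phi) (t * sin phi))%:E = (V t)%:E)%E) ->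
  measurable_fun setT (fun t : R => k * (if 0 <= t then t * V t else 0)).
Proof.
move=> mD D0 DV; apply: measurable_funM => //.
pose F (z : R * R) : \bar R := (D (z.1 * cos z.2) (z.1 * sin z.2) * \1_`[0, pi / 2] z.2)%:E.
have mF : measurable_fun setT F.
  apply/measurable_EFinP; apply: measurable_funM.
    have mc : measurable_fun setT (fun z : R * R => cos z.2).
      by apply: (measurableT_comp (continuous_measurable_fun (@continuous_cos R))).
    have ms : measurable_fun setT (fun z : R * R => sin z.2).
      by apply: (measurableT_comp (continuous_measurable_fun (@continuous_sin R))).
    have mp : measurable_fun setT (fun z : R * R => (z.1 * cos z.2, z.1 * sin z.2)).
      by apply/measurable_fun_pair; exact: measurable_funM.
    exact: (measurableT_comp mD mp).
  have mi : measurable_fun setT (\1_`[0, pi / 2] : R -> R) by exact: measurable_indic.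
  exact: (measurableT_comp mi).
have F0 z : (0 <= F z)%E by rewrite lee_fin mulr_ge0.
have mI := @measurable_fun_fubini_tonelli_F _ _ (measurableTypeR R) (measurableTypeR R) R mu F mF F0.
have mW : measurable_fun setT (fun t : R => Num.max 0 t * fine (\int[mu]_phi F (t, phi))%E).
  apply: measurable_funM; first exact: (measurable_maxr (f := cst 0)).
  by apply: measurableT_comp; [exact: fine_measurable|exact: mI].
apply: eq_measurable_fun mW => t _ /=.
have [t0|t0] := leP 0 t; last by rewrite mul0r.
move: t0; rewrite le_eqVlt => /predU1P[<-|t0]; first by rewrite !mul0r.
congr (_ * _); rewrite -[RHS]/(fine (V t)%:E) -DV// [in RHS]integral_mkcond; congr fine.
apply: eq_integral => phi _; rewrite /F/= patchE indicE.
by case: (_ \in _); rewrite ?mulr1 ?mulr0.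
Qed.

Lemma measurable_gR : measurable_fun setT (gR a b).
Proof.
rewrite (_ : gR a b = fun t => ((a * b) ^+ 2)^-1 * (if 0 <= t then t * rect_value a b t else 0)).
  by apply: (@measurable_radial (rect_weight a b) (rect_value a b) _ (measurable_rect_weight a b)) => [x y|t t0];
    [exact: rect_weight_ge0|exact: integral_rect_weight_value].
by apply/funext => t; exact: gRE.
Qed.

Lemma measurable_gT : measurable_fun setT (gT a b).
Proof.
rewrite (_ : gT a b = fun t => ((a * b / 2) ^+ 2)^-1 * (if 0 <= t then t * tri_value a b t else 0)).
  by apply: (@measurable_radial (tri_weight a b) (tri_value a b) _ (measurable_tri_weight a b)) => [x y|t t0];
    [exact: tri_weight_ge0|exact: integral_tri_weight_value].
by apply/funext => t; exact: gTE.
Qed.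

End densities.

Section distribution_functions.
Context {R : realType}.
Local Notation mu := (@lebesgue_measure R).
Variables (a b : R).
Hypotheses (a0 : 0 < a) (ab : a <= b).
Let b0 : 0 < b. Proof. exact: lt_le_trans ab. Qed.
Local Notation c := (hypot a b).
Local Notation h := (hT a b).
Let ac : a <= c. Proof. by have [] := legs_le_hypot a0 ab. Qed.
Let bc : b <= c. Proof. by have [] := legs_le_hypot a0 ab. Qed.
Let c0 : 0 < c. Proof. exact: hypot_gt0. Qed.

Let h0 : 0 < h. Proof. by rewrite hTE// divr_gt0// mulr_gt0. Qed.

Let ha : h < a.
Proof.
rewrite hTE// ltr_pdivrMr// ltr_pM2l// -(ltr_pXn2r (_ : (0 < 2)%N)) ?nnegrE ?ltW//.
by rewrite hypot_sqr ltrDr exprn_gt0.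
Qed.

Let L2s_diag (x : R) : 0 < x -> L2s x x = x * (pi / 2).
Proof. by move=> x0; rewrite /L2s subrr sqrtr0 add0r divff ?gt_eqF// asin1. Qed.

(** Adjacent formulas agree at a and b, so each is valid on a closed interval and can be integrated
    up to its end. When a = b the middle range is empty and the first formula has to meet the
    third. *)
Let JsR1 t : t <= a -> JsR a b t = pi * AR a b - uR a b * t + t ^+ 2.
Proof.
rewrite le_eqVlt /JsR => /predU1P[->|->//]; rewrite ltxx.
case: ltgtP ab => // [_ _|ba _]; first by rewrite L2s_diag// /uR /AR; field.
by rewrite -ba L2s_diag// hypot_sqr /uR /AR; field.
Qed.

Let JsR2 t : a <= t -> t <= b -> JsR a b t = - a ^+ 2 - 2 * b * t + 2 * b * L2s t a.
Proof.
move=> at_; rewrite le_eqVlt /JsR (ltNge t a) at_/= => /predU1P[->|->//].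
by rewrite ltxx L2s_diag// hypot_sqr /AR; field.
Qed.

Let JsR3 t : b <= t -> JsR a b t =
  - (pi * AR a b + c ^+ 2) - t ^+ 2 + 2 * b * L2s t a + 2 * a * L2s t b.
Proof. by move=> bt; rewrite /JsR !ltNge bt (le_trans ab bt). Qed.

Let gR1 e : 0 <= e -> e <= a ->
  (\int[mu]_(t in `[0%R, e]) (gR a b t)%:E = (2 / AR a b ^+ 2 * J1nR a b 0 e)%:E)%E.
Proof.
move=> e0 ea.
transitivity (\int[mu]_(t in `[0%R, e]) (t * (2 / AR a b ^+ 2 * (pi * AR a b) +
    (- (2 / AR a b ^+ 2) * uR a b) * t + 2 / AR a b ^+ 2 * t ^+ 2))%:E)%E.
  apply: eq_integral => t; rewrite inE/= in_itv/= => /andP[t0 te].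
  have ta : (t : R) <= a by exact: le_trans ea.
  rewrite /gR t0 (le_trans ta ac)/= JsR1//; congr EFin.
  by move: (t : R) => s; field; rewrite mulf_neq0// gt_eqF.
rewrite integral_poly_piece//; congr EFin.
by rewrite /J1nR /H1nR; field; rewrite mulf_neq0// gt_eqF.
Qed.

Let gR2 e : a <= e -> e <= b ->
  (\int[mu]_(t in `[a, e]) (gR a b t)%:E = (2 / AR a b ^+ 2 * J2nR a b a e)%:E)%E.
Proof.
move=> ae eb; set k := 2 / AR a b ^+ 2.
transitivity (\int[mu]_(t in `[a, e]) (t * (k * (- a ^+ 2) +
    (- k * (2 * b)) * t + 0 * t ^+ 2 + 0 * L1s t a + (k * (2 * b)) * L2s t a
    + 0 * L1s t a + 0 * L2s t a))%:E)%E.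
  apply: eq_integral => t; rewrite inE/= in_itv/= => /andP[t0 te].
  have tb : (t : R) <= b by exact: le_trans eb.
  rewrite /gR (le_trans (ltW a0) t0) (le_trans tb bc)/= JsR2//; congr EFin.
  by rewrite /k; move: (t : R) => s; field; rewrite mulf_neq0// gt_eqF.
rewrite integral_L_piece//; congr EFin.
by rewrite /J2nR /H2nR; field.
Qed.

Let gR3 e : b <= e -> e <= c ->
  (\int[mu]_(t in `[b, e]) (gR a b t)%:E = (2 / AR a b ^+ 2 * J3nR a b b e)%:E)%E.
Proof.
move=> be ec; set k := 2 / AR a b ^+ 2.
transitivity (\int[mu]_(t in `[b, e]) (t * (k * (- (pi * AR a b + c ^+ 2)) +
    0 * t + (- k) * t ^+ 2 + 0 * L1s t a + (k * (2 * b)) * L2s t a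
    + 0 * L1s t b + (k * (2 * a)) * L2s t b))%:E)%E.
  apply: eq_integral => t; rewrite inE/= in_itv/= => /andP[t0 te].
  rewrite /gR (le_trans (ltW b0) t0) (le_trans te ec)/= JsR3//; congr EFin.
  by rewrite /k; move: (t : R) => s; field; rewrite mulf_neq0// gt_eqF.
rewrite integral_L_piece//; congr EFin.
by rewrite /J3nR /H3nR; field.
Qed.

Let split_gR s m e (sm : s <= m) (me : m <= e) :=
  ge0_integral_itv_split sm me (measurable_gR a0 ab) (gR_ge0 a0 ab).

Lemma integral_gR t : 0 <= t -> t < c ->
  (\int[mu]_(s in `[0%R, t]) (gR a b s)%:E = (GR a b t)%:E)%E.
Proof.
move=> t0 tc; rewrite /GR ltNge t0/= tc /JnR.
have [ta|at_] := ltP t a; first by rewrite gR1// ltW.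
have [tb|bt] := ltP t b.
  by rewrite (split_gR (ltW a0) at_) (gR1 (ltW a0) (lexx a)) (gR2 at_ (ltW tb)) -EFinD; congr EFin; ring.
rewrite (split_gR (ltW b0) bt) (split_gR (ltW a0) ab) (gR1 (ltW a0) (lexx a)).
rewrite (gR2 ab (lexx b)) (gR3 bt (ltW tc)).
by rewrite -!EFinD; congr EFin; ring.
Qed.

(** The pieces of J* match at h, a and b because J_k*(s, s) = 0. *)
Let Js1 t : t <= h -> Js a b t = J1s a b 0 t.
Proof.
rewrite le_eqVlt /Js => /predU1P[->|->//].
by rewrite ltxx ha /J2s subrr addr0.
Qed.

Let Js2 t : h <= t -> t <= a -> Js a b t = J1s a b 0 h + J2s a b h t.
Proof.
move=> ht; rewrite le_eqVlt /Js (ltNge t h) ht/= => /predU1P[->|->//]; rewrite ltxx.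
case: ltgtP ab => // [_ _|<- _]; first by rewrite /J3s subrr addr0.
by rewrite /J3s /J4s !subrr !addr0.
Qed.

Let Js3 t : a <= t -> t <= b -> Js a b t = J1s a b 0 h + J2s a b h a + J3s a b a t.
Proof.
move=> at_; rewrite le_eqVlt /Js (ltNge t h) (ltNge t a) at_ (le_trans (ltW ha) at_)/= => /predU1P[->|->//].
by rewrite ltxx /J4s subrr addr0.
Qed.

Let Js4 t : b <= t -> Js a b t = J1s a b 0 h + J2s a b h a + J3s a b a b + J4s a b b t.
Proof.
move=> bt; have at_ := le_trans ab bt.
by rewrite /Js !ltNge bt at_ (le_trans (ltW ha) at_).
Qed.

Let AT0 : 0 < AT a b. Proof. by rewrite divr_gt0// mulr_gt0. Qed.

(** The part of G common to the four ranges; its increments telescope in [integral_gT]. *)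
Let M t : R := t ^+ 2 * (pi - 2 * uT a b / (3 * AT a b) * t).

Let gT1 e : 0 <= e -> e <= h ->
  (\int[mu]_(t in `[0%R, e]) (gT a b t)%:E
   = (1 / AT a b * (M e + 2 / AT a b * K1 a b e))%:E)%E.
Proof.
move=> e0 eh; set k := 2 / AT a b ^+ 2.
transitivity (\int[mu]_(t in `[0%R, e]) (t * (2 / AT a b * pi +
    (- k * uT a b) * t + k * (Theta1 a b / 8) * t ^+ 2))%:E)%E.
  apply: eq_integral => t; rewrite inE/= in_itv/= => /andP[t0 te].
  have th : (t : R) <= h by exact: le_trans eh.
  rewrite /gT t0 (le_trans th (le_trans (ltW ha) ac))/= Js1//; congr EFin.
  by rewrite /k /J1s /H1s; move: (t : R) => s; field; rewrite gt_eqF.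
rewrite integral_poly_piece//; congr EFin.
by rewrite /M /K1 /J1n /H1n /k; field; rewrite gt_eqF.
Qed.

Let gT2 e : h <= e -> e <= a ->
  (\int[mu]_(t in `[h, e]) (gT a b t)%:E
   = (1 / AT a b * (M e - M h + 2 / AT a b * K2 a b e))%:E)%E.
Proof.
move=> he ea; set k := 2 / AT a b ^+ 2.
(* On this range J* is H_2* plus this constant; the next two ranges are treated in the same way. *)
pose K := J1s a b 0 h - H2s a b h.
transitivity (\int[mu]_(t in `[h, e]) (t * ((2 / AT a b * pi + k * K) +
    (- k * uT a b) * t + (k * (Theta2 a b / 8)) * t ^+ 2
    + (k * Theta3 a b) * L1s t h + (k * c) * L2s t h
    + 0 * L1s t h + 0 * L2s t h))%:E)%E.
  apply: eq_integral => t; rewrite inE/= in_itv/= => /andP[t0 te].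
  have ta : (t : R) <= a by exact: le_trans ea.
  rewrite /gT (le_trans (ltW h0) t0) (le_trans ta ac)/= Js2//; congr EFin.
  rewrite (_ : J1s a b 0 h + J2s a b h t = K + H2s a b t); last by rewrite /K /J2s; ring.
  by rewrite /k [in LHS]/H2s; move: K (t : R) => {}K s; field; rewrite gt_eqF.
rewrite integral_L_piece//; congr EFin.
rewrite /M /K2 -/K /J2n /H2n /k; move: K => {}K.
by field; rewrite gt_eqF.
Qed.

Let gT3 e : a <= e -> e <= b ->
  (\int[mu]_(t in `[a, e]) (gT a b t)%:E
   = (1 / AT a b * (M e - M a + 2 / AT a b * K3 a b e))%:E)%E.
Proof.
move=> ae eb; set k := 2 / AT a b ^+ 2; have hlea := ltW ha.
pose K := J1s a b 0 h + J2s a b h a - H3s a b a.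
transitivity (\int[mu]_(t in `[a, e]) (t * ((2 / AT a b * pi + k * K) +
    (k * (a - uT a b)) * t + (k * (Theta4 a b / 2)) * t ^+ 2
    + (k * (Theta3 a b / 2)) * L1s t h + (k * (c / 2)) * L2s t h
    + (k * (b / (2 * a))) * L1s t a + (k * (b / 2)) * L2s t a))%:E)%E.
  apply: eq_integral => t; rewrite inE/= in_itv/= => /andP[t0 te].
  have tb : (t : R) <= b by exact: le_trans eb.
  rewrite /gT (le_trans (ltW a0) t0) (le_trans tb bc)/= Js3//; congr EFin.
  rewrite (_ : J1s a b 0 h + J2s a b h a + J3s a b a t = K + H3s a b t); last by rewrite /K /J3s; ring.
  by rewrite /k [in LHS]/H3s; move: K (t : R) => {}K s; field; rewrite !gt_eqF.
rewrite integral_L_piece//; congr EFin.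
rewrite /M /K3 -/K /J3n /H3n /k; move: K => {}K.
by field; rewrite !gt_eqF.
Qed.

Let gT4 e : b <= e -> e <= c ->
  (\int[mu]_(t in `[b, e]) (gT a b t)%:E
   = (1 / AT a b * (M e - M b + 2 / AT a b * K4 a b e))%:E)%E.
Proof.
move=> be ec; set k := 2 / AT a b ^+ 2.
pose K := J1s a b 0 h + J2s a b h a + J3s a b a b - H4s a b b.
transitivity (\int[mu]_(t in `[b, e]) (t * ((2 / AT a b * pi + k * K) +
    (k * (Theta5 a b - uT a b)) * t + (k * (Theta6 a b / 8)) * t ^+ 2
    + (k * (b / (2 * a))) * L1s t a + (k * (b / 2)) * L2s t a
    + (k * (a / (2 * b))) * L1s t b + (k * (a / 2)) * L2s t b))%:E)%E.
  apply: eq_integral => t; rewrite inE/= in_itv/= => /andP[t0 te].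
  rewrite /gT (le_trans (ltW b0) t0) (le_trans te ec)/= Js4//; congr EFin.
  rewrite (_ : J1s a b 0 h + J2s a b h a + J3s a b a b + J4s a b b t = K + H4s a b t); last by rewrite /K /J4s; ring.
  by rewrite /k [in LHS]/H4s; move: K (t : R) => {}K s; field; rewrite !gt_eqF.
rewrite integral_L_piece//; congr EFin.
rewrite /M /K4 -/K /J4n /H4n /k; move: K => {}K.
by field; rewrite !gt_eqF.
Qed.

Let split_gT s m e (sm : s <= m) (me : m <= e) :=
  ge0_integral_itv_split sm me (measurable_gT a0 ab) (gT_ge0 a0 ab).

Lemma integral_gT t : 0 <= t -> t < c ->
  (\int[mu]_(s in `[0%R, t]) (gT a b s)%:E = (GT a b t)%:E)%E.
Proof.
move=> t0 tc; have hlea := ltW ha; have hleb := le_trans hlea ab.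
rewrite /GT ltNge t0/= tc /Jn -/(M t).
have [th|ht] := ltP t h; first by rewrite gT1// ltW.
have [ta|at_] := ltP t a.
  rewrite (split_gT (ltW h0) ht) (gT1 (ltW h0) (lexx h)) (gT2 ht (ltW ta)).
  by rewrite -!EFinD; congr EFin; ring.
have [tb|bt] := ltP t b.
  rewrite (split_gT (ltW a0) at_) (split_gT (ltW h0) hlea) (gT1 (ltW h0) (lexx h)).
  rewrite (gT2 hlea (lexx a)) (gT3 at_ (ltW tb)).
  by rewrite -!EFinD; congr EFin; ring.
rewrite (split_gT (ltW b0) bt) (split_gT (ltW a0) ab) (split_gT (ltW h0) hlea).
rewrite (gT1 (ltW h0) (lexx h)) (gT2 hlea (lexx a)) (gT3 ab (lexx b)) (gT4 bt (ltW tc)).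
by rewrite -!EFinD; congr EFin; ring.
Qed.

End distribution_functions.

(** * From masses to laws of the distance *)

Section canonical_laws.
Context {R : realType}.
Local Notation mu := (@lebesgue_measure R).

Lemma distance_law_pair_mass (S1 S2 : set (R * R)) (f F : R -> R) (c : R) :
  measurable S1 -> measurable S2 ->
  measurable_fun setT f -> (forall t, 0 <= f t) ->
  (forall t, ~~ (0 <= t <= c) -> f t = 0) ->
  (forall B : set R, measurable B ->
    (((fine (lebesgue2 S1))^-1 * (fine (lebesgue2 S2))^-1)%:E * pair_mass S1 S2 B
     = \int[mu]_(t in B) (f t)%:E)%E) ->
  (forall t, t < 0 -> F t = 0) -> (forall t, 0 <= t -> c <= t -> F t = 1) ->
  (forall t, 0 <= t -> t < c -> (\int[mu]_(s in `[0%R, t]) (f s)%:E = (F t)%:E)%E) ->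
  distance_law S1 S2 f F.
Proof.
move=> mS1 mS2 mf f0 fc fE F0 F1 FE d T P X Y uX uY iXY.
have dE (B : set R) : measurable B ->
    distribution P (distance X Y) B = (\int[mu]_(t in B) (f t)%:E)%E.
  by move=> mB; rewrite (distribution_distance uX uY iXY)// fE.
split; first by split.
(* As f vanishes off [0, c], only the trace of the domain on [0, c] matters: []-oo, t]] may be
   replaced by [[0, t]], by the empty set or by the whole line. *)
have eqI (A B : set R) : (forall t : R, 0 <= t -> t <= c -> (t \in A) = (t \in B)) ->
    (\int[mu]_(t in A) (f t)%:E = \int[mu]_(t in B) (f t)%:E)%E.
  move=> AB; rewrite integral_mkcond [RHS]integral_mkcond; apply: eq_integral => t _.
  rewrite !patchE; have [/andP[t0 tc]|/fc ->] := boolP (0 <= (t : R) <= c); first by rewrite AB.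
  by do 2 case: ifP.
move=> t; rewrite /cdf dE//; have [t0|t0] := ltP t 0.
  rewrite F0// (eqI _ set0) ?integral_set0// => s s0 _.
  by rewrite in_set0; apply/negbTE; rewrite notin_setE/= in_itv/=; apply/negP; rewrite -ltNge (lt_le_trans t0).
have [ct|tc] := leP c t.
  rewrite (F1 t t0 ct).
  (* No primitive is evaluated here: the integral of f over the line is 1 because [P] is a
     probability. *)
  transitivity (distribution P (distance X Y) setT); last by rewrite /distribution /pushforward preimage_setT probability_setT.
  by rewrite dE//; apply: eqI => s _ sc; rewrite in_setT; apply/mem_set; rewrite /= in_itv/= (le_trans sc ct).
rewrite -FE//; apply: eqI => s s0 _.
by apply/idP/idP => /set_mem H; apply/mem_set; move: H; rewrite /= !in_itv/= s0.
Qed.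

(** Bounded by |S1| |S2|. This finiteness permits the cancellation in [pair_mass_tri0_tri1]. *)
Lemma pair_mass_lt_pinfty (S1 S2 : set (R * R)) (B : set R) :
  measurable S1 -> measurable S2 -> measurable B ->
  (lebesgue2 S1 < +oo)%E -> (lebesgue2 S2 < +oo)%E -> (pair_mass S1 S2 B < +oo)%E.
Proof.
move=> mS1 mS2 mB l1 l2.
apply: (@le_lt_trans _ _ (lebesgue2 S2 * lebesgue2 S1)%E); last first.
  by rewrite lte_mul_pinfty// ge0_fin_numE.
have mS1' : measurable (S1 : set (measurableTypeR R * measurableTypeR R)) by [].
have mS2' : measurable (S2 : set (measurableTypeR R * measurableTypeR R)) by [].
have -> : (lebesgue2 S2 * lebesgue2 S1 = \int[@planar R]_(p in S1) lebesgue2 S2)%E.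
  by rewrite (integral_cst (@planar R) mS1').
have mp := measurable_pair_mass mS2 mB.
apply: ge0_le_integral; first exact: mS1'.
- by move=> p _; exact: measure_ge0.
- exact: measurable_funTS.
- exact: measurable_cst.
move=> p _.
have mA : measurable (S2 `&` [set q | B (eucl_dist p q)] : set (measurableTypeR R * measurableTypeR R)).
  apply: measurableI => //.
  by rewrite -[X in measurable X]setTI; exact: measurable_eucl_distr.
by apply: (le_measure (@planar R)); [exact/mem_set|exact/mem_set|move=> q []].
Qed.

End canonical_laws.

Section rectangle_triangle_laws.
Context {R : realType}.
Local Notation mu := (@lebesgue_measure R).
Variables (a b : R).
Hypotheses (a0 : 0 < a) (ab : a <= b).
Let b0 : 0 < b. Proof. exact: lt_le_trans ab. Qed.
Local Notation c := (hypot a b).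

Let integral_radial (V g : R -> R) (k : R) (B : set R) : 0 < k ->
  measurable_fun setT g -> (forall t, 0 <= g t) ->
  (forall t, g t = k * (if 0 <= t then t * V t else 0)) -> measurable B ->
  (k%:E * \int[mu]_(t in B) (if (0 <= t)%R then t * V t else 0)%:E
   = \int[mu]_(t in B) (g t)%:E)%E.
Proof.
move=> k0 mg g0 gE mB.
have E (t : R) : (if 0 <= t then t * V t else 0) = k^-1 * g t.
  by rewrite gE mulKf ?gt_eqF.
rewrite -ge0_integralZl//.
- by apply: eq_integral => t _; rewrite -EFinM -gE.
- apply/measurable_EFinP; apply: measurable_funTS.
  by under eq_fun => t do rewrite E; exact: measurable_funM.
- by move=> t _; rewrite lee_fin E mulr_ge0// invr_ge0 ltW.
- by rewrite lee_fin ltW.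
Qed.

Lemma pair_mass_rect0_gR (B : set R) : measurable B ->
  ((((a * b) ^+ 2)^-1)%:E * pair_mass (rect0 a b) (rect0 a b) B
   = \int[mu]_(t in B) (gR a b t)%:E)%E.
Proof.
move=> mB; have k0 : 0 < ((a * b) ^+ 2)^-1 by rewrite invr_gt0 exprn_gt0// mulr_gt0.
rewrite (@pair_mass_polar _ _ _ (rect_weight a b) (rect_value a b))//.
- by apply: integral_radial => //; [exact: measurable_gR|exact: gR_ge0|exact: gRE].
- exact: measurable_rect0.
- exact: measurable_rect0.
- exact: measurable_rect_weight.
- exact: rect_weight_ge0.
- exact: continuous_rect_weight.
- exact: covariogram_rect0_sum.
- exact: integral_rect_weight_value.
Qed.

Lemma pair_mass_tri0_gT (B : set R) : measurable B ->
  ((((a * b / 2) ^+ 2)^-1)%:E * pair_mass (tri0 a b) (tri0 a b) B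
   = \int[mu]_(t in B) (gT a b t)%:E)%E.
Proof.
move=> mB; have k0 : 0 < ((a * b / 2) ^+ 2)^-1 by rewrite invr_gt0 exprn_gt0// divr_gt0// mulr_gt0.
rewrite (@pair_mass_polar _ _ _ (tri_weight a b) (tri_value a b))//.
- by apply: integral_radial => //; [exact: measurable_gT|exact: gT_ge0|exact: gTE].
- exact: measurable_tri0.
- exact: measurable_tri0.
- exact: measurable_tri_weight.
- exact: tri_weight_ge0.
- exact: continuous_tri_weight.
- exact: covariogram_tri0_sum.
- exact: integral_tri_weight_value.
Qed.

(** Stated as a sum, so that it is additivity for nonnegative functions and involves no difference
    of extended reals. *)
Lemma integral_2gR_sub_gT (B : set R) : measurable B ->
  (\int[mu]_(t in B) (2 * gR a b t - gT a b t)%:E + \int[mu]_(t in B) (gT a b t)%:E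
   = 2%:E * \int[mu]_(t in B) (gR a b t)%:E)%E.
Proof.
move=> mB; have mR := measurable_gR a0 ab; have mT := measurable_gT a0 ab.
rewrite -ge0_integralZl//; last 2 first.
- by apply: measurable_funTS; exact/measurable_EFinP.
- by move=> t _; rewrite lee_fin gR_ge0.
rewrite -ge0_integralD//.
- by apply: eq_integral => t _; rewrite -EFinD subrK -EFinM.
- by move=> t _; rewrite lee_fin subr_ge0 gT_le_gR.
- apply: measurable_funTS; apply/measurable_EFinP; apply: measurable_funB => //.
  exact: measurable_funM.
- by move=> t _; rewrite lee_fin gT_ge0.
- by apply: measurable_funTS; exact/measurable_EFinP.
Qed.

Let addeIr (x y z : \bar R) : x \is a fin_num -> (y + x = z + x)%E -> y = z.
Proof. by move=> fx E; rewrite -(addeK y fx) E addeK. Qed.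

Let tri0_fin : (lebesgue2 (tri0 a b) < +oo)%E.
Proof. by rewrite lebesgue2_tri0// ltry. Qed.

(** A triangle has half the area of the rectangle, so its normalization is 4 / (a b)^2, while
    [pair_mass_rect0] counts each kind of pair twice. The claim follows by adding the finite
    integral of g to both sides and cancelling it. *)
Lemma pair_mass_tri0_tri1 (B : set R) : measurable B ->
  ((((a * b / 2) ^+ 2)^-1)%:E * pair_mass (tri0 a b) (tri1 a b) B
   = \int[mu]_(t in B) (2 * gR a b t - gT a b t)%:E)%E.
Proof.
move=> mB; have mT := measurable_tri0 a b; have mT1 := measurable_tri1 a b.
have T_ge0 S : (0 <= pair_mass (tri0 a b) S B)%E.
  by apply: integral_ge0 => p _; exact: measure_ge0.
have T_fin S : measurable S -> (lebesgue2 S < +oo)%E -> pair_mass (tri0 a b) S B \is a fin_num.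
  by move=> mS Sf; rewrite ge0_fin_numE// pair_mass_lt_pinfty.
have f0 := T_fin _ mT tri0_fin.
apply: (@addeIr (\int[mu]_(t in B) (gT a b t)%:E)%E).
  by rewrite -pair_mass_tri0_gT// fin_numM.
rewrite integral_2gR_sub_gT// -pair_mass_tri0_gT// -pair_mass_rect0_gR//.
rewrite pair_mass_rect0//.
have f1 : pair_mass (tri0 a b) (tri1 a b) B \is a fin_num.
  by apply: T_fin => //; rewrite lebesgue2_tri1// ltry.
move: (pair_mass (tri0 a b) (tri0 a b) B) (pair_mass (tri0 a b) (tri1 a b) B) f0 f1.
move=> [x| |] [y| |] // _ _; apply: (congr1 EFin).
by field; rewrite !gt_eqF.
Qed.

Let GR_lt0 t : t < 0 -> GR a b t = 0. Proof. by rewrite /GR => ->. Qed.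
Let GT_lt0 t : t < 0 -> GT a b t = 0. Proof. by rewrite /GT => ->. Qed.
Let GR_ge t : 0 <= t -> c <= t -> GR a b t = 1.
Proof. by move=> t0 ct; rewrite /GR !ltNge t0 ct. Qed.
Let GT_ge t : 0 <= t -> c <= t -> GT a b t = 1.
Proof. by move=> t0 ct; rewrite /GT !ltNge t0 ct. Qed.

Lemma distance_law_rect0 :
  distance_law (rect0 a b) (rect0 a b) (gR a b) (GR a b).
Proof.
apply: (@distance_law_pair_mass _ _ _ _ _ c) => //.
- exact: measurable_rect0.
- exact: measurable_rect0.
- exact: measurable_gR.
- exact: gR_ge0.
- by move=> t /negbTE tc; rewrite /gR tc.
- move=> B mB; rewrite lebesgue2_rect0//= -invfM -expr2; exact: pair_mass_rect0_gR.
- exact: integral_gR.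
Qed.

Lemma distance_law_tri0 :
  distance_law (tri0 a b) (tri0 a b) (gT a b) (GT a b).
Proof.
apply: (@distance_law_pair_mass _ _ _ _ _ c) => //.
- exact: measurable_tri0.
- exact: measurable_tri0.
- exact: measurable_gT.
- exact: gT_ge0.
- by move=> t /negbTE tc; rewrite /gT tc.
- move=> B mB; rewrite lebesgue2_tri0//= -invfM -expr2; exact: pair_mass_tri0_gT.
- exact: integral_gT.
Qed.

Lemma distance_law_tri0_tri1 :
  distance_law (tri0 a b) (tri1 a b)
    (fun t => 2 * gR a b t - gT a b t) (fun t => 2 * GR a b t - GT a b t).
Proof.
apply: (@distance_law_pair_mass _ _ _ _ _ c).
- exact: measurable_tri0.
- exact: measurable_tri1.
- apply: measurable_funB; last exact: measurable_gT.
  by apply: measurable_funM => //; exact: measurable_gR.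
- by move=> t; rewrite subr_ge0 gT_le_gR.
- by move=> t /negbTE tc; rewrite /gR /gT tc mulr0 subr0.
- move=> B mB; rewrite lebesgue2_tri0// lebesgue2_tri1//= -invfM -expr2.
  exact: pair_mass_tri0_tri1.
- by move=> t t0; rewrite GR_lt0// GT_lt0// mulr0 subr0.
- by move=> t t0 ct; rewrite GR_ge// GT_ge// mulr1; ring.
- move=> t t0 tc; apply: (@addeIr (\int[mu]_(s in `[0%R, t]) (gT a b s)%:E)%E).
    by rewrite integral_gT.
  rewrite integral_2gR_sub_gT// integral_gT// integral_gR//.
  by rewrite -EFinD subrK EFinM.
Qed.

End rectangle_triangle_laws.

(** * Reduction to a rectangle with sides on the axes *)

Section rigid_motion.
Context {R : realType}.
Variables (A : R * R) (u1 u2 v1 v2 : R).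
Hypotheses (uu : u1 ^+ 2 + u2 ^+ 2 = 1) (vv : v1 ^+ 2 + v2 ^+ 2 = 1).
Hypothesis uv : u1 * v1 + u2 * v2 = 0.

(** Coordinates of p in the orthonormal frame (u, v) with origin [A], expanded to the affine form
    used by [lebesgue2_affine]. *)
Definition frame_coord (p : R * R) : R * R :=
  (- (u1 * A.1 + u2 * A.2) + u1 * p.1 + u2 * p.2,
   - (v1 * A.1 + v2 * A.2) + v1 * p.1 + v2 * p.2).

(** The determinant of the frame. It is 1 or -1 by Lagrange's identity, since [D] may lie on either
    side of AB, and v is e times the quarter turn of u. *)
Let e := u1 * v2 - u2 * v1.
Let e2 : e ^+ 2 = 1.
Proof.
transitivity ((u1 ^+ 2 + u2 ^+ 2) * (v1 ^+ 2 + v2 ^+ 2) - (u1 * v1 + u2 * v2) ^+ 2).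
  by rewrite /e; ring.
by rewrite uu vv uv; ring.
Qed.
Let v1E : v1 = - e * u2.
Proof.
rewrite -[LHS]mulr1 -uu; transitivity (- e * u2 + u1 * (u1 * v1 + u2 * v2)); first by rewrite /e; ring.
by rewrite uv mulr0 addr0.
Qed.
Let v2E : v2 = e * u1.
Proof.
rewrite -[LHS]mulr1 -uu; transitivity (e * u1 + u2 * (u1 * v1 + u2 * v2)); first by rewrite /e; ring.
by rewrite uv mulr0 addr0.
Qed.

Lemma measurable_frame_coord : measurable_fun setT frame_coord.
Proof. by apply/measurable_fun_pair; exact: measurable_planar. Qed.

Lemma lebesgue2_frame_coord E : measurable E -> lebesgue2 (frame_coord @^-1` E) = lebesgue2 E.
Proof.
move=> mE; have ne : `|e| = 1.
  by apply/eqP; rewrite -sqrp_eq1// real_normK ?num_real// e2.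
have ee : e = u1 * v2 - v1 * u2 by rewrite /e (mulrC v1).
rewrite lebesgue2_affine// -?ee ?ne ?invr1 ?mul1e//.
by rewrite -normr_eq0 ne oner_eq0.
Qed.

Lemma eucl_dist_frame_coord p q : eucl_dist (frame_coord p) (frame_coord q) = eucl_dist p q.
Proof.
rewrite /eucl_dist /frame_coord/=; congr Num.sqrt.
transitivity ((u1 * (p.1 - q.1) + u2 * (p.2 - q.2)) ^+ 2 + (v1 * (p.1 - q.1) + v2 * (p.2 - q.2)) ^+ 2).
  by ring.
transitivity ((u1 ^+ 2 + u2 ^+ 2 * e ^+ 2) * (p.1 - q.1) ^+ 2 + (u2 ^+ 2 + u1 ^+ 2 * e ^+ 2) * (p.2 - q.2) ^+ 2
   + 2 * (1 - e ^+ 2) * u1 * u2 * (p.1 - q.1) * (p.2 - q.2)).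
  by move: (e) v1E v2E => e' -> ->; ring.
by rewrite e2 !mulr1 uu addrC [u2 ^+ 2 + _]addrC uu; ring.
Qed.

(** The vectors u and v are orthonormal, so the transposed pairs (u1, v1) and (u2, v2) are too
    ([h1], [h2], [h12]); this inverts the frame map. *)
Lemma frame_coordP p x y : frame_coord p = (x, y) <->
  p = (A.1 + x * u1 + y * v1, A.2 + x * u2 + y * v2).
Proof.
have h1 : u1 ^+ 2 + v1 ^+ 2 = 1 by rewrite v1E mulNr sqrrN exprMn e2 mul1r.
have h2 : u2 ^+ 2 + v2 ^+ 2 = 1 by rewrite v2E exprMn e2 mul1r addrC.
have h12 : u1 * u2 + v1 * v2 = 0.
  rewrite v1E v2E; transitivity (u1 * u2 * (1 - e ^+ 2)); first by ring.
  by rewrite e2 subrr mulr0.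
case: p => p1 p2; rewrite /frame_coord /=; split=> [[<- <-]|[-> ->]]; congr (_, _).
- transitivity (A.1 + (u1 ^+ 2 + v1 ^+ 2) * (p1 - A.1) + (u1 * u2 + v1 * v2) * (p2 - A.2)); last by ring.
  by rewrite h1 h12; ring.
- transitivity (A.2 + (u1 * u2 + v1 * v2) * (p1 - A.1) + (u2 ^+ 2 + v2 ^+ 2) * (p2 - A.2)); last by ring.
  by rewrite h2 h12; ring.
- transitivity (x * (u1 ^+ 2 + u2 ^+ 2) + y * (u1 * v1 + u2 * v2)); first by ring.
  by rewrite uu uv; ring.
- transitivity (x * (u1 * v1 + u2 * v2) + y * (v1 ^+ 2 + v2 ^+ 2)); first by ring.
  by rewrite vv uv; ring.
Qed.

End rigid_motion.

Section rectangle_frame.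
Context {R : realType}.
Variables (a b : R) (A B C D : R * R).
Hypotheses (a0 : 0 < a) (b0 : 0 < b) (ABCD : is_rectangle a b A B C D).

Let phi := frame_coord A ((B.1 - A.1) / a) ((B.2 - A.2) / a)
  ((D.1 - A.1) / b) ((D.2 - A.2) / b).

Let unit_edge (p : R * R) (l : R) : 0 < l -> eucl_dist A p = l ->
  ((p.1 - A.1) / l) ^+ 2 + ((p.2 - A.2) / l) ^+ 2 = 1.
Proof.
move=> l0 Apl; have : (p.1 - A.1) ^+ 2 + (p.2 - A.2) ^+ 2 = l ^+ 2.
  rewrite -Apl sqr_sqrtr ?addr_ge0 ?sqr_ge0//; ring.
by rewrite !expr_div_n -mulrDl => ->; rewrite divff// sqrf_eq0 gt_eqF.
Qed.

Let uu : ((B.1 - A.1) / a) ^+ 2 + ((B.2 - A.2) / a) ^+ 2 = 1.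
Proof. by have [AB _ _ _] := ABCD; exact: unit_edge. Qed.
Let vv : ((D.1 - A.1) / b) ^+ 2 + ((D.2 - A.2) / b) ^+ 2 = 1.
Proof. by have [_ AD _ _] := ABCD; exact: unit_edge. Qed.
Let uv : (B.1 - A.1) / a * ((D.1 - A.1) / b) + (B.2 - A.2) / a * ((D.2 - A.2) / b) = 0.
Proof. by have [_ _ o _] := ABCD; rewrite mulrACA [X in _ + X]mulrACA -mulrDl o mul0r. Qed.

Lemma distance_law_rectangle S1 S2 f F : measurable S1 -> measurable S2 ->
  distance_law S1 S2 f F -> distance_law (phi @^-1` S1) (phi @^-1` S2) f F.
Proof.
apply: distance_law_transport; first exact: measurable_frame_coord.
- by move=> E; exact: lebesgue2_frame_coord.
- by move=> p q; exact: eucl_dist_frame_coord.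
Qed.

Let phiP p x y : phi p = (x, y) <->
  p = (A.1 + x * ((B.1 - A.1) / a) + y * ((D.1 - A.1) / b),
       A.2 + x * ((B.2 - A.2) / a) + y * ((D.2 - A.2) / b)).
Proof. exact: frame_coordP. Qed.

Let na : a != 0. Proof. by rewrite gt_eqF. Qed.
Let nb : b != 0. Proof. by rewrite gt_eqF. Qed.

Lemma parallelogramE : parallelogram A B D = phi @^-1` rect0 a b.
Proof.
apply/seteqP; split => p /=.
  move=> [s [t [/andP[s0 s1] /andP[t0 t1] pE]]].
  have -> : phi p = (s * a, t * b).
    by apply/phiP; rewrite pE; congr (_, _); field; rewrite na nb.
  by split; rewrite /= in_itv/= mulr_ge0 ?(ltW a0) ?(ltW b0)//= ger_pMl.
case E : (phi p) => [x y] [] /=; rewrite !in_itv/= => /andP[x0 xa] /andP[y0 yb].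
have /phiP pE := E.
exists (x / a), (y / b); split.
- by rewrite divr_ge0 ?(ltW a0)//= ler_pdivrMr ?mul1r.
- by rewrite divr_ge0 ?(ltW b0)//= ler_pdivrMr ?mul1r.
- by rewrite pE; congr (_, _); field; rewrite na nb.
Qed.

(** The weights at [B] and [D] are the frame coordinates divided by a and by b; the weight at [A] is
    nonnegative exactly when b x + a y <= a b. *)
Lemma triangle_ABDE : triangle A B D = phi @^-1` tri0 a b.
Proof.
apply/seteqP; split => p /=.
  move=> [x [y [z [x0 y0 z0 s1 pE]]]].
  have -> : phi p = (y * a, z * b).
    apply/phiP; rewrite pE (_ : x = 1 - y - z); last by lra.
    by congr (_, _); field; rewrite na nb.
  split; rewrite /= ?mulr_ge0 ?(ltW a0) ?(ltW b0)//.
  by have := mulr_ge0 x0 (mulr_ge0 (ltW a0) (ltW b0)); rewrite (_ : x = 1 - y - z); lra.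
case E : (phi p) => [x y] [] /= x0 y0 xy.
have /phiP pE := E.
exists (1 - x / a - y / b), (x / a), (y / b); split.
- rewrite (_ : _ - _ = (a * b - (b * x + a * y)) / (a * b)); last by field; rewrite na nb.
  by rewrite divr_ge0 ?subr_ge0// mulr_ge0 ?(ltW a0) ?(ltW b0).
- by rewrite divr_ge0// ltW.
- by rewrite divr_ge0// ltW.
- by ring.
- by rewrite pE; congr (_, _); field; rewrite na nb.
Qed.

(** The half-turn sends A, B, D to C, D, B in this order, so the weights at C, D, B are the
    barycentric coordinates of the turned point in [tri0]. *)
Lemma triangle_CDBE : triangle C D B = phi @^-1` tri1 a b.
Proof.
have [_ _ _ ->] := ABCD.
apply/seteqP; split => p /=.
  move=> [x [y [z [x0 y0 z0 s1 pE]]]].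
  have E : phi p = ((1 - y) * a, (1 - z) * b).
    apply/phiP; rewrite pE (_ : x = 1 - y - z); last by lra.
    by rewrite /=; congr (_, _); field; rewrite na nb.
  rewrite /tri1 /= E /central_symmetry /=; split => /=.
  - by rewrite (_ : _ + _ = y * a); [rewrite mulr_ge0 ?(ltW a0) ?(ltW b0)|ring].
  - by rewrite (_ : _ + _ = z * b); [rewrite mulr_ge0 ?(ltW a0) ?(ltW b0)|ring].
  by have := mulr_ge0 x0 (mulr_ge0 (ltW a0) (ltW b0)); rewrite (_ : x = 1 - y - z); lra.
rewrite /tri1 /=; case E : (phi p) => [x y]; rewrite /central_symmetry => -[] /= x0 y0 xy.
have /phiP pE := E.
exists (x / a + y / b - 1), (1 - x / a), (1 - y / b); split.
- rewrite (_ : _ - _ = (b * x + a * y - a * b) / (a * b)); last by field; rewrite na nb.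
  by rewrite divr_ge0 ?mulr_ge0 ?(ltW a0) ?(ltW b0)//; lra.
- by rewrite subr_ge0 ler_pdivrMr// mul1r; lra.
- by rewrite subr_ge0 ler_pdivrMr// mul1r; lra.
- by ring.
- by rewrite pE /=; congr (_, _); field; rewrite na nb.
Qed.

End rectangle_frame.

Theorem mainTheorem4 (R : realType) (a b : R) (A B C D : R * R) :
  0 < a -> a <= b -> is_rectangle a b A B C D ->
  [/\ distance_law (parallelogram A B D) (parallelogram A B D)
        (gR a b) (GR a b),
      distance_law (triangle A B D) (triangle A B D) (gT a b) (GT a b) &
      distance_law (triangle A B D) (triangle C D B)
        (fun t => 2 * gR a b t - gT a b t)
        (fun t => 2 * GR a b t - GT a b t)].
Proof.
move=> a0 ab ABCD; have b0 := lt_le_trans a0 ab.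
rewrite (parallelogramE a0 b0 ABCD) (triangle_ABDE a0 b0 ABCD) (triangle_CDBE a0 b0 ABCD).
split; apply: (distance_law_rectangle a0 b0 ABCD).
- exact: measurable_rect0.
- exact: measurable_rect0.
- exact: distance_law_rect0.
- exact: measurable_tri0.
- exact: measurable_tri0.
- exact: distance_law_tri0.
- exact: measurable_tri0.
- exact: measurable_tri1.
- exact: distance_law_tri0_tri1.
Qed.
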